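(* Let $p,q\ge 1$ and $h\ge 0$ be integers. Then the ring $\mathfrak R_h=\mathfrak R/\mathfrak R[h+1]$ has a $\mathbb Z$-basis given by the standard monomials of $\mathcal J_h$; that is, the images in $\mathfrak R_h$ of the elements $J_1J_2\cdots J_m$, where $J_1J_2\cdots J_m$ runs over the standard monomials with all $J_i\in\mathcal J_h$, form a $\mathbb Z$-basis of $\mathfrak R_h$ (distinct standard monomials giving distinct basis elements).
   Context: **Ring.** $\mathfrak R=\mathbb Z[x^{(k)}_{ij}\mid 1\le i\le p,\ 1\le j\le q,\ k\ge 0]$ with the derivation $\partial x^{(k)}_{ij}=(k+1)x^{(k+1)}_{ij}$. The normalized derivative $\bar\partial^n=\frac1{n!}\partial^n$ maps $\mathfrak R$ to itself. For $1\le u_1<\dots<u_h\le p$ and $1\le v_1<\dots<v_h\le q$, the symbol $(u_h,\dots,u_1|v_1,\dots,v_h)$ denotes the $h$-minor $\det\big(x^{(0)}_{u_iv_j}\big)_{1\le i,j\le h}$. $\mathfrak R[h]$ is the ideal of $\mathfrak R$ generated by all $\bar\partial^nB$, $n\ge 0$, $B$ an $h$-minor (zero if $h>\min(p,q)$). **$\bar\partial$-lists.** $\mathcal J$ is the set of symbols $J=\bar\partial^n(u_h,\dots,u_1|v_1,\dots,v_h)$, $n\ge0$, $h\ge1$, $u_i<u_{i+1}$, $v_i<v_{i+1}$, each representing the corresponding element of $\mathfrak R$; $wt(J)=n$, $sz(J)=h$; $\mathcal J_h=\{J\in\mathcal J\mid sz(J)\le h\}$. **The set $\mathcal E$.** $\mathcal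 E$ is the set of $E=((u_h,k_h),\dots,(u_1,k_1)|(v_1,l_1),\dots,(v_h,l_h))$ with $h\geq 1$, $1\le u_i\le p$, $1\le v_i\le q$, the $u_i$ pairwise distinct, the $v_i$ pairwise distinct, and $k_i,l_i\in\mathbb Z_{\ge0}$. Put $||E||=\bar\partial^n(u_{\sigma(h)},\dots,u_{\sigma(1)}|v_{\sigma'(1)},\dots,v_{\sigma'(h)})\in\mathcal J$, where $n=\sum k_i+\sum l_i$ and $\sigma,\sigma'$ are the permutations sorting the $u$'s and $v$'s increasingly. For $J\in\mathcal J$, $\mathcal E(J)=\{E\in\mathcal E\mid ||E||=J\}$. **Orders.** Pairs: $(u,k)\le(u',k')$ iff $k<k'$, or $k=k'$ and $u\le u'$. Partial order on $\mathcal E$: for $E=((u_h,k_h),\dots,(u_1,k_1)|(v_1,l_1),\dots,(v_h,l_h))$ and $E'=((u'_{h'},k'_{h'}),\dots,(u'_1,k'_1)|(v'_1,l'_1),\dots,(v'_{h'},l'_{h'}))$ in $\mathcal E$, $E\le E'$ iff $h'\le h$ and $(u_i,k_i)\le(u'_i,k'_i)$, $(v_i,l_i)\le(v'_i,l'_i)$ for $1\le i\le h'$. Total order on $\mathcal E$: $E\prec E'$ iff $h>h'$; or $h=h'$ and $\sum(k_i+l_i)<\sum(k'_i+l'_i)$; or these are equal and the word $(u_h,k_h)\cdots(u_1,k_1)(v_h,l_h)\cdots(v_1,l_1)$ is lexicographically smaller than $(u'_{h'},k'_{h'})\cdots(u'_1,k'_1)(v'_{h'},l'_{h'})\cdots(v'_1,l'_1)$.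 **Standard monomials.** An ordered product $E_1\cdots E_m$ of elements of $\mathcal E$ is standard if (1) $E_a\le E_{a+1}$ for $1\le a<m$; (2) $E_1$ is the largest element of $\mathcal E(||E_1||)$ under $\prec$; (3) for each $a$, $E_{a+1}$ is the largest (under $\prec$) among those elements $F$ of $\mathcal E(||E_{a+1}||)$ with $E_a\le F$. An ordered product $J_1\cdots J_m$ of elements of $\mathcal J$ is standard (a standard monomial) if there is a standard $E_1\cdots E_m$ with $E_i\in\mathcal E(J_i)$ for all $i$. The empty product $1$ ($m=0$) is counted as standard. A standard monomial of $\mathcal J_h$ is one with all factors in $\mathcal J_h$. *)

(* Defs.v *)
From HB Require Import structures.
From mathcomp Require Import all_boot all_order all_algebra.
From mathcomp Require Import finmap.
From mathcomp.multinomials Require Import monalg.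
From mathcomp.classical Require Import boolp.

Set Implicit Arguments.
Unset Strict Implicit.
Unset Printing Implicit Defensive.

Import Order.TTheory GRing.Theory Num.Theory.
Local Open Scope ring_scope.

Fact leibniz_term (S : comNzRingType) (a b : nat) (x y z t u v : S) :
    y *+ a = z * v *+ a -> y *+ b = u * t *+ b ->
  y * x *+ (a + b) = z * x *+ a * v + u * (t * x *+ b).
Proof.
move=> e1 e2; rewrite mulrnDr -!mulrnAl e1 e2 !mulrnAl mulrnAr !mulrA.
by rewrite mulrAC.
Qed.

Fact leibniz_mulz (S : comNzRingType) (d : {additive S -> S}) (a b : int)
    (x y : S) :
    d (x * y) = d x * y + x * d y ->
  d (x *~ a * (y *~ b)) = d (x *~ a) * (y *~ b) + x *~ a * d (y *~ b).
Proof.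
by move=> e; rewrite !raddfMz !(mulrzAl, mulrzAr) !raddfMz /= e -!mulrzDl.
Qed.

Section IterLeibniz.
Variables (S : comNzRingType) (d : {additive S -> S}).
Hypothesis dM : forall x y, d (x * y) = d x * y + x * d y.

Fact iter_leibniz n x y :
  iter n d (x * y) =
  \sum_(i < n.+1) iter (n - i) d x * iter i d y *+ 'C(n, i).
Proof.
elim: n => [|n IH]; first by rewrite big_ord_recl big_ord0 /= addr0.
rewrite iterS IH raddf_sum /=.
under eq_bigr => i _ do
  rewrite raddfMn /= dM -!iterS -(subSn (leq_ord i)) mulrnDl.
rewrite big_split /= [RHS]big_ord_recl [X in X + _]big_ord_recl /=.
rewrite !bin0 -addrA; congr (_ + _).
rewrite big_ord_recr [in RHS]big_ord_recr /= addrA; congr (_ + _); last first.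
  by rewrite subnn !binn /bump add1n subnn.
rewrite -big_split /=; apply: eq_bigr => i _.
by rewrite /bump add1n subSS binS mulrnDr.
Qed.

Definition divided x := forall n, exists y, iter n d x = y *+ n`!.

Fact dividedM x y : divided x -> divided y -> divided (x * y).
Proof.
move=> hx hy n.
have [u Hu] := boolp.choice (hx : forall k, exists z, iter k d x = z *+ k`!).
have [v Hv] := boolp.choice (hy : forall k, exists z, iter k d y = z *+ k`!).
exists (\sum_(i < n.+1) u (n - i)%N * v i).
rewrite iter_leibniz -sumrMnl; apply: eq_bigr => i _.
rewrite Hu Hv mulrnAr mulrnAl -!mulrnA.
by rewrite mulnCA mulnA mulnC (bin_fact (leq_ord i)).
Qed.

Fact dividedMz x a : divided x -> divided (x *~ a).
Proof.
move=> hx n; have [y Hy] := hx n; exists (y *~ a).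
suff -> : iter n d (x *~ a) = iter n d x *~ a by rewrite Hy !pmulrn mulrzAC.
by elim: n {hx y Hy} => //= n ->; rewrite raddfMz.
Qed.

Fact dividedD x y : divided x -> divided y -> divided (x + y).
Proof.
move=> hx hy n; have [u Hu] := hx n; have [v Hv] := hy n; exists (u + v).
rewrite mulrnDl -Hu -Hv.
by elim: n {hx hy u v Hu Hv} => //= n ->; rewrite raddfD.
Qed.

Fact divided1 : divided 1.
Proof.
have d1 : d 1 = 0.
  have /eqP := dM 1 1; rewrite !mul1r mulr1 -{1}[d 1]addr0.
  by rewrite (inj_eq (addrI _)) => /eqP.
case=> [|n]; first by exists 1.
by exists 0; rewrite mul0rn iterSr d1; elim: n => //= n ->; rewrite raddf0.
Qed.

Fact divided0 : divided 0.
Proof. by rewrite -(mulr0z 1); apply: dividedMz divided1. Qed.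

End IterLeibniz.

Section Derivation.
Variable I : choiceType.
Local Notation R := {malg int[{cmonom I}]}.
Implicit Types (f g : R) (m : {cmonom I}).
Variable D : I -> R.

Definition deriv_mon m : R :=
  \sum_(i <- finsupp m) << divcm m (ucm i) >> * D i *+ m i.

(* The derivation of Z[X_i | i in I] that extends X_i |-> D i: see
   derivation_var and derivationM. *)
Definition derivation f : R := \sum_(m <- msupp f) deriv_mon m *~ f@_m.

(* The division by n! is exact on every coefficient if the n-th
   derivative of every X_i is divisible by n!: see nderivE. *)
Definition nderiv (n : nat) f : R :=
  let g := iter n derivation f in
  \sum_(m <- msupp g) << (g@_m %/ n`!)%Z *g m >>.

Lemma derivationE f : derivation f = mmap intr deriv_mon f.
Proof. by rewrite /derivation mmapE; apply: eq_bigr => m _; rewrite mulrzl. Qed.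

Lemma derivation_is_zmod_morphism : zmod_morphism derivation.
Proof. by move=> f g; rewrite !derivationE mmapB. Qed.

HB.instance Definition _ :=
  GRing.isZmodMorphism.Build R R derivation derivation_is_zmod_morphism.

Lemma derivationU m : derivation << m >> = deriv_mon m.
Proof. by rewrite derivationE mmapU mul1r. Qed.

Lemma deriv_monEw (d : {fset I}) m : (finsupp m `<=` d)%fset ->
  deriv_mon m = \sum_(i <- d) << divcm m (ucm i) >> * D i *+ m i.
Proof.
move=> le; rewrite /deriv_mon (big_fset_incl _ le) //= => i _.
by rewrite -cmE_eq0 => /eqP ->.
Qed.

Lemma malgUM m1 m2 : << mulcm m1 m2 >> = << m1 >> * << m2 >> :> R.
Proof. by rewrite malgM_def fgmulUU mulr1. Qed.

Lemma derivation_var i : derivation << ucm i >> = D i.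
Proof.
rewrite derivationU /deriv_mon mdomU big_seq_fset1 cmUU mulr1n.
have -> : divcm (ucm i) (ucm i) = onecm _.
  by apply/eqP/cmP => j; rewrite divcmE onecmE subnn.
by rewrite mul1r.
Qed.

Lemma divcmMl m1 m2 i :
  << divcm (mulcm m1 m2) (ucm i) >> *+ m1 i =
  << divcm m1 (ucm i) >> * << m2 >> *+ m1 i :> R.
Proof.
case: (posnP (m1 i)) => [->|m1i]; first by [].
congr (_ *+ _); rewrite -malgUM; congr << _ >>.
apply/eqP/cmP => j; rewrite divcmE !mulcmE divcmE ucmE.
by case: eqVneq => [<-|_]; rewrite ?subn0 // addnBAC.
Qed.

Lemma divcmMr m1 m2 i :
  << divcm (mulcm m1 m2) (ucm i) >> *+ m2 i =
  << m1 >> * << divcm m2 (ucm i) >> *+ m2 i :> R.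
Proof.
rewrite mulcmC; apply: etrans (divcmMl _ _ _) _.
move: << divcm _ _ >> << m1 >> (m2 i) => x y k.
by rewrite (mulrC x y).
Qed.

Lemma deriv_monM m1 m2 :
  deriv_mon (mulcm m1 m2) = deriv_mon m1 * << m2 >> + << m1 >> * deriv_mon m2.
Proof.
have le1 : (finsupp m1 `<=` finsupp m1 `|` finsupp m2)%fset by apply: fsubsetUl.
have le2 : (finsupp m2 `<=` finsupp m1 `|` finsupp m2)%fset by apply: fsubsetUr.
rewrite (deriv_monEw le1) (deriv_monEw le2).
rewrite (@deriv_monEw (finsupp m1 `|` finsupp m2)%fset); last by rewrite mdomD.
rewrite mulr_suml [X in _ = _ + X]mulr_sumr -big_split.
apply: eq_bigr => i _ /=; rewrite mulcmE.
move: (divcmMl m1 m2 i) (divcmMr m1 m2 i).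
exact: leibniz_term.
Qed.

Lemma malg_intE f : f = \sum_(m <- msupp f) << m >> *~ f@_m.
Proof.
rewrite {1}[f]monalgE; apply: eq_bigr => m _.
by rewrite -raddfMz /= intz.
Qed.

Lemma derivationM f g :
  derivation (f * g) = derivation f * g + f * derivation g.
Proof.
rewrite [f]malg_intE [g]malg_intE.
rewrite mulr_suml !raddf_sum mulr_suml [X in _ = _ + X]mulr_suml -big_split /=.
apply: eq_bigr => m1 _.
rewrite mulr_sumr !raddf_sum mulr_sumr [X in _ = _ + X]mulr_sumr -big_split /=.
apply: eq_bigr => m2 _.
apply: leibniz_mulz; rewrite -[X in derivation X = _]malgUM.
by rewrite [LHS]derivationU deriv_monM -[deriv_mon m1]derivationU
  -[deriv_mon m2]derivationU.
Qed.

Lemma dividedU m :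
  (forall i, divided derivation << ucm i >>) -> divided derivation << m >>.
Proof.
move=> hX; have [n] := ubnP (mdeg m); elim: n m => // n IH m.
have [[i mi]|m0] := pselect (exists i, m i != 0%N); last first.
  suff -> : m = onecm _ by move=> _; exact: (divided1 derivationM).
  apply/eqP/cmP => i; rewrite onecmE; apply/eqP; apply: contra_notT m0.
  by exists i.
have -> : m = mulcm (ucm i) (divcm m (ucm i)).
  apply/eqP/cmP => j; rewrite mulcmE divcmE ucmE subnKC //.
  by case: eqVneq => [<-|_] //; rewrite lt0n.
rewrite mdegM mdegU add1n ltnS => lt; rewrite malgUM.
by apply: (dividedM derivationM (hX i)); exact: IH.
Qed.

Lemma derivation_divided f :
  (forall i, divided derivation << ucm i >>) -> divided derivation f.
Proof.
move=> hX; rewrite [f]malg_intE.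
apply: (big_ind (divided derivation)); first exact: (divided0 derivationM).
  by move=> x y; exact: dividedD.
by move=> m _; apply: dividedMz; exact: dividedU.
Qed.

Lemma nderivE n f : (forall i, divided derivation << ucm i >>) ->
  nderiv n f *+ n`! = iter n derivation f.
Proof.
move=> hX; have [g Hg] := derivation_divided f hX n.
rewrite /nderiv /= Hg -sumrMnl [RHS]monalgE; apply: eq_bigr => m _.
rewrite -raddfMn /=; congr << _ *g _ >>.
rewrite -mulr_natr natz divzK //.
by rewrite mcoeffMn -mulr_natr natz dvdz_mull.
Qed.

Lemma mcoeff_nderiv n f m :
  (nderiv n f)@_m = ((iter n derivation f)@_m %/ n`!)%Z.
Proof.
rewrite /nderiv /=; move: (iter n _ f) => g; rewrite raddf_sum /=.
under eq_bigr => k _ do rewrite mcoeffU.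
case: msuppP => [mg|mg]; last first.
  rewrite div0z big_seq big1 // => k kg.
  by case: eqVneq kg mg => // -> ->.
rewrite (big_fsetD1 m) //= eqxx mulr1n big1_seq ?addr0 // => k /andP [_].
by rewrite in_fsetD1 => /andP [/negPf -> _].
Qed.

Lemma mcoeff1M f g :
  (f * g)@_(mone : {cmonom _}) =
  f@_(mone : {cmonom _}) * g@_(mone : {cmonom _}).
Proof. by case: (mcoeff1g_is_multiplicative {cmonom I} int) => + _; apply. Qed.

Lemma mcoeff1_derivation f :
  (forall i, (D i)@_(mone : {cmonom _}) = 0) ->
  (derivation f)@_(mone : {cmonom _}) = 0.
Proof.
move=> hD; rewrite /derivation raddf_sum big1 // => m _.
rewrite raddfMz /= /deriv_mon raddf_sum big1 ?mul0rz // => i _.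
by rewrite raddfMn /= mcoeff1M hD mulr0 mul0rn.
Qed.

End Derivation.

(* Row and column indices start at 0. *)
Definition arc_idx (p q : nat) : choiceType :=
  Choice.clone ('I_p * 'I_q * nat)%type _.

Notation arc_ring p q := {malg int[{cmonom arc_idx p q}]}.

Section ArcRing.
Variables p q : nat.

Definition xvar (i : 'I_p) (j : 'I_q) (k : nat) : arc_ring p q :=
  << ucm ((i, j, k) : arc_idx p q) >>.

Definition arc_deriv_var (z : arc_idx p q) : arc_ring p q :=
  let: (i, j, k) := z in xvar i j k.+1 *+ k.+1.

Definition arc_deriv : arc_ring p q -> arc_ring p q := derivation arc_deriv_var.

Definition arc_nderiv : nat -> arc_ring p q -> arc_ring p q :=
  nderiv arc_deriv_var.

Lemma arc_deriv_xvar i j k : arc_deriv (xvar i j k) = xvar i j k.+1 *+ k.+1.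
Proof. exact: derivation_var. Qed.

Lemma arc_nderivE n f : arc_nderiv n f *+ n`! = iter n arc_deriv f.
Proof.
apply: nderivE => -[[i j] k] {f}n; exists (xvar i j (n + k) *+ 'C(n + k, n)).
rewrite -mulrnA bin_ffact; elim: n => [|n IH]; first by rewrite ffactn0 mulr1n.
rewrite iterS IH raddfMn /= [derivation _ _]arc_deriv_xvar -mulrnA.
by rewrite ffactSS.
Qed.

End ArcRing.

Section Symbols.
Variables p q : nat.

(* The minor (u_h,...,u_1|v_1,...,v_h) is encoded as the sequence
   [:: (u_1, v_1); ...; (u_h, v_h)]. *)
Definition minor (s : seq ('I_p * 'I_q)) : arc_ring p q :=
  let t := in_tuple s in
  \det (\matrix_(i < size s, j < size s) xvar (tnth t i).1 (tnth t j).2 0).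

Definition is_minor (s : seq ('I_p * 'I_q)) : bool :=
  [&& (0 < size s)%N, sorted ltn [seq val a.1 | a <- s]
    & sorted ltn [seq val a.2 | a <- s]].

(* J = (n, s) is the n-th normalized derivative of the minor s. *)
Definition Jsym : Type := {J : nat * seq ('I_p * 'I_q) | is_minor J.2}.
HB.instance Definition _ := Choice.on Jsym.

Definition Jwt (J : Jsym) : nat := (val J).1.
Definition Jsz (J : Jsym) : nat := size (val J).2.
Definition Jval (J : Jsym) : arc_ring p q :=
  arc_nderiv (Jwt J) (minor (val J).2).

(* ((u_h,k_h),...,(u_1,k_1)|(v_1,l_1),...,(v_h,l_h)) is encoded as the sequence
   [:: ((u_1, k_1), (v_1, l_1)); ...; ((u_h, k_h), (v_h, l_h))]. *)
Definition is_E (s : seq (('I_p * nat) * ('I_q * nat))) : bool :=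
  [&& (0 < size s)%N, uniq [seq a.1.1 | a <- s] & uniq [seq a.2.1 | a <- s]].

Definition Esym : Type := {s : seq (('I_p * nat) * ('I_q * nat)) | is_E s}.
HB.instance Definition _ := Choice.on Esym.

Definition Ewt (E : Esym) : nat := \sum_(a <- val E) (a.1.2 + a.2.2)%N.

Definition ord_leq (n : nat) : rel 'I_n := fun i j => (i <= j)%N.

Definition Enorm_val (E : Esym) : nat * seq ('I_p * 'I_q) :=
  (Ewt E, zip (sort (@ord_leq p) [seq a.1.1 | a <- val E])
              (sort (@ord_leq q) [seq a.2.1 | a <- val E])).

Fact sort_ord_ltn n (s : seq 'I_n) :
  uniq s -> sorted ltn (map val (sort (@ord_leq n) s)).
Proof.
move=> us; rewrite ltn_sorted_uniq_leq (map_inj_uniq val_inj) sort_uniq us /=.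
by rewrite sorted_map; apply: sort_sorted => i j; apply: leq_total.
Qed.

Fact Enorm_subproof E : is_minor (Enorm_val E).2.
Proof.
have /and3P [s0 u1 u2] := valP E; rewrite /is_minor /=.
set s := sort _ _; set t := sort _ _.
have est : size s = size t by rewrite !size_sort !size_map.
rewrite size_zip -est minnn size_sort size_map s0 /=.
have -> : [seq val a.1 | a <- zip s t] = map val s.
  by rewrite (map_comp val fst) -/(unzip1 _) unzip1_zip ?est.
have -> : [seq val a.2 | a <- zip s t] = map val t.
  by rewrite (map_comp val snd) -/(unzip2 _) unzip2_zip ?est.
by rewrite !sort_ord_ltn.
Qed.

Definition Enorm (E : Esym) : Jsym := exist _ (Enorm_val E) (Enorm_subproof E).

(* (u, k) <= (u', k') is the lexicographic order on the swapped pairs (k, u). *)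
Definition letter n (a : 'I_n * nat) : nat *l nat := (a.2, val a.1).

(* zip drops the entries of E whose index exceeds the size of E'. *)
Definition Ele (E E' : Esym) : bool :=
  (size (val E') <= size (val E))%N &&
  all (fun ab => (letter ab.1.1 <= letter ab.2.1)%O &&
                 (letter ab.1.2 <= letter ab.2.2)%O) (zip (val E) (val E')).

Definition Eword (E : Esym) : seqlexi (nat *l nat) :=
  [seq letter a.1 | a <- rev (val E)] ++ [seq letter a.2 | a <- rev (val E)].

Definition Eprec (E E' : Esym) : bool :=
  let h := size (val E) in let h' := size (val E') in
  (h' < h)%N ||
  (h == h') && ((Ewt E < Ewt E')%N ||
                (Ewt E == Ewt E') && (Eword E < Eword E')%O).

Definition largest (S : Esym -> Prop) (E : Esym) : Prop :=
  S E /\ forall F, S F -> F = E \/ Eprec F E.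

Fixpoint standard_from (E : Esym) (s : seq Esym) : Prop :=
  if s is F :: s' then
    [/\ Ele E F, largest (fun G => Enorm G = Enorm F /\ Ele E G) F
      & standard_from F s']
  else True.

Definition Estandard (s : seq Esym) : Prop :=
  if s is E :: s' then
    largest (fun G => Enorm G = Enorm E) E /\ standard_from E s'
  else True.

Definition Jstandard (s : seq Jsym) : Prop :=
  exists t : seq Esym, Estandard t /\ map Enorm t = s.

End Symbols.

Definition ideal_gen (R : comNzRingType) (S : R -> Prop) (f : R) : Prop :=
  exists s : seq (R * R),
    (forall a, a \in s -> S a.2) /\ f = \sum_(a <- s) a.1 * a.2.

Fact ideal_genMD (R : comNzRingType) (S : R -> Prop) a x y :
  ideal_gen S x -> ideal_gen S y -> ideal_gen S (a * x + y).
Proof.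
move=> [s [hs ->]] [t [ht ->]].
exists ([seq (a * b.1, b.2) | b <- s] ++ t); split.
  move=> b; rewrite mem_cat => /orP [/mapP [c cs ->]|]; last exact: ht.
  exact: hs cs.
rewrite big_cat big_map mulr_sumr /=; congr (_ + _).
by apply: eq_bigr => b _; rewrite mulrA.
Qed.

Lemma mcoeff1_xvar p q (i : 'I_p) (j : 'I_q) k :
  (xvar i j k)@_(mone : {cmonom _}) = 0.
Proof. by rewrite mcoeffU1 cm1_eq1. Qed.

Lemma mcoeff1_Jval p q (J : Jsym p q) : (Jval J)@_(mone : {cmonom _}) = 0.
Proof.
rewrite mcoeff_nderiv.
case: J => -[n s] /= Js; case: n => [|n] /=; last first.
  rewrite mcoeff1_derivation ?div0z // => -[[i j] k].
  by rewrite raddfMn /= mcoeff1_xvar mul0rn.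
suff -> : (minor s)@_(mone : {cmonom _}) = 0 by rewrite div0z.
have /and3P [s0 _ _] := Js; rewrite /minor -[LHS]det_map_mx.
have -> : map_mx (mcoeff (mone : {cmonom _}))
    (\matrix_(i, j) xvar (tnth (in_tuple s) i).1 (tnth (in_tuple s) j).2 0) = 0.
  by apply/matrixP => i j; rewrite !mxE mcoeff1_xvar.
by case: (size s) s0 => [|k] // _; rewrite det0.
Qed.

Section ArcIdeal.
Variables p q h : nat.

Definition arc_ideal : {pred arc_ring p q} := fun f =>
  `[< ideal_gen (fun g => exists2 J : Jsym p q, Jsz J = h & g = Jval J) f >].

Lemma arc_ideal_idealr_closed : idealr_closed arc_ideal.
Proof.
split.
- by apply/asboolP; exists [::]; rewrite big_nil.
- apply/asboolP => -[s [hs e]].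
  suff : (1 : arc_ring p q)@_(mone : {cmonom _}) = 0 by rewrite mcoeff1 eqxx.
  rewrite e raddf_sum big1_seq //= => a /hs [J _ ->].
  by rewrite mcoeff1M mcoeff1_Jval mulr0.
- by move=> a x y /asboolP hx /asboolP hy; apply/asboolP; apply: ideal_genMD.
Qed.

HB.instance Definition _ := isIdealr.Build (arc_ring p q) arc_ideal
  arc_ideal_idealr_closed.

End ArcIdeal.

Arguments arc_ideal p q h : clear implicits.

(* The family b restricted to S is a Z-basis of V; linear independence forces b
   to be
   injective on S. *)
Definition Zbasis (V : zmodType) (I : eqType) (S : I -> Prop) (b : I -> V) :=
  (forall (s : seq I) (c : I -> int), uniq s -> (forall i, i \in s -> S i) ->
     \sum_(i <- s) b i *~ c i = 0 -> forall i, i \in s -> c i = 0) /\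
  (forall v : V, exists (s : seq I) (c : I -> int),
     (forall i, i \in s -> S i) /\ v = \sum_(i <- s) b i *~ c i).

(* Main.v *)
From HB Require Import structures.
Require Import Defs.
From mathcomp Require Import all_boot all_order all_algebra.
From mathcomp Require Import finmap.
From mathcomp.multinomials Require Import monalg.
From mathcomp.classical Require Import boolp.
From mathcomp Require Import fingroup perm.
From mathcomp Require Import zify ring.

Set Implicit Arguments.
Unset Strict Implicit.
Unset Printing Implicit Defensive.

Import Order.TTheory GRing.Theory Num.Theory.
Local Open Scope ring_scope.
Local Open Scope quotient_scope.

(** Straightening and leading monomials for derivatives of minors.

    Put x_ij(T) = sum_k x_ij^(k) T^k. The normalized n-th derivative of a minor
    is the coefficient of T^n in the same minor of the matrix (x_ij(T)), because
    f |-> exp(T d) f is a ring homomorphism (nderiv_minor). So the symbols are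
    coefficients of determinants of power series.

    Spanning. Let F be the symbol chosen for a factor of a standard prefix, o
    being the factor before it, and let j be a symbol none of whose
    representatives lies above F. The straightening law (straighten) says that
    the product of F and j lies in the ideal generated by the symbols j' below
    F: all the representatives of j' above o precede F. As the order on
    representatives is well founded (Eprec_ind) and degrees are preserved,
    products can be rewritten until they are standard (standard_reduces,
    span_all). This needs no bound on the sizes of the minors. A standard
    monomial with a factor of size > h vanishes in the quotient since by
    expansion along a row the larger minors lie in the ideal of those of size h
    + 1 (larger_vanish).

    The law comes from relations among products of a first minor and a second
    one that is not larger (exchange); let h' <= h be their sizes. Join their
    rows and their columns, give every row and every column a set of allowed
    colours, false for the first minor and true for the second one, and let an
    entry be the sum of x(T) if false is allowed at both of its ends and of z
    x(S T) if true is. The determinant is the sum over all colourings of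
    products of two complementary minors (det_compat, pure_bal); S records how
    the weight is distributed. Where both colours are free the entry is x(T) + z
    x(S T), in the ideal (1 + z, S - 1), so the determinant lies in a power of
    that ideal. If the minors of size > h vanish, few powers of z occur, and the
    part in which the second minor has size h' is divisible by a power of S - 1
    (type_sum_div). If moreover minors of small weight vanish, this part has few
    coefficients, and so it is zero (window_eq0).

    It remains to choose which rows and columns are freed. As F is largest in
    its class, its rows resist every exchange that would enlarge its word; from
    this two thresholds are found (row_thresholds), which define a set of free
    indices and a set of bad ones. The numbers of these indices, compared with
    the weight that j lacks for being placed above F (side_data), make every
    term vanish modulo the smaller symbols, except the product of F and j.

    Independence. Let h again be the bound of the theorem. The substitution of
    sum_l a_il(T) b_jl(T), with h summands, for x_ij(T) kills all minors of size
    > h. In the image of the product of a standard chain, put the i-th entry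
    ((u, k), (v, l)) of every factor into column i, that is, multiply all the
    variables a_ui^(k) and b_vi^(l): this monomial occurs in that image
    (phi_chain), and it occurs in the image of another standard product only if
    the chain of the latter is larger at the first place where the two chains
    differ (dominate). So in a linear relation a maximal chain has coefficient
    zero (quotient_free). *)

(** * Determinants and colourings of rows and columns *)

Section NatDet.
Variable S : comNzRingType.
Implicit Types F : nat -> nat -> S.

(** Entries are indexed by natural numbers, so that submatrices are given by
    sequences of indices and no dimension has to be cast. *)
Definition natdet n F : S := \det (\matrix_(i < n, j < n) F i j).

Lemma eq_natdet n F F' : (forall i j, (i < n)%N -> (j < n)%N -> F i j = F' i j) ->
  natdet n F = natdet n F'.
Proof. by move=> e; congr (\det _); apply/matrixP => i j; rewrite !mxE e. Qed.

Lemma natdet_tr n F : natdet n F = natdet n (fun i j => F j i).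
Proof. by rewrite /natdet -det_tr; congr (\det _); apply/matrixP => i j; rewrite !mxE. Qed.

Lemma natdet_coef0 n (F : nat -> nat -> {poly S}) :
  (\det (\matrix_(i < n, j < n) F i j))`_0 = natdet n (fun i j => (F i j)`_0).
Proof.
rewrite -horner_coef0 -[LHS](det_map_mx (horner_eval (0 : S))); congr (\det _).
by apply/matrixP => i j; rewrite !mxE -horner_coef0.
Qed.

Lemma natdet_block a b F :
  (forall i j, (i < a)%N -> (a <= j < a + b)%N -> F i j = 0) ->
  (forall i j, (a <= i < a + b)%N -> (j < a)%N -> F i j = 0) ->
  natdet (a + b) F = natdet a F * natdet b (fun i j => F (a + i)%N (a + j)%N).
Proof.
move=> F0 F1.
rewrite /natdet -[RHS](det_ublock _ 0); congr (\det _); apply/matrixP => i j.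
rewrite !mxE; case: splitP => i' ->; rewrite !mxE; case: splitP => j' ->; rewrite ?mxE //.
  by rewrite F0 // leq_addr ltn_add2l /=.
by rewrite F1 // leq_addr ltn_add2l /=.
Qed.

Lemma natdet_perml (T : eqType) x0 (r r' : seq T) (F : T -> nat -> S) :
  perm_eq r r' -> exists b : bool,
  natdet (size r) (fun i j => F (nth x0 r i) j) =
  (-1) ^+ b * natdet (size r) (fun i j => F (nth x0 r' i) j).
Proof.
move=> e; have es := perm_size e.
have /tuple_permP [s es'] : perm_eq r (in_tuple r') by [].
have re : r = [seq nth x0 r' (s i) | i <- enum 'I_(size r')].
  by rewrite es'; apply: eq_map => i; rewrite (tnth_nth x0).
exists (odd_perm s); rewrite -det_perm es -det_mulmx -row_permE.
congr (\det _); apply/matrixP => i j; rewrite !mxE.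
congr (F _ _); rewrite {1}re (nth_map i) ?size_enum_ord //.
by rewrite nth_ord_enum.
Qed.

Lemma natdet_permlr (T U : eqType) x0 y0 (r r' : seq T) (c c' : seq U) (F : T -> U -> S) :
  perm_eq r r' -> perm_eq c c' -> size r = size c -> exists b : bool,
  natdet (size r) (fun i j => F (nth x0 r i) (nth y0 c j)) =
  (-1) ^+ b * natdet (size r) (fun i j => F (nth x0 r' i) (nth y0 c' j)).
Proof.
move=> er ec es.
have [b1 e1] := natdet_perml x0 (fun x j => F x (nth y0 c j)) er.
have [b2 e2] := natdet_perml y0 (fun y i => F (nth x0 r' i) y) ec.
exists (b1 (+) b2); rewrite e1 signr_addb -mulrA; congr (_ * _).
by rewrite natdet_tr es e2 natdet_tr.
Qed.

Lemma natdet_nuniql (T : eqType) x0 (r : seq T) (F : T -> nat -> S) :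
  ~~ uniq r -> natdet (size r) (fun i j => F (nth x0 r i) j) = 0.
Proof.
move=> /(uniqPn x0) [i [j [lij ljs e]]].
have li : (i < size r)%N by apply: ltn_trans ljs.
apply: (@determinant_alternate _ _ _ (Ordinal li) (Ordinal ljs)).
  by rewrite -val_eqE /= neq_ltn lij.
by move=> k; rewrite !mxE /= e.
Qed.

Section Pure.
Variables (N : nat) (Y : bool -> nat -> nat -> S).
Implicit Types (e : {ffun 'I_N -> bool}) (t : nat -> pred bool).

(** The colourings e of the rows and e' of the columns erase the entries whose
    row and column have different colours. *)
Definition pure e e' : S :=
  \det (\matrix_(i < N, j < N) if e i == e' j then Y (e i) i j else 0).

(** [t i] is the set of colours allowed at the index i. *)
Definition compat t : pred {ffun 'I_N -> bool} := fun e => [forall i : 'I_N, t i (e i)].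

Lemma det_sum_rows (G : 'I_N -> bool -> 'I_N -> S) :
  \det (\matrix_(i, j) \sum_b G i b j) =
  \sum_(e : {ffun 'I_N -> bool}) \det (\matrix_(i, j) G i (e i) j).
Proof.
rewrite /determinant exchange_big /=; apply: eq_bigr => s _.
under eq_bigr => i _ do rewrite mxE.
rewrite bigA_distr_bigA /= mulr_sumr; apply: eq_bigr => e _.
by congr (_ * _); apply: eq_bigr => i _; rewrite mxE.
Qed.

Lemma det_scale_rows (a : 'I_N -> S) (M : 'M[S]_N) :
  \det (\matrix_(i, j) (a i * M i j)) = (\prod_i a i) * \det M.
Proof.
rewrite /determinant mulr_sumr; apply: eq_bigr => s _.
rewrite mulrCA; congr (_ * _); rewrite -big_split /=.
by apply: eq_bigr => i _; rewrite mxE.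
Qed.

Lemma prod_bool (P : pred 'I_N) : \prod_i (P i)%:R = ([forall i, P i])%:R :> S.
Proof.
case: (boolP [forall i, P i]) => [/forallP h|].
  by rewrite big1 // => i _; rewrite h.
by rewrite negb_forall => /existsP [i /negPf h]; rewrite (bigD1 i) //= h mul0r.
Qed.

(** Multilinearity, in the rows and then in the columns: the colours allowed at
    both ends of an entry may be chosen once for each row and each column. *)
Lemma det_compat t t' :
  \det (\matrix_(i < N, j < N) \sum_(b : bool) (t i b && t' j b)%:R * Y b i j) =
  \sum_(e | compat t e) \sum_(e' | compat t' e') pure e e'.
Proof.
transitivity (\sum_(e : {ffun 'I_N -> bool}) \det (\matrix_(i < N, j < N)
    ((t i (e i))%:R * ((t' j (e i))%:R * Y (e i) i j)))).
  rewrite -(det_sum_rows (fun i b j => (t i b)%:R * ((t' j b)%:R * Y b i j))).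
  congr (\det _); apply/matrixP => i j; rewrite !mxE.
  by apply: eq_bigr => b _; rewrite -mulnb natrM mulrA.
rewrite [RHS]big_mkcond /=; apply: eq_bigr => e _.
transitivity ((\prod_(i < N) (t i (e i))%:R) * \det (\matrix_(i < N, j < N)
    ((t' j (e i))%:R * Y (e i) i j))).
  rewrite -det_scale_rows; congr (\det _).
  by apply/matrixP => i j; rewrite !mxE.
rewrite (prod_bool (fun i => t i (e i))) -/(compat t e).
case: (compat t e); last by rewrite mul0r.
rewrite mul1r -det_tr.
transitivity (\sum_(e' : {ffun 'I_N -> bool}) \det (\matrix_(j < N, i < N)
    ((t' j (e' j))%:R * (if e i == e' j then Y (e i) i j else 0)))).
  rewrite -(det_sum_rows (fun j b i => (t' j b)%:R * (if e i == b then Y (e i) i j else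
    0))).
  congr (\det _); apply/matrixP => j i; rewrite !mxE.
  rewrite (bigD1 (e i)) //= eqxx big1 ?addr0 // => b /negPf.
  by rewrite eq_sym => ->; rewrite mulr0.
rewrite [RHS]big_mkcond; apply: eq_bigr => e' _.
transitivity ((\prod_(j < N) (t' j (e' j))%:R) * \det (\matrix_(j < N, i < N)
    (if e i == e' j then Y (e i) i j else 0))).
  rewrite -det_scale_rows; congr (\det _).
  by apply/matrixP => i j; rewrite !mxE.
rewrite (prod_bool (fun i => t' i (e' i))) -/(compat t' e').
case: (compat t' e'); last by rewrite mul0r.
rewrite mul1r -det_tr; congr (\det _).
by apply/matrixP => i j; rewrite !mxE.
Qed.

Definition part (e : {ffun 'I_N -> bool}) b : seq nat :=
  [seq val i | i <- enum 'I_N & e i == b].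

Lemma part_lt e b i : i \in part e b -> (i < N)%N.
Proof. by move=> /mapP [k _ ->]; apply: ltn_ord. Qed.

Lemma mem_part e b (i : 'I_N) : (val i \in part e b) = (e i == b).
Proof. by rewrite (mem_map val_inj) mem_filter mem_enum andbT. Qed.

Lemma size_part e b : size (part e b) = #|[pred i | e i == b]|.
Proof. by rewrite size_map enumT cardE /enum_mem. Qed.

Lemma uniq_part e b : uniq (part e b).
Proof. by rewrite (map_inj_uniq val_inj) filter_uniq // enum_uniq. Qed.

Lemma part_perm e : perm_eq (part e false ++ part e true) (iota 0 N).
Proof.
apply: uniq_perm; rewrite ?iota_uniq //.
  rewrite cat_uniq !uniq_part andbT /=.
  apply/hasPn => _ /mapP [i hi ->]; rewrite /= mem_part.
  by move: hi; rewrite mem_filter => /andP [/eqP ->].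
move=> i; rewrite mem_cat mem_iota add0n leq0n /=; apply/orP/idP => [[]|lt].
- exact: part_lt.
- exact: part_lt.
by have := (mem_part e (e (Ordinal lt)) (Ordinal lt)); rewrite eqxx; case: (e _) => ->;
  [right|left].
Qed.

Lemma size_part2 e : (size (part e false) + size (part e true) = N)%N.
Proof. by rewrite -size_cat (perm_size (part_perm e)) size_iota. Qed.

(** In a nonzero term of the Leibniz formula the permutation respects the
    colours. *)
Lemma pure_unbal e e' : size (part e true) != size (part e' true) ->
  pure e e' = 0.
Proof.
move=> ne; rewrite /pure /determinant big1 // => s _.
have [i hi] : exists i, e i != e' (s i).
  apply/existsP; apply: contraNT ne; rewrite negb_exists => /forallP h.
  apply/eqP; rewrite !size_part -[RHS](card_image (@perm_inj _ s^-1%g)).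
  apply: eq_card => i; apply/idP/imageP => [ei|[j]].
    by exists (s i); rewrite ?permK // inE -(eqP (negbNE (h i))).
  by rewrite inE => ej ->; rewrite inE (eqP (negbNE (h _))) permKV.
by rewrite (bigD1 i) //= mxE (negPf hi) mul0r mulr0.
Qed.

(** Sorting rows and columns by colour makes the matrix block diagonal. *)
Lemma pure_bal e e' : size (part e true) = size (part e' true) ->
  exists b : bool, pure e e' = (-1) ^+ b *
   (natdet (size (part e false))
      (fun i j => Y false (nth 0%N (part e false) i) (nth 0%N (part e' false) j)) *
    natdet (size (part e true))
      (fun i j => Y true (nth 0%N (part e true) i) (nth 0%N (part e' true) j))).
Proof.
move=> es.
have es0 : size (part e false) = size (part e' false).
  by apply/(@addIn (size (part e true))); rewrite size_part2 es size_part2.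
pose F (i j : nat) : S := let b := i \in part e true in
  if b == (j \in part e' true) then Y b i j else 0.
have -> : pure e e' = natdet N F.
  congr (\det _); apply/matrixP => i j; rewrite !mxE /F !mem_part.
  by rewrite !eqb_id.
set r := part e false ++ part e true; set c := part e' false ++ part e' true.
have sr : size r = N by rewrite size_cat size_part2.
have sc : size c = N by rewrite size_cat size_part2.
have [b e1] := natdet_permlr 0%N 0%N F (part_perm e) (part_perm e') (etrans sr (esym sc)).
exists b; have -> : natdet N F = (-1) ^+ b * natdet (size r) (fun i j => F (nth 0%N r i)
  (nth 0%N c j)).
  rewrite e1 mulrA -signr_addb addbb mul1r sr; apply: eq_natdet => i j li lj.
  by rewrite !nth_iota.
have memr k f i : i \in part f k -> (i \in part f true) = k.
  by case/mapP => x; rewrite mem_filter => /andP [/eqP <- _] ->; rewrite mem_part eqb_id.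
congr (_ * _); rewrite size_cat natdet_block; first congr (_ * _).
- apply: eq_natdet => i j li lj; rewrite !nth_cat li -es0 lj /F.
  by rewrite !(memr false) ?mem_nth // -es0.
- apply: eq_natdet => i j li lj; rewrite !nth_cat -es0 !ltnNge !leq_addr /= !addKn /F.
  by rewrite !mem_nth // -es.
- move=> i j li /andP [lj lj']; rewrite /F !nth_cat li -es0 ltnNge lj /=.
  by rewrite (memr false) ?mem_nth -?es ?ltn_subLR // es0.
- move=> i j /andP [li li'] lj; rewrite /F !nth_cat -es0 lj ltnNge li /=.
  by rewrite mem_nth ?ltn_subLR // (memr false) ?mem_nth -?es0.
Qed.
End Pure.
End NatDet.

Lemma natdet_map (R S : comNzRingType) (f : {rmorphism R -> S}) n F :
  natdet n (fun i j => f (F i j)) = f (natdet n F).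
Proof.
by rewrite /natdet -det_map_mx; congr (\det _); apply/matrixP => i j; rewrite !mxE.
Qed.

Lemma coef_sign (R : comNzRingType) (b : bool) (p : {poly R}) k :
  ((-1) ^+ b * p)`_k = (-1) ^+ b * p`_k.
Proof. by case: b; rewrite ?expr1 ?expr0 ?mulN1r ?mul1r ?coefN. Qed.

(** * Divisibility by powers of linear polynomials and of ideals *)

Section Strip.
Variable A : comNzRingType.
Implicit Types (P H K : {poly A}) (c : A).

Lemma poly0_decomp P : exists P1, P = 'X * P1 + (P.[0])%:P.
Proof.
have : root (P - (P.[0])%:P) 0 by rewrite /root hornerD hornerN hornerC subrr.
by case/factor_theorem => P1 e; exists P1; rewrite mulrC -['X]subr0 -polyC0 -e subrK.
Qed.

(** Modulo c, the polynomial 'X^b * P is divisible by ('X + u)^a, hence so is P,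
    since u is a unit; and P is too small for that, unless it vanishes modulo c.
    The cases u = 1 and u = -1 are used; u * u = 1 makes the inverse of u
    explicit. *)
Lemma strip_power (a b : nat) P H K c u : u * u = 1 ->
  'X^b * P = ('X + u%:P) ^+ a * H + c%:P * K -> (size P <= a)%N ->
  exists K', P = c%:P * K'.
Proof.
move=> uu e sP; elim: b H K e => [|b IH] H K e.
  have eu : 'X + u%:P = 'X - (- u)%:P by rewrite polyCN opprK.
  have mon : ('X + u%:P : {poly A}) ^+ a \is monic.
    by rewrite monic_exp // eu monicXsubC.
  have sz : size (('X + u%:P : {poly A}) ^+ a) = a.+1.
    by rewrite eu size_exp_XsubC.
  have eK := Pdiv.RingMonic.rdivp_eq mon K.
  set K1 := Pdiv.Ring.rdivp _ _ in eK; set K2 := Pdiv.Ring.rmodp _ _ in eK.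
  have sK2 : (size K2 <= a)%N.
    by rewrite -ltnS -sz Pdiv.Ring.ltn_rmodpN0 // monic_neq0.
  exists K2; apply/eqP; rewrite -subr_eq0; apply/eqP.
  have eD : P - c%:P * K2 = (H + c%:P * K1) * ('X + u%:P) ^+ a.
    by rewrite mul1r in e; rewrite e eK; ring.
  have sD : (size (P - c%:P * K2)%R <= a)%N.
    rewrite (leq_trans (size_polyD _ _)) // geq_max sP size_polyN mul_polyC.
    exact: leq_trans (size_scale_leq _ _) sK2.
  have [e0|ne0] := eqVneq (H + c%:P * K1) 0; first by rewrite eD e0 mul0r.
  by move: sD; rewrite eD size_Mmonic // sz addnS /= leqNgt -{1}[a]add0n ltn_add2r
    size_poly_gt0 ne0.
have [H1 eH] := poly0_decomp H; have [K1 eK] := poly0_decomp K.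
have ua : u ^+ a * u ^+ a = 1 by rewrite -exprMn uu expr1n.
have h0 : H.[0] = - (u ^+ a * c * K.[0]).
  have := congr1 (horner^~ 0) e.
  rewrite !hornerE exprS !mul0r => /esym/eqP; rewrite addr_eq0 => /eqP h0.
  by rewrite -[LHS]mul1r -ua -mulrA h0; ring.
(* Subtract from the relation a multiple of c that makes both sides divisible
   by 'X, and divide. *)
have [W eW] := poly0_decomp (1 - (u ^+ a)%:P * ('X + u%:P) ^+ a : {poly A}).
rewrite !hornerE ua subrr polyC0 addr0 in eW.
apply: (IH H1 (K1 + W * (K.[0])%:P)).
have X0 : GRing.lreg ('X : {poly A}) by apply: monic_lreg; apply: monicX.
apply: X0; rewrite mulrA -exprS e {1}eH {1}eK h0 polyCN !polyCM.
transitivity ('X * (('X + u%:P) ^+ a * H1 + c%:P * K1) + c%:P * (K.[0])%:P * (1 - (u ^+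
  a)%:P * ('X + u%:P) ^+ a)); first by ring.
by rewrite eW; ring.
Qed.

(** The m coefficients that may be nonzero are consecutive, so P is a power of
    'X times a polynomial of degree less than m, which ('X - 1)^m still divides.
    *)
Lemma window_eq0 (m n : nat) P q : P = ('X - 1) ^+ m * q ->
  (forall k, (n < k)%N -> P`_k = 0) -> (forall k, (k + m <= n)%N -> P`_k = 0) ->
  P = 0.
Proof.
move=> eP hi lo; set j := (n.+1 - m)%N.
have eP' : P = 'X^j * drop_poly j P.
  rewrite -[LHS](poly_take_drop j) mulrC [take_poly _ _](_ : _ = 0) ?add0r //.
  apply/polyP => k; rewrite coef_take_poly coef0; case: ltnP => // lt.
  by apply: lo; move: lt; rewrite /j; lia.
have [|||K' eK] := @strip_power m j (drop_poly j P) q 0 0 (-1).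
- by rewrite mulrNN mulr1.
- by rewrite -eP' eP polyCN polyC1 mulr0 addr0.
- apply/leq_sizeP => k lk; rewrite coef_drop_poly; apply: hi.
  by move: lk; rewrite /j; lia.
by rewrite eP' eK polyC0 mul0r mulr0.
Qed.
End Strip.

Section PowIdeal.
Variables (S : comNzRingType) (y s : S).

(** What is used of membership in the k-th power of the ideal (y, s): if a + b =
    k + 1, a monomial of degree k in y and s is divisible by y^a or by s^b. *)
Definition inpow k F := forall a b, (a + b = k.+1)%N ->
  exists H K, F = y ^+ a * H + s ^+ b * K.

Lemma inpow0 F : inpow 0 F.
Proof.
case=> [|[|a]] [|[|b]] //= _; first by exists F, 0; rewrite expr0; ring.
by exists 0, F; rewrite expr0; ring.
Qed.

Lemma inpowD k F G : inpow k F -> inpow k G -> inpow k (F + G).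
Proof.
move=> hF hG a b e; have [H [K ->]] := hF a b e; have [H' [K' ->]] := hG a b e.
by exists (H + H'), (K + K'); ring.
Qed.

Lemma inpowMl k F G : inpow k F -> inpow k (G * F).
Proof.
move=> hF a b e; have [H [K ->]] := hF a b e.
by exists (G * H), (G * K); ring.
Qed.

Lemma inpow_zero k : inpow k 0.
Proof. by move=> a b _; exists 0, 0; ring. Qed.

Lemma inpowS k F u v : inpow k F -> inpow k.+1 ((y * u + s * v) * F).
Proof.
move=> hF [|a] [|b] // e.
- by exists ((y * u + s * v) * F), 0; ring.
- by exists 0, ((y * u + s * v) * F); ring.
have [|H [K e1]] := hF a b.+1; first by lia.
have [|H' [K' e2]] := hF a.+1 b; first by lia.
exists (u * H + s * v * H'), (y * u * K + v * K').
by rewrite mulrDl {1}e1 e2 !exprS; ring.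
Qed.

Lemma inpow_le k l F : (k <= l)%N -> inpow l F -> inpow k F.
Proof.
move=> lkl hF a b e; have [|H [K ->]] := hF (a + (l - k))%N b; first by lia.
by exists (y ^+ (l - k) * H), K; rewrite exprD; ring.
Qed.

Lemma inpow_sum k (I : Type) (r : seq I) (P : pred I) (F : I -> S) :
  (forall i, P i -> inpow k (F i)) -> inpow k (\sum_(i <- r | P i) F i).
Proof. by move=> h; apply: big_ind => //; [exact: inpow_zero|exact: inpowD]. Qed.

Lemma inpow_prod (I : Type) (r : seq I) (P : pred I) (F : I -> S) :
  (forall i, P i -> exists u v, F i = y * u + s * v) ->
  inpow (count P r) (\prod_(i <- r) F i).
Proof.
move=> h; elim: r => [|i r IH]; first by rewrite big_nil; apply: inpow0.
rewrite big_cons /=; case: (boolP (P i)) => [/h [u [v ->]]|_].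
  by rewrite add1n; apply: inpowS.
by rewrite add0n; apply: inpowMl.
Qed.

(** Each permutation passes through the block U x V at least #|U| + #|V| - N
    times. *)
Lemma inpow_det N (M : 'M[S]_N) (U V : pred 'I_N) :
  (forall i j, U i -> V j -> exists u v, M i j = y * u + s * v) ->
  inpow (#|U| + #|V| - N) (\det M).
Proof.
move=> h; apply: inpow_sum => p _; apply: inpowMl.
pose W := [pred i | U i && V (p i)].
apply: (@inpow_le _ (count W (index_enum 'I_N))); last first.
  by apply: inpow_prod => i /andP [Ui Vi]; apply: h.
have -> : count W (index_enum 'I_N) = #|W|.
  by rewrite -sum1_card -sum1_count.
have -> : #|V| = #|[pred i | V (p i)]|.
  rewrite -[LHS](card_image (@perm_inj _ p^-1%g)); apply: eq_card => i.
  apply/imageP/idP => [[j Vj ->]|Vi]; first by rewrite inE permKV.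
  by exists (p i); rewrite ?permK.
pose V' := [pred i | V (p i)]; pose X := [predU U & V'].
have e1 : (#|X| + #|W| = #|U| + #|V'|)%N by apply: cardUI.
have : (#|X| <= N)%N by rewrite -[leqRHS]card_ord max_card.
rewrite -/V' leq_subLR -e1; move: #|X| #|W| => x w.
by move=> le; rewrite leq_add2r.
Qed.
End PowIdeal.

(** * Relations among products of two minors *)

(** A first minor of size h and a second one of size h', with disjoint rows and
    disjoint columns: an index i < h belongs to the first minor, the others to
    the second one. X i j k is the coefficient of T^k in the entry (i, j). All
    the coefficients of interest have index at most nu. *)
Section Rel.
Variables (Q : comNzRingType) (h h' K nu : nat) (X : nat -> nat -> nat -> Q).
Hypothesis nuK : (nu < K)%N.
Notation N := (h + h')%N.
Implicit Types (e : {ffun 'I_N -> bool}) (t : nat -> pred bool).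

Definition tseries i j : {poly Q} := \poly_(k < K) X i j k.

Definition subdet (r c : seq nat) k : Q :=
  (natdet (size r) (fun a b => tseries (nth 0%N r a) (nth 0%N c b)))`_k.

Hypothesis big0 : forall r c k, all (gtn N) r -> all (gtn N) c ->
  size r = size c -> (h < size r)%N -> (k < K)%N -> subdet r c k = 0.

(** T |-> S T, where S is the inner variable. *)
Definition rescale := (comp_poly (('X : {poly Q})%:P * 'X) \o map_poly polyC) :
  {rmorphism {poly Q} -> {poly {poly Q}}}.

Lemma coef_rescale p k : (rescale p)`_k = p`_k *: 'X^k.
Proof.
rewrite /= comp_polyE coef_sum size_map_polyC.
under eq_bigr => i _ do rewrite coef_map /= exprMn -polyC_exp -mul_polyC coefCM
  coefCM coefXn mulrA.
case: (ltnP k (size p)) => [lt|le].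
  rewrite (bigD1 (Ordinal lt)) //= eqxx mulr1 big1 ?addr0 ?mul_polyC // => i ne.
  by rewrite eq_sym -val_eqE in ne; rewrite (negPf ne) mulr0.
rewrite nth_default // scale0r big1 // => i _.
by rewrite gtn_eqF ?mulr0 // (leq_trans _ le).
Qed.

(** S^k - 1 is divisible by S - 1: modulo S - 1 the colours of indices cannot be
    told apart. *)
Lemma rescale_sub p : exists w, rescale p = map_poly polyC p + ('X - 1)%:P * w.
Proof.
exists (\poly_(k < size p) (p`_k *: \sum_(i < k) 'X^i)); apply/polyP => k.
rewrite coef_rescale coefD coef_map coefCM coef_poly /=.
case: ltnP => lk; last by rewrite nth_default // scale0r polyC0 mulr0 addr0.
rewrite -scalerAr -subrX1 scalerBr -[p`_k *: 1]mul_polyC mulr1.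
by rewrite addrC subrK.
Qed.

(** x(T) for the colour false, x(S T) for the colour true. *)
Definition twist (b : bool) i j : {poly {poly Q}} :=
  if b then rescale (tseries i j) else map_poly polyC (tseries i j).

(** The coefficient of T^nu in the determinant of one colouring, a polynomial in
    S. *)
Definition pure_coef e e' : {poly Q} := (pure twist e e')`_nu.

Lemma part_all e b : all (gtn N) (part e b).
Proof. by apply/allP => i; apply: part_lt. Qed.

Lemma pure_coef_unbal e e' : size (part e true) != size (part e' true) ->
  pure_coef e e' = 0.
Proof. by move=> ne; rewrite /pure_coef pure_unbal // coef0. Qed.

(** S^k T^nu collects the terms where the weight of the true minor is k and that
    of the false minor is nu - k. *)
Lemma pure_coef_bal e e' : size (part e true) = size (part e' true) ->
  exists b : bool, forall k, (pure_coef e e')`_k =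
  if (k <= nu)%N then (-1) ^+ b *
    (subdet (part e false) (part e' false) (nu - k) *
     subdet (part e true) (part e' true) k) else 0.
Proof.
move=> es; have [b eb] := pure_bal twist es; exists b => k.
rewrite /pure_coef eb /= (natdet_map (map_poly polyC)) (natdet_map rescale).
rewrite !coef_sign coefMr coef_sum /=.
under eq_bigr => i _ do rewrite coef_map coef_rescale /= coefCM coefZ coefXn.
case: leqP => [le|lt]; last first.
  rewrite big1 ?mulr0 // => i _.
  by rewrite gtn_eqF ?mulr0 // (leq_trans _ lt).
congr (_ * _); rewrite (bigD1 (Ordinal (le : (k < nu.+1)%N))) //= eqxx mulr1.
rewrite big1 ?addr0 // => i; rewrite -val_eqE /= eq_sym => /negPf ->.
by rewrite !mulr0.
Qed.

Lemma pure_coef_big e e' : (h < size (part e true))%N || (h < size (part e false))%N ->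
  pure_coef e e' = 0.
Proof.
have [es|/eqP ne] := @eqP _ (size (part e true)) (size (part e' true)); last first.
  by rewrite pure_coef_unbal.
have [b eb] := pure_coef_bal es => lt; apply/polyP => k; rewrite eb coef0.
case: leqP => // le; have es0 : size (part e false) = size (part e' false).
  by apply/(@addIn (size (part e true))); rewrite size_part2 es size_part2.
case/orP: lt => lt.
  by rewrite (big0 (r := part e true)) ?mulr0 ?part_all // (leq_ltn_trans le).
rewrite (big0 (r := part e false)) ?mul0r ?mulr0 ?part_all //.
by rewrite (leq_ltn_trans _ nuK) // leq_subr.
Qed.

(** A further variable z counts the rows coloured true. *)
Definition ztwist (b : bool) i j : {poly {poly {poly Q}}} :=
  (if b then 'X%:P else 1) * map_poly polyC (twist b i j).

(** x(T) + z x(S T) = (1 + z) x(T) + z (x(S T) - x(T)). *)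
Lemma ztwist_free i j : exists u v,
  ztwist true i j + ztwist false i j = (1 + 'X)%:P * u + (('X - 1)%:P)%:P * v.
Proof.
have [w e] := rescale_sub (tseries i j).
have e1 : ztwist true i j = 'X%:P * map_poly polyC (map_poly polyC (tseries i j) + ('X -
  1)%:P * w).
  by rewrite /ztwist /twist e.
have e0 : ztwist false i j = map_poly polyC (map_poly polyC (tseries i j)) by apply: mul1r.
exists (map_poly polyC (map_poly polyC (tseries i j))), ('X%:P * map_poly polyC w).
rewrite e1 e0 rmorphD rmorphM /= map_polyC /= polyCD; ring.
Qed.

Lemma pure_ztwist e e' :
  pure ztwist e e' = ('X ^+ size (part e true))%:P * map_poly polyC (pure twist e e').
Proof.
rewrite -[map_poly polyC _]det_map_mx.
have -> : ('X ^+ size (part e true))%:P =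
    \prod_(i < N) (if e i then 'X%:P else 1) :> {poly {poly {poly Q}}}.
  rewrite -big_mkcond prodr_const polyC_exp size_part; congr (_ ^+ _).
  by apply: eq_card => i; rewrite !inE eqb_id.
rewrite -det_scale_rows; congr (\det _); apply/matrixP => i j; rewrite !mxE.
by case: ifP => _; rewrite // rmorph0 mulr0.
Qed.

Definition free_idx t : pred 'I_N := fun i => t i true && t i false.

Definition type_sum t t' : {poly Q} :=
  \sum_(e | compat t e && (size (part e true) == h'))
  \sum_(e' | compat t' e' && (size (part e' true) == h')) pure_coef e e'.

(** The determinant with all allowed colours lies in the power of the ideal (1 +
    z, S - 1) that inpow_det gives. Its z-degrees lie between h' and h, as the
    larger minors vanish: up to a power of z it has degree at most h - h' in z.
    Of the total exponent, h - h' + 1 is spent on 1 + z, which strip_power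
    removes for reasons of degree, and the rest remains as an exponent of S - 1.
    *)
Lemma type_sum_div_full t t' : (h' <= h)%N -> (h <= #|free_idx t|)%N ->
  (h <= #|free_idx t'|)%N ->
  exists q, type_sum t t' = ('X - 1) ^+ ((#|free_idx t| - h) + (#|free_idx t'| - h)) * q.
Proof.
move=> hh hU hV; set m := (_ + _)%N.
pose D := \det (\matrix_(i < N, j < N) \sum_(b : bool) (t i b && t' j b)%:R * ztwist b i j).
have [||Hh [Kk eD]] := @inpow_det _ (1 + 'X)%:P (('X - 1)%:P)%:P N
    (\matrix_(i < N, j < N) \sum_(b : bool) (t i b && t' j b)%:R * ztwist b i j)
    (free_idx t) (free_idx t') _ (h - h').+1 m.
- move=> i j /andP [t1 t2] /andP [t1' t2']; rewrite mxE big_bool /= t1 t1' t2 t2'.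
  have [u [v e]] := ztwist_free i j; exists u, v; rewrite -e.
  by congr (_ + _); apply: mul1r.
- by rewrite /m; lia.
have {eD} := congr1 (fun p : {poly {poly {poly Q}}} => p`_nu) eD.
rewrite det_compat coefD -!polyC_exp !coefCM.
set Hn := Hh`_nu; set Kn := Kk`_nu.
rewrite coef_sum.
under eq_bigr => e _.
  rewrite coef_sum.
  under eq_bigr => e' _.
    rewrite pure_ztwist coefCM coef_map /= -/(pure_coef e e').
    over.
  over.
move=> eD.
pose P : {poly {poly Q}} := \sum_(e | compat t e) \sum_(e' | compat t' e')
   if (h' <= size (part e true) <= h)%N then 'X ^+ (size (part e true) - h') * (pure_coef e
     e')%:P else 0.
have eP : 'X ^+ h' * P = (1 + 'X) ^+ (h - h').+1 * Hn + (('X - 1) ^+ m)%:P * Kn.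
  rewrite -eD /P mulr_sumr; apply: eq_bigr => e _.
  rewrite mulr_sumr; apply: eq_bigr => e' _.
  case: ifP => [/andP [l1 l2]|/negbT]; first by rewrite mulrA -exprD subnKC.
  rewrite mulr0 negb_and -!ltnNge => lt; rewrite pure_coef_big ?polyC0 ?mulr0 //.
  by have := size_part2 e; case/orP: lt => lt es; apply/orP; [right|left]; lia.
rewrite [1 + 'X]addrC in eP; rewrite -polyC1 in eP; have [||q eq] := strip_power _ eP;
  first by rewrite mulr1.
  apply/leq_sizeP => j lj; rewrite coef_sum big1 // => e _.
  rewrite coef_sum big1 // => e' _; case: ifP => [/andP [l1 l2]|]; rewrite ?coef0 //.
  by rewrite coefMC coefXn gtn_eqF ?mul0r //; lia.
exists q`_0; have := congr1 (fun p : {poly {poly Q}} => p`_0) eq.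
rewrite coefCM => <-; rewrite /P coef_sum /type_sum.
rewrite [RHS](bigID (fun e : {ffun 'I_N -> bool} => size (part e true) == h')) /=.
rewrite [X in _ = _ + X]big1 ?addr0 => [|e /andP [_ ne]]; last first.
  rewrite coef_sum big1 // => e' _; case: ifP; rewrite ?coef0 // => /andP [l1 l2].
  by rewrite coefMC coefXn ltn_eqF ?mul0r //; lia.
apply: eq_bigr => e /andP [_ /eqP es].
rewrite coef_sum [RHS](bigID (fun e : {ffun 'I_N -> bool} => size (part e true) == h')) /=.
rewrite [X in _ = _ + X]big1 ?addr0 => [|e' /andP [_ ne]]; last first.
  by rewrite pure_coef_unbal ?es 1?eq_sym // polyC0 mulr0 if_same coef0.
by apply: eq_bigr => e' _; rewrite es leqnn hh subnn mul1r coefC.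
Qed.
End Rel.

Section Rel2.
Variables (Q : comNzRingType) (h h' K nu : nat) (X : nat -> nat -> nat -> Q).
Hypothesis nuK : (nu < K)%N.
Hypothesis hh : (h' <= h)%N.
Notation N := (h + h')%N.
Implicit Types (e : {ffun 'I_N -> bool}) (t : nat -> pred bool).
Notation mn := (subdet K X).
Notation psi := (pure_coef K nu X).
Notation Psi := (@type_sum Q h h' K nu X).
Notation free := (@free_idx h h').

Hypothesis big0 : forall r c k, all (gtn N) r -> all (gtn N) c ->
  size r = size c -> (h < size r)%N -> (k < K)%N -> mn r c k = 0.

(** True is forced where e is true and nothing is forced elsewhere. If e is true
    at h' indices, e is the only such colouring that this type admits; still, h
    indices are free. *)
Definition forced_type e : nat -> pred bool := fun i b => b || (i \notin part e true).

Lemma compat_forced e e' : size (part e true) = h' ->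
  compat (forced_type e) e' && (size (part e' true) == h') = (e' == e).
Proof.
move=> es; apply/andP/eqP => [[/forallP ce /eqP es']|->]; last first.
  rewrite es eqxx; split=> //; apply/forallP => i.
  by rewrite /forced_type mem_part eqb_id; case: (e i).
have sub : [pred i | e i == true] \subset [pred i | e' i == true].
  apply/subsetP => i; rewrite !inE !eqb_id => ei; have := ce i.
  by rewrite /forced_type mem_part ei orbF.
have /subset_cardP /(_ sub) eqe : #|[pred i | e i == true]| = #|[pred i | e' i == true]|.
  by rewrite -!size_part es es'.
by apply/ffunP => i; have := eqe i; rewrite !inE !eqb_id.
Qed.

Lemma free_forced e : size (part e true) = h' -> #|free (forced_type e)| = h.
Proof.
move=> es; have es2 := size_part2 e; have : #|free (forced_type e)| = size (part e false).
  rewrite size_part; apply: eq_card => i.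
  by rewrite !inE /free_idx /forced_type /= unfold_in mem_part; case: (e i).
by rewrite es in es2; move=> ->; apply: (@addIn h').
Qed.

Lemma type_sum_exp_l t t' :
  Psi t t' = \sum_(e | compat t e && (size (part e true) == h')) Psi (forced_type e) t'.
Proof.
apply: eq_bigr => e /andP [_ /eqP es]; rewrite /Psi.
by rewrite [RHS](eq_bigl (pred1 e)) ?big_pred1_eq // => e'; rewrite compat_forced.
Qed.

Lemma type_sum_exp_r t t' :
  Psi t t' = \sum_(e | compat t' e && (size (part e true) == h')) Psi t (forced_type e).
Proof.
rewrite /Psi [RHS]exchange_big /=; apply: eq_bigr => e _.
rewrite [RHS](eq_bigr (fun e' => psi e e')) // => e' /andP [_ /eqP es].
by rewrite (eq_bigl (pred1 e')) ?big_pred1_eq // => f; rewrite compat_forced.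
Qed.

(** If fewer than h rows (or columns) are free, the sum is cut into its single
    colourings, and each of these is seen as a sum with h free rows, by
    forced_type. *)
Lemma type_sum_div t t' :
  exists q, Psi t t' = ('X - 1) ^+ ((#|free t| - h) + (#|free t'| - h)) * q.
Proof.
have sum_div (I : finType) (P : pred I) (F : I -> {poly Q}) (d : {poly Q}) :
    (forall i, P i -> exists q, F i = d * q) -> exists q, \sum_(i | P i) F i = d * q.
  move=> hF; apply: (big_ind (fun p => exists q,
    p = d * q)) => [|x y [q ->] [q' ->]|i /hF //].
    by exists 0; rewrite mulr0.
  by exists (q + q'); rewrite mulrDr.
have full t1 : (h <= #|free t1|)%N ->
    exists q, Psi t1 t' = ('X - 1) ^+ ((#|free t1| - h) + (#|free t'| - h)) * q.
  move=> h1; case: (leqP h #|free t'|) => h2; first exact: type_sum_div_full.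
  rewrite type_sum_exp_r; apply: sum_div => e /andP [_ /eqP es].
  have /eqP -> : (#|free t'| - h == 0)%N by rewrite subn_eq0 ltnW.
  have := type_sum_div_full nuK big0 hh h1 (_ : h <= #|free (forced_type e)|)%N.
  by rewrite free_forced // subnn; apply.
case: (leqP h #|free t|) => h1; first exact: full.
rewrite type_sum_exp_l; apply: sum_div => e /andP [_ /eqP es].
have /eqP -> : (#|free t| - h == 0)%N by rewrite subn_eq0 ltnW.
by have := full (forced_type e); rewrite free_forced // subnn; apply.
Qed.
End Rel2.

(** The first minor has weight n and the second one weight n'; minors of size h
    and weight less than n vanish. Both colours are allowed on G. A change of
    the initial colour of an index of B, called a swap, makes one more
    coefficient of the second minor vanish, by heavy0. *)
Section Exchange.
Variables (Q : comNzRingType) (h h' n n' K : nat) (X : nat -> nat -> nat -> Q).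
Hypothesis nuK : (n + n' < K)%N.
Hypothesis hh : (h' <= h)%N.
Notation N := (h + h')%N.
Implicit Types (e : {ffun 'I_N -> bool}) (t : nat -> pred bool).
Notation mn := (subdet K X).
Notation nu := (n + n')%N.
Notation psi := (pure_coef K nu X).
Notation Psi := (@type_sum Q h h' K nu X).
Notation free := (@free_idx h h').

Hypothesis big0 : forall r c k, all (gtn N) r -> all (gtn N) c ->
  size r = size c -> (h < size r)%N -> (k < K)%N -> mn r c k = 0.
Hypothesis light0 : forall r c k, all (gtn N) r -> all (gtn N) c ->
  size r = h -> size c = h -> (k < n)%N -> mn r c k = 0.

(** The colourings that arise from the initial one by changes in G and B. *)
Definition admissible (G B : pred nat) e :=
  forall i : 'I_N, ~~ G i -> ~~ B i -> e i = (h <= i)%N.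
Definition swaps (B : pred nat) e := #|[pred i : 'I_N | B i && (e i != (h <= i)%N)]|.

Variables G B G' B' : pred nat.
Hypothesis GB : forall i, G i -> ~~ B i.
Hypothesis GB' : forall i, G' i -> ~~ B' i.

Hypothesis heavy0 : forall e e' k, (k < K)%N -> admissible G B e -> admissible G' B' e' ->
  size (part e true) = h' -> size (part e' true) = h' ->
  (k + #|[pred i : 'I_N | G i || B i]| + #|[pred i : 'I_N | G' i || B' i]| <=
   n' + swaps B e + swaps B' e' + 2 * h)%N ->
  mn (part e true) (part e' true) k = 0.

Definition initial_colouring : {ffun 'I_N -> bool} := [ffun i : 'I_N => (h <= i)%N].

Hypothesis good0 : forall e e', admissible G B e -> admissible G' B' e' ->
  size (part e true) = h' -> size (part e' true) = h' ->
  swaps B e = 0%N -> swaps B' e' = 0%N ->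
  e != initial_colouring \/ e' != initial_colouring ->
  mn (part e false) (part e' false) n = 0.

(** The types met in the induction of type_sum_pending: an index of B starts
    with its initial colour only, and then gets both colours or the other one
    only. *)
Definition reachable (G B : pred nat) t := forall i : nat, (i < N)%N ->
  [/\ G i -> t i true && t i false,
      ~~ G i -> ~~ B i -> forall b, t i b = (b == (h <= i)%N)
    & B i -> t i (~~ (h <= i)%N) || t i (h <= i)%N].

Definition pending (B : pred nat) t :=
  #|[pred i : 'I_N | B i && ~~ t i (~~ (h <= i)%N)]|.

Definition done_swaps (B : pred nat) t :=
  #|[pred i : 'I_N | B i && ~~ t i (h <= i)%N]|.

Lemma card_free_reach (G0 B0 : pred nat) t : (forall i, G0 i -> ~~ B0 i) ->
  reachable G0 B0 t -> pending B0 t = 0%N ->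
  (#|free t| + done_swaps B0 t = #|[pred i : 'I_N | G0 i || B0 i]|)%N.
Proof.
move=> gb rt /card0_eq p0.
suff key i : (free t i = (G0 i || B0 i) && free t i) /\
    (B0 i && ~~ t i (h <= i)%N = (G0 i || B0 i) && ~~ free t i).
  rewrite -[RHS](cardID (free t)); congr (_ + _)%N; apply: eq_card => i; rewrite !inE /=.
    exact: (key i).1.
  by rewrite (key i).2 andbC.
have [rG rF rB] := rt i (ltn_ord i); have := p0 i; rewrite !inE /free_idx.
case gi: (G0 i); first by rewrite (negPf (gb _ gi)) (rG gi).
case bi: (B0 i) => /=.
  by have := rB bi; case: (h <= i)%N => /=; case: (t i true); case: (t i false).
by rewrite !rF ?gi ?bi //; case: (h <= i)%N.
Qed.

Lemma swaps_ge (B0 : pred nat) t e : compat t e -> (done_swaps B0 t <= swaps B0 e)%N.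
Proof.
move=> /forallP ce; apply: subset_leq_card; apply/subsetP => i; rewrite !inE.
case/andP => -> /= ; apply: contra => /eqP <-; exact: ce.
Qed.

Lemma reach_adm (G0 B0 : pred nat) t e : reachable G0 B0 t -> compat t e ->
  admissible G0 B0 e.
Proof.
move=> rt /forallP ce i gi bi; have [_ /(_ gi bi) h1 _] := rt i (ltn_ord i).
by have := ce i; rewrite h1 => /eqP.
Qed.

(** No index of B is restricted to its initial colour any more. In degrees S^k
    with k > n' the first minor is too light, and in low degrees heavy0 applies.
    What remains is a window as long as the exponent of S - 1. *)
Lemma type_sum_reach t t' : reachable G B t -> reachable G' B' t' ->
  pending B t = 0%N -> pending B' t' = 0%N -> Psi t t' = 0.
Proof.
move=> rt rt' p0 p0'; have [q eq] := type_sum_div nuK hh big0 t t'.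
have ef := card_free_reach GB rt p0; have ef' := card_free_reach GB' rt' p0'.
have vanish k : (forall e e', compat t e -> compat t' e' ->
    size (part e true) = h' -> size (part e' true) = h' -> (k <= nu)%N ->
    mn (part e false) (part e' false) (nu - k) * mn (part e true) (part e' true) k = 0) ->
    (Psi t t')`_k = 0.
  move=> z; rewrite coef_sum big1 // => e /andP [ce /eqP es].
  rewrite coef_sum big1 // => e' /andP [ce' /eqP es'].
  have [b ->] := pure_coef_bal K nu X (etrans es (esym es')).
  by case: leqP => // le; rewrite z ?mulr0.
apply: (window_eq0 (n := n') eq) => k lk; apply: vanish => e e' ce ce' es es' le.
  have s1 := size_part2 e; have s2 := size_part2 e'.
  rewrite light0 ?mul0r ?part_all //; [lia|lia|].
  by rewrite ltn_subLR // addnC ltn_add2r.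
rewrite heavy0 ?mulr0 //; [exact: leq_ltn_trans le nuK|exact: reach_adm rt ce|exact:
  reach_adm rt' ce'|].
by have := swaps_ge B ce; have := swaps_ge B' ce'; lia.
Qed.

(** Used to release the index i, with c = predT, and to swap its colour, with c
    the singleton of the other colour. *)
Definition retype t (i : nat) (c : pred bool) : nat -> pred bool :=
  fun j => if j == i then c else t j.

(** One colour alone is both colours minus the other colour alone. *)
Lemma sum_retype (F : {ffun 'I_N -> bool} -> {poly Q}) t (i : 'I_N) b :
  let sum t := \sum_(e | compat t e && (size (part e true) == h')) F e in
  (forall c, t i c = (c == b)) ->
  sum t = sum (retype t i predT) - sum (retype t i (pred1 (~~ b))).
Proof.
move=> sum ti; apply/eqP; rewrite eq_sym subr_eq; apply/eqP.
rewrite /sum (bigID (fun e : {ffun 'I_N -> bool} => e i == b)) /=.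
have ce c e : compat (retype t i c) e = c (e i) && [forall (j : 'I_N | j != i), t j (e j)].
  apply/forallP/andP => [h1|[ci /forallP h1] j].
    split; first by have := h1 i; rewrite /retype eqxx.
    by apply/forallP => j; apply/implyP => /negPf ji; have := h1 j;
      rewrite /retype val_eqE ji.
  rewrite /retype val_eqE; case: eqVneq => [->//|ji].
  by have := h1 j; rewrite ji.
have ce' e : compat t e = (e i == b) && [forall (j : 'I_N | j != i), t j (e j)].
  rewrite -ti -(ce (t i)); apply/forallP/forallP => hc j; have := hc j;
    by rewrite /retype val_eqE; case: eqVneq => [->|].
congr (_ + _); apply: eq_bigl => e; rewrite !ce ?ce' /=;
  move: [forall (j | _), _] (_ == h') (e i) => x y z;
  by case: b {ti ce'}; case: x; case: y; case: z.
Qed.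

Lemma type_sum_retype_l t t' (i : 'I_N) b : (forall c, t i c = (c == b)) ->
  Psi t t' = Psi (retype t i predT) t' - Psi (retype t i (pred1 (~~ b))) t'.
Proof. exact: sum_retype. Qed.

Lemma type_sum_retype_r t t' (i : 'I_N) b : (forall c, t' i c = (c == b)) ->
  Psi t t' = Psi t (retype t' i predT) - Psi t (retype t' i (pred1 (~~ b))).
Proof.
move=> ti; rewrite /Psi -sumrB; apply: eq_bigr => e _.
exact: (sum_retype (psi e)).
Qed.

Lemma retype_reach (G0 B0 : pred nat) t (i : 'I_N) (c : pred bool) :
  (forall i, G0 i -> ~~ B0 i) ->
  reachable G0 B0 t -> B0 i -> c (~~ (h <= i)%N) -> reachable G0 B0 (retype t i c).
Proof.
move=> gb rt Bi ci j lj; have [rG rF rB] := rt j lj; rewrite /retype.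
by case: eqP => [->|//]; split => [/gb||_]; rewrite ?Bi ?ci.
Qed.

Lemma retype_pending (B0 : pred nat) t (i : 'I_N) (c : pred bool) :
  B0 i -> ~~ t i (~~ (h <= i)%N) -> c (~~ (h <= i)%N) ->
  (pending B0 (retype t i c) < pending B0 t)%N.
Proof.
move=> Bi ti ci; apply: proper_card; apply/properP; split.
  apply/subsetP => j; rewrite !inE /retype; case: eqP => [->|//].
  by rewrite ci andbF.
by exists i; rewrite !inE ?Bi //= /retype eqxx ci.
Qed.

Lemma pending_pick (G0 B0 : pred nat) t : reachable G0 B0 t -> pending B0 t != 0%N ->
  exists i : 'I_N, [/\ B0 i, ~~ t i (~~ (h <= i)%N) &
    forall c, t i c = (c == (h <= i)%N)].
Proof.
move=> rt; rewrite -lt0n => /card_gt0P [i]; rewrite inE => /andP [Bi ti].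
exists i; split=> // c; have [_ _ /(_ Bi)] := rt i (ltn_ord i).
by rewrite (negPf ti) /=; move: ti; case: (h <= i)%N; case: c => //= /negPf -> // ->.
Qed.

(** Each index of B is released and swapped in turn; m bounds the number of
    those that are still pending. *)
Lemma type_sum_pending m t t' : reachable G B t -> reachable G' B' t' ->
  (pending B t + pending B' t' <= m)%N -> Psi t t' = 0.
Proof.
elim: m t t' => [|m IH] t t' rt rt' pm.
  by apply: type_sum_reach => //; lia.
have [p0|p1] := eqVneq (pending B t) 0%N; last first.
  have [i [Bi ti tib]] := pending_pick rt p1.
  rewrite (type_sum_retype_l _ tib) !IH ?subr0 //; try exact: retype_reach;
    try (apply: retype_reach => //=; exact: eqxx).
    by have := @retype_pending B t i (pred1 (~~ (h <= i)%N)) Bi ti (eqxx _); lia.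
  by have := @retype_pending B t i predT Bi ti isT; lia.
have [p0'|p1] := eqVneq (pending B' t') 0%N; first exact: type_sum_reach.
have [i [Bi ti tib]] := pending_pick rt' p1.
rewrite (type_sum_retype_r _ tib) !IH ?subr0 //; try exact: retype_reach;
  try (apply: retype_reach => //=; exact: eqxx).
  by have := @retype_pending B' t' i (pred1 (~~ (h <= i)%N)) Bi ti (eqxx _); lia.
by have := @retype_pending B' t' i predT Bi ti isT; lia.
Qed.

Lemma part_iota b : part initial_colouring b = if b then iota h h' else iota 0 h.
Proof.
rewrite /part (eq_filter (a2 := (fun j => (h <= j)%N == b) \o val)); last first.
  by move=> i; rewrite ffunE.
rewrite -filter_map val_enum_ord iotaD filter_cat.
have lo j : j \in iota 0 h -> (h <= j)%N = false.
  by rewrite mem_iota => /andP [_ lt]; apply: ltn_geF.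
have hi j : j \in iota (0 + h) h' -> (h <= j)%N by rewrite mem_iota => /andP [].
case: b.
  rewrite -[RHS]cat0s; congr (_ ++ _).
    by rewrite (eq_in_filter (a2 := pred0)) ?filter_pred0 // => j /lo ->.
  by rewrite (eq_in_filter (a2 := predT)) ?filter_predT // => j /hi ->.
rewrite -[RHS]cats0; congr (_ ++ _).
  by rewrite (eq_in_filter (a2 := predT)) ?filter_predT // => j /lo ->.
by rewrite (eq_in_filter (a2 := pred0)) ?filter_pred0 // => j /hi ->.
Qed.

Definition start_type (G0 : pred nat) : nat -> pred bool :=
  fun i b => G0 i || (b == (h <= i)%N).

Lemma start_reach (G0 B0 : pred nat) : reachable G0 B0 (start_type G0).
Proof.
move=> i _; rewrite /start_type; split=> [->//|/negPf -> _ b //|_].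
by rewrite eqxx !orbT.
Qed.

Lemma start_swaps (G0 B0 : pred nat) e : (forall i, G0 i -> ~~ B0 i) ->
  compat (start_type G0) e -> swaps B0 e = 0%N.
Proof.
move=> gb /forallP ce; apply: eq_card0 => i; rewrite !inE.
apply/negP => /andP [Bi]; have := ce i; rewrite /start_type.
by case/orP => [/gb|->//]; rewrite Bi.
Qed.

(** With both colours on G and the initial ones elsewhere, the sum is zero by
    type_sum_pending, and good0 leaves only the term of the initial colouring.
    *)
Lemma exchange : mn (iota 0 h) (iota 0 h) n * mn (iota h h') (iota h h') n' = 0.
Proof.
have rt := @start_reach G B; have rt' := @start_reach G' B'.
have P0 := type_sum_pending rt rt' (leqnn _).
have /= := congr1 (fun p : {poly Q} => p`_n') P0.
rewrite coef0 coef_sum.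
have cio G0 : compat (start_type G0) initial_colouring && (size (part initial_colouring
  true) == h').
  rewrite part_iota size_iota eqxx andbT; apply/forallP => i.
  by rewrite /start_type ffunE eqxx orbT.
have zero e e' : compat (start_type G) e -> compat (start_type G') e' ->
    size (part e true) = h' -> size (part e' true) = h' ->
    e != initial_colouring \/ e' != initial_colouring -> (psi e e')`_n' = 0.
  move=> ce ce' es es' ne; have [b ->] := pure_coef_bal K nu X (etrans es (esym es')).
  rewrite leq_addl addnK good0 ?mul0r ?mulr0 ?if_same //;
    by [exact: reach_adm rt ce|exact: reach_adm rt' ce'|exact: start_swaps GB ce|exact:
      start_swaps GB' ce'].
rewrite (bigD1 initial_colouring) //= [X in _ + X]big1 ?addr0; last first.
  move=> e /andP [/andP [ce /eqP es] ne]; rewrite coef_sum big1 // => e' /andP [ce' /eqP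
    es'].
  by rewrite zero //; left.
rewrite coef_sum (bigD1 initial_colouring) //= [X in _ + X]big1 ?addr0; last first.
  move=> e' /andP [/andP [ce' /eqP es'] ne]; have /andP [ci /eqP si] := cio G.
  by rewrite zero //; right.
have [b ->] := pure_coef_bal K nu X (erefl (size (part initial_colouring true))).
rewrite leq_addl addnK !part_iota => e0.
by apply: (can_inj (signrMK b)); rewrite e0 mulr0.
Qed.
End Exchange.

(** * Matching indices with thresholds *)

Section Counting.
Local Open Scope nat_scope.

Definition cnt (s : seq nat) c := count (gtn c) s.

Section Assign.
Variables (T : eqType) (f : T -> nat).

Lemma cnt_rem (b : seq T) x c : x \in b ->
  cnt (map f b) c = (f x < c) + cnt (map f (rem x b)) c.
Proof. by move=> xb; rewrite /cnt (seq.permP (perm_map f (perm_to_rem xb))). Qed.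

(** If d0 is the first threshold, assign to it the smallest index that is at
    least d0; if there is none, assign to it the smallest index of all and pay
    one of the L permitted deficits. Both choices preserve the inequality
    between the counts. *)
Lemma assign (d : seq nat) (b : seq T) L : size b = size d ->
  (forall c, cnt (map f b) c <= cnt d c + L) ->
  exists2 b', perm_eq b' b &
    count (fun xy => xy.1 < xy.2) (zip (map f b') d) <= L.
Proof.
elim: d b L => [|d0 d IH] b L.
  by move/eqP/nilP => -> _; exists [::].
move=> sb hc.
have step x L' : x \in b -> L = L' + (f x < d0) ->
   (forall c, cnt (map f (rem x b)) c <= cnt d c + L') ->
   exists2 b', perm_eq b' b &
    count (fun xy => xy.1 < xy.2) (zip (map f b') (d0 :: d)) <= L.
  move=> xb eL hx; have [|b' pb' cb'] := IH (rem x b) L' _ hx.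
    by rewrite size_rem // sb.
  exists (x :: b'); last by rewrite /= eL addnC leq_add2r.
  by rewrite perm_sym (permPl (perm_to_rem xb)) perm_cons perm_sym.
have cd c : cnt (d0 :: d) c = (d0 < c) + cnt d c by [].
have cmono (s : seq nat) c c' : c <= c' -> cnt s c <= cnt s c'.
  by move=> le; apply: sub_count => x /= lt; apply: leq_trans le.
have [/hasP [x0 x0b x0d]|/hasPn nob] := boolP (has (fun x => d0 <= f x) b).
  have ex : exists n, has (fun x => (d0 <= f x) && (f x == n)) b.
    by exists (f x0); apply/hasP; exists x0; rewrite ?x0d ?eqxx.
  case: (ex_minnP ex) => n /hasP [x xb /andP [xd /eqP fx]] mn.
  apply: (step x L) => // [|c]; first by rewrite ltnNge xd addn0.
  have := hc c; rewrite (cnt_rem _ xb) cd.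
  case: (ltnP d0 c) => lc; last by rewrite add0n; case: (f x < c) => //=; lia.
  case: (ltnP (f x) c) => lx; first by rewrite !add1n addSn ltnS.
  move=> _; have := hc d0; rewrite (cnt_rem _ xb) cd ltnn ltnNge xd /= !add0n.
  suff -> : cnt (map f (rem x b)) c = cnt (map f (rem x b)) d0.
    by move/leq_trans; apply; rewrite leq_add2r cmono // ltnW.
  rewrite /cnt !count_map; apply: eq_in_count => y /mem_rem yb /=.
  case: (ltnP (f y) d0) => ly; first by rewrite (ltn_trans ly).
  have : n <= f y by apply: mn; apply/hasP; exists y; rewrite ?ly ?eqxx.
  by rewrite -fx => ly'; rewrite ltnNge (leq_trans lx).
have [x0 x0b] : exists x, x \in b.
  by case: (b) sb => // y s _; exists y; rewrite mem_head.
have ex : exists n, has (fun x => f x == n) b.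
  by exists (f x0); apply/hasP; exists x0.
case: (ex_minnP ex) => n /hasP [x xb /eqP fx] mn.
have xd : f x < d0 by rewrite ltnNge nob.
have full c : d0 <= c -> cnt (map f b) c = size b.
  move=> lc; rewrite /cnt count_map; apply/eqP; rewrite -all_count.
  by apply/allP => y yb /=; apply: leq_trans lc; rewrite ltnNge nob.
have sd : cnt d d0 <= size d by apply: count_size.
have hd0 := hc d0; rewrite full // cd ltnn sb /= add0n in hd0.
apply: (step x L.-1) => // [|c]; first by rewrite xd; lia.
have := hc c; rewrite (cnt_rem _ xb) cd.
case: (ltnP d0 c) => lc.
  have := full c (ltnW lc); rewrite (cnt_rem _ xb) sb (ltn_trans xd lc) /=.
  by have := cmono d _ _ (ltnW lc); lia.
case: (ltnP (f x) c) => lx /=; first by lia.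
suff -> : cnt (map f (rem x b)) c = 0 by [].
rewrite /cnt count_map; apply/eqP; rewrite -leqn0 leqNgt -has_count.
apply/hasPn => y /mem_rem yb /=; rewrite -leqNgt (leq_trans lx) // fx.
by apply: mn; apply/hasP; exists y.
Qed.
End Assign.

Lemma cnt_cat s t c : cnt (s ++ t) c = cnt s c + cnt t c.
Proof. exact: count_cat. Qed.

Lemma cnt_mono s c c' : c <= c' -> cnt s c <= cnt s c'.
Proof. by move=> le; apply: sub_count => x /= lt; apply: leq_trans le. Qed.
End Counting.

(** * Letters above a bound, and the thresholds of a largest symbol *)

Section Letters.
Local Open Scope nat_scope.
Variable P : nat.
Notation L := ('I_P * nat)%type.
Implicit Types (x y : L) (a : seq L) (b : seq 'I_P) (D : nat -> nat *l nat).

Lemma le_letterE (x y : nat *l nat) : (x <= y)%O =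
  (x.1 < y.1) || ((x.1 == y.1) && (x.2 <= y.2)).
Proof.
by rewrite Order.ProdLexiOrder.leEprodlexi !leEnat; case: ltngtP => //= _; rewrite andbF.
Qed.

Lemma lt_letterE (x y : nat *l nat) : (x < y)%O =
  (x.1 < y.1) || ((x.1 == y.1) && (x.2 < y.2)).
Proof.
by rewrite Order.ProdLexiOrder.ltEprodlexi !leEnat ltEnat; case: ltngtP.
Qed.

(** A bound D i on the i-th letter (u, k) is given in the order (k, u) in which
    letters are compared. *)
Definition shift k D : nat -> nat *l nat := fun i => D (k + i).

Fixpoint above D a := if a is x :: a' then (D 0 <=
  letter x)%O && above (shift 1 D) a' else true.
Fixpoint thr D n := if n is n'.+1 then (D 0).2 :: thr (shift 1 D) n' else [::].
Fixpoint base D n := if n is n'.+1 then (D 0).1 + base (shift 1 D) n' else 0.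
(** The lightest letters with indices b above D: the weight of the bound, plus
    one where the index is smaller than that of the bound. *)
Fixpoint fill D b : seq L :=
  if b is x :: b' then (x, (D 0).1 + (val x < (D 0).2)) :: fill (shift 1 D) b' else [::].
Definition wt a := sumn (unzip2 a).

Lemma eq_above D D' a : D =1 D' -> above D a = above D' a.
Proof.
by elim: a D D' => //= x a IH D D' e; rewrite e (IH _ (shift 1 D')) // => i;
  rewrite /shift e.
Qed.

Lemma above_cat D s t : above D (s ++ t) = above D s && above (shift (size s) D) t.
Proof.
elim: s D => [|x s IH] D /=; first by apply: eq_above.
by rewrite IH andbA; congr (_ && _); apply: eq_above => i; rewrite /shift addSn add1n.
Qed.

Lemma size_thr D n : size (thr D n) = n.
Proof. by elim: n D => //= n IH D; rewrite IH. Qed.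

Lemma unzip1_fill D b : unzip1 (fill D b) = b.
Proof. by elim: b D => //= x b IH D; rewrite IH. Qed.

Lemma above_fill D b : above D (fill D b).
Proof.
by elim: b D => //= x b IH D; rewrite IH andbT le_letterE /=; case: ltngtP => /=; lia.
Qed.

Lemma wt_fill D b : wt (fill D b) =
  base D (size b) + count (fun xy => xy.1 < xy.2) (zip (map val b) (thr D (size b))).
Proof. by rewrite /wt; elim: b D => //= x b IH D; rewrite IH; lia. Qed.

(** By assign, few indices are smaller than that of their bound. *)
Lemma arrange D b c0 : (forall c, cnt (map val b) c <= cnt (thr D (size b)) c + c0) ->
  exists a, [/\ perm_eq (unzip1 a) b, above D a & wt a <= base D (size b) + c0].
Proof.
move=> hc; have [|b' pb le] := assign _ hc; first by rewrite size_thr.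
exists (fill D b'); rewrite unzip1_fill above_fill wt_fill (perm_size pb).
by rewrite leq_add2l.
Qed.

(** Conversely to arrange: each index below c over a bound whose index is at
    least c costs one unit of weight. *)
Lemma above_duality D a c : above D a ->
  base D (size a) + cnt (map val (unzip1 a)) c <= wt a + cnt (thr D (size a)) c.
Proof.
rewrite /wt /cnt; elim: a D => //= x a IH D /andP [lx /IH]; move: lx.
rewrite le_letterE /=; case: (D 0) => k0 u0 /=.
move: (base _ _) (count _ (map _ _)) (count _ (thr _ _)) (sumn _) => b1 b2 b3 b4.
by case: (ltnP x.1 c); case: (ltnP u0 c); lia.
Qed.

(** The part of a word that comes from the rows, or from the columns. *)
Definition rword a : seqlexi (nat *l nat) := [seq letter x | x <- rev a].

Lemma ltxi_prefix (w s t : seq (nat *l nat)) (k l : nat *l nat) : (k < l)%O ->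
  ((w ++ k :: s : seqlexi _) < (w ++ l :: t : seqlexi _))%O.
Proof.
move=> lt; elim: w => [|z w IH] /=; last by rewrite eqhead_ltxiE.
by rewrite ltxi_cons ltW //= lt_geF.
Qed.

Lemma rword_lt s s' t x y : (letter x < letter y)%O ->
  (rword (s ++ x :: t) < rword (s' ++ y :: t))%O.
Proof.
move=> lt; rewrite /rword !rev_cat !rev_cons !cat_rcons !map_cat /=.
exact: ltxi_prefix.
Qed.

Lemma cnt_all b c : P <= c -> cnt (map val b) c = size b.
Proof.
move=> lc; rewrite -(size_map val b); apply/eqP; rewrite -all_count.
by apply/allP => _ /mapP [y _ ->] /=; apply: leq_trans lc.
Qed.

Lemma cnt_zero t : cnt t 0 = 0.
Proof. by rewrite /cnt (eq_count (a2 := pred0)) ?count_pred0. Qed.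

Lemma max_gap b b' : size b' = size b -> exists c lo,
  [/\ cnt (map val b') c = cnt (map val b) c + lo,
      forall c', cnt (map val b') c' <= cnt (map val b) c' + lo & lo = 0 -> c = 0].
Proof.
move=> es; pose g c := cnt (map val b') c + (size b - cnt (map val b) c).
have le c : cnt (map val b) c <= size b by rewrite (leq_trans (count_size _ _)) // size_map.
have [c _ mc] := @arg_maxnP 'I_P.+1 ord0 predT (fun c : 'I_P.+1 => g c) isT.
have {}mc c' : g c' <= g c.
  case: (leqP c' P) => lc; first exact: (mc (Ordinal (lc : c' < P.+1))).
  have := mc ord_max isT; rewrite -[nat_of_ord ord_max]/P /g.
  by rewrite !(cnt_all _ (leqnn _)) !(cnt_all _ (ltnW lc)).
have g0 : g 0 = size b by rewrite /g !cnt_zero subn0.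
pose lo := cnt (map val b') c - cnt (map val b) c.
have h0 := mc 0; rewrite g0 /g in h0; have lec := le c.
have bd c' : cnt (map val b') c' <= cnt (map val b) c' + lo.
  by have := mc c'; rewrite /g /lo; have := le c'; lia.
have [l0|l0] := posnP lo; first by exists 0, lo; rewrite !cnt_zero.
by exists c, lo; split=> //; move: l0; rewrite /lo; lia.
Qed.

(** What the maximality of a symbol in its class says about its rows alone, or
    about its columns alone. *)
Definition greedy D a := forall a', perm_eq (unzip1 a') (unzip1 a) -> above D a' ->
  wt a' <= wt a -> ~~ (rword a < rword a')%O.

Lemma unzip1_cat (s t : seq L) : unzip1 (s ++ t) = unzip1 s ++ unzip1 t.
Proof. exact: map_cat. Qed.

Lemma wt_cat (s t : seq L) : wt (s ++ t) = wt s + wt t.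
Proof. by rewrite /wt /unzip2 map_cat sumn_cat. Qed.

(** Here s ++ m are the rows, or the columns, of a largest symbol above the
    bound D, and u' are those of a second symbol, which is as long as s. *)
Section Row.
Variables (D : nat -> nat *l nat) (s m : seq L) (u' : seq 'I_P).
Hypothesis gr : greedy D (s ++ m).
Hypothesis ab : above D (s ++ m).
Hypothesis m0 : m != [::].
Hypothesis su : size u' = size s.

Notation n := (size s).
Notation S := (map val (unzip1 s)).
Notation e := (thr D n).

(** The letters of m come first in the word. Hence a rearrangement of s which
    allows for a larger letter in m, at no cost in weight, contradicts
    maximality. *)
Lemma greedy_replace m1 m2 y y' s' : m = m1 ++ y :: m2 -> (letter y < letter y')%O ->
  above D s' -> perm_eq (y'.1 :: unzip1 s') (y.1 :: unzip1 s) ->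
  wt s' + y'.2 <= wt s + y.2 -> False.
Proof.
move=> em lt abs' pe lw.
have sz : size s' = size s by have := perm_size pe; rewrite /= !size_map => -[].
suff /negP[] : ~~ (rword (s ++ m) < rword (s' ++ m1 ++ y' :: m2))%O.
  by rewrite em !catA; apply: rword_lt.
apply: gr; last by rewrite em !wt_cat; move: lw; rewrite /wt /=; lia.
- apply/seq.permP => q; have /seq.permP /(_ q) := pe.
  by rewrite em !unzip1_cat !count_cat /=; lia.
move: ab; rewrite em !above_cat sz abs' /= => /and4P [_ -> le ->].
by rewrite (le_trans le (ltW lt)).
Qed.

Let slack := wt s - base D n.

Lemma base_le : base D n <= wt s.
Proof.
have := above_duality 0; move: ab; rewrite above_cat => /andP [abs _].
by move=> /(_ _ _ abs); rewrite /cnt !(@eq_count _ (gtn 0) pred0) ?count_pred0 ?addn0 // =>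
  ?.
Qed.

Lemma cntS_le c : cnt S c <= cnt e c + slack.
Proof.
move: ab; rewrite above_cat => /andP [/(above_duality c) + _].
by have := base_le; rewrite /slack; lia.
Qed.

Lemma ltS c : P <= c -> cnt S c = n.
Proof. by move=> lc; rewrite cnt_all // size_map. Qed.

Lemma cnte_le c : cnt e c <= n.
Proof. by rewrite -[leqRHS](size_thr D) count_size. Qed.

(** A threshold c with equality in cntS_le is called tight. If there were none,
    s could be rearranged with one unit of weight less, to be given to the last
    letter of m. *)
Lemma valid_ex : exists2 c, c <= P & cnt S c = cnt e c + slack.
Proof.
have [/existsP [c /eqP ec]|/existsPn none] :=
  boolP [exists c : 'I_P.+1, cnt S c == cnt e c + slack].
  by exists c => //; rewrite -ltnS.
exfalso; have lt c : cnt S c < cnt e c + slack.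
  case: (ltnP c P.+1) => lc.
    by have := none (Ordinal lc); have := cntS_le c; rewrite ltn_neqAle => -> /= ->.
  have := none ord_max; have := cntS_le P; have := cnt_mono e (ltnW lc).
  by rewrite /= !ltS ?(ltnW lc) //; lia.
have dl0 : 0 < slack by have := lt P; rewrite ltS // ; have := cnte_le P; lia.
have [|s' [ps abs' ws]] := @arrange D (unzip1 s) slack.-1.
  by move=> c; rewrite size_map; have := lt c; lia.
case: (lastP m) m0 (@greedy_replace) => // m1 y _ /(_ m1 [::] y (y.1, y.2.+1) s').
rewrite cats1; apply=> //; first by rewrite lt_letterE /= ltnSn.
  by rewrite /= perm_cons.
by move: ws; rewrite size_map /=; have := base_le; move: dl0; rewrite /slack; lia.
Qed.

Definition exch (y z : 'I_P) := y :: rem z (unzip1 s).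

Lemma cnt_exch (y z : 'I_P) c : z \in unzip1 s ->
  cnt (map val (exch y z)) c + (val z < c) = cnt S c + (val y < c).
Proof. by move=> zs; rewrite (cnt_rem val c zs) /cnt /= addnC addnA addnAC. Qed.

Lemma size_exch (y z : 'I_P) : z \in unzip1 s -> size (exch y z) = n.
Proof. by move=> zs; have := perm_size (perm_to_rem zs); rewrite /= size_map => ->. Qed.

(** The index of the letter y of m and the index z of s change places. *)
Lemma exch_arrange (y : L) z k c0 : y \in m -> z \in unzip1 s ->
  (letter y < letter (z, k))%O -> (forall c, cnt (map val (exch y.1 z)) c <=
    cnt e c + c0) ->
  base D n + c0 + k <= wt s + y.2 -> False.
Proof.
move=> ym zs lt hc lw; have [|s' [ps abs' ws]] := @arrange D (exch y.1 z) c0.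
  by rewrite size_exch.
case/splitPr: ym (@greedy_replace) => m1 m2 /(_ m1 m2 y (z, k) s' (erefl _) lt abs').
apply; last by move: ws; rewrite size_exch //=; lia.
apply/seq.permP => f; have /seq.permP /(_ f) := ps;
  have /seq.permP /(_ f) := perm_to_rem zs.
by rewrite /=; lia.
Qed.

(** If y.1 < z, exchanging them enlarges a letter of m at constant weights. So
    some threshold between them must be tight, which makes s too heavy after the
    exchange. *)
Lemma valid_above (y : L) z : y \in m -> z \in unzip1 s -> y.1 < z ->
  exists2 c, y.1 < c <= z & cnt S c = cnt e c + slack.
Proof.
move=> ym zs lt.
have [/existsP [c /andP [h /eqP v]]|/existsPn none] :=
  boolP [exists c : 'I_P.+1, (y.1 < c <= z) && (cnt S c == cnt e c + slack)].
  by exists c.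
exfalso; apply: (@exch_arrange y z y.2 slack) => //.
- by rewrite lt_letterE /= ltnn eqxx.
- move=> c; have := cnt_exch y.1 c zs; have := cntS_le c.
  case: (boolP (y.1 < c <= z)) => [/andP [l1 l2]|nb].
    have lc : c < P.+1 by rewrite ltnS (leq_trans l2) // ltnW.
    by have := none (Ordinal lc); rewrite /= l1 l2 /= ltnNge l2 /=; lia.
  by move: nb; case: (ltnP y.1 c); case: (ltnP z c) => //=; lia.
by have := base_le; rewrite /slack; lia.
Qed.

(** If z < y.1, exchanging them enlarges the letter of m only when it gets one
    more unit of weight, which s must save. A tight threshold outside the
    interval prevents this. *)
Lemma valid_outside (y : L) z : y \in m -> z \in unzip1 s -> z < y.1 -> 0 < slack ->
  exists c, [/\ c <= P, ~~ (z < c <= y.1) & cnt S c = cnt e c + slack].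
Proof.
move=> ym zs lt d0.
have [/existsP [c /andP [h /eqP v]]|/existsPn none] :=
  boolP [exists c : 'I_P.+1, (~~ (z < c <= y.1)) && (cnt S c == cnt e c + slack)].
  by exists c; rewrite -ltnS.
have zP : z < P by []. have yP : y.1 < P by [].
exfalso; apply: (@exch_arrange y z y.2.+1 slack.-1) => //.
- by rewrite lt_letterE /= ltnSn.
- have key c : c <= P -> cnt (map val (exch y.1 z)) c <= cnt e c + slack.-1.
    move=> lc; have := none (Ordinal (lc : c < P.+1)); have := cnt_exch y.1 c zs.
    have := cntS_le c; rewrite /=; case: (ltnP z c); case: (leqP c y.1) => /=; lia.
  move=> c; case: (leqP c P) => lc; first exact: key.
  have := key P (leqnn _); have := cnt_exch y.1 c zs; have := cnt_exch y.1 P zs.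
  have := cnt_mono e (ltnW lc); rewrite !ltS ?(ltnW lc) // zP yP !(ltn_trans _ lc) //=.
  by lia.
by have := base_le; rewrite /slack; move: d0; rewrite /slack; lia.
Qed.

(** At the threshold c1 the excess lo of u' over s is greatest; c0 is tight. If
    m has indices below c1, the largest one and the least index of s that is at
    least c1 give a tight threshold between them, by valid_above. If not, let c0
    be the largest tight threshold: by valid_outside all of m lies below it. *)
Lemma row_thresholds : exists c0 c1 lo,
  [/\ cnt S c0 = cnt e c0 + slack,
      cnt (map val u') c1 = cnt S c1 + lo,
      forall c, cnt (map val u') c <= cnt S c + lo &
      (c0 <= c1 /\ forall y, y \in m -> ~~ (c0 <= y.1 < c1)) \/
      (c1 < c0 /\ forall y, y \in m -> c1 <= y.1 < c0)].
Proof.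
have [|c1 [lo [lo1 lo2 c10]]] := @max_gap (unzip1 s) u'; first by rewrite size_map.
have [/hasP [y0 y0m y0c]|/hasPn noy] := boolP (has (fun y : L => y.1 < c1) m).
  (* the largest entry of m below c1 *)
  pose pm := [pred k | has (fun y : L => (y.1 < c1) && (val y.1 == k)) m].
  have exm : exists k, pm k by exists (val y0.1); apply/hasP; exists y0; rewrite ?y0c ?eqxx.
  have bm k : pm k -> k <= P by move=> /hasP [y _ /andP [_ /eqP <-]];
    exact: ltnW (ltn_ord _).
  case: (ex_maxnP exm bm) => ky /hasP [y ym /andP [yc /eqP ey]] my.
  have lo0 : 0 < lo.
    by case: (posnP lo) => // /c10 e; rewrite e in yc.
  have exz : exists k, has (fun z : 'I_P => (c1 <= z) && (val z == k)) (unzip1 s).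
    have : has (fun z : 'I_P => c1 <= z) (unzip1 s).
      rewrite has_count; have := count_predC (fun z : 'I_P => z < c1) (unzip1 s).
      rewrite (eq_count (a1 := predC _) (a2 := fun z : 'I_P => c1 <= z)); last first.
        by move=> z /=; rewrite -leqNgt.
      have : count (fun z : 'I_P => z < c1) (unzip1 s) = cnt S c1 by rewrite /cnt count_map.
      have : cnt (map val u') c1 <= n by rewrite (leq_trans (count_size _ _)) // size_map
        su.
      by rewrite lo1 size_map; lia.
    by case/hasP => z zs zc; exists (val z); apply/hasP; exists z; rewrite ?zc ?eqxx.
  case: (ex_minnP exz) => kz /hasP [z zs /andP [zc /eqP ez]] mz.
  have [c /andP [yc' cz] vc] := valid_above ym zs (leq_trans yc zc).
  have [c0 [c01 yc0 v0]] : exists c0, [/\ c0 <= c1, y.1 < c0 & cnt S c0 = cnt e c0 + slack].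
    case: (leqP c c1) => lc; first by exists c.
    exists c1; split=> //; apply/eqP; rewrite eqn_leq cntS_le /=.
    have -> : cnt S c1 = cnt S c.
      rewrite /cnt !(count_map val); apply: eq_in_count => z' z's /=.
      case: (ltnP z' c1) => l; first by rewrite (ltn_trans l).
      have : kz <= z' by apply: mz; apply/hasP; exists z'; rewrite ?l ?eqxx.
      by rewrite -ez => l'; rewrite ltnNge (leq_trans cz).
    by rewrite vc leq_add2r cnt_mono // ltnW.
  exists c0, c1, lo; split=> //; left; split=> // w wm; apply/negP => /andP [w0 w1].
  have : w.1 <= ky by apply: my; apply/hasP; exists w; rewrite ?w1 ?eqxx.
  by rewrite -ey leqNgt (leq_trans yc0 w0).
have {}noy (y : L) : y \in m -> c1 <= y.1 by move=> /noy; rewrite -leqNgt.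
have [c0 v0 my] : exists2 c0, cnt S c0 = cnt e c0 + slack & forall y : L, y \in m ->
  y.1 < c0.
  case: (posnP slack) => [d0|d0].
    exists P => [|y _]; last exact: ltn_ord.
    by apply/eqP; rewrite eqn_leq cntS_le ltS // d0 addn0 cnte_le.
  have [cv cvP vv] := valid_ex.
  have exv : exists c, (c <= P) && (cnt S c == cnt e c + slack) by exists cv;
    rewrite cvP vv eqxx.
  have bvar c : (c <= P) && (cnt S c == cnt e c + slack) -> c <= P by case/andP.
  case: (ex_maxnP exv bvar) => c0 /andP [c0P /eqP v0] mx0; exists c0 => // y ym.
  rewrite ltnNge; apply/negP => yc0.
  have s0 : has (fun z : 'I_P => z < c0) (unzip1 s).
    rewrite has_count; have : count (fun z : 'I_P => z < c0) (unzip1 s) = cnt S c0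
      by rewrite /cnt count_map.
    by rewrite v0; lia.
  have exz : exists k, has (fun z : 'I_P => (val z == k)) (unzip1 s).
    by case/hasP: s0 => z zs _; exists (val z); apply/hasP; exists z.
  case: (ex_minnP exz) => kz /hasP [z zs /eqP ez] mz.
  have zc0 : z < c0.
    case/hasP: s0 => z' z's lz'; apply: leq_ltn_trans lz'; rewrite ez.
    by apply: mz; apply/hasP; exists z'.
  have [c [cP nc vc]] := valid_outside ym zs (leq_trans zc0 yc0) d0.
  have cc0 : c <= c0 by apply: mx0; rewrite cP vc eqxx.
  have lcz : c <= z.
    by rewrite leqNgt; apply: contra nc => ->; rewrite (leq_trans cc0).
  suff : cnt S c = 0 by rewrite vc; lia.
  rewrite /cnt count_map; apply/eqP; rewrite -leqn0 leqNgt -has_count.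
  apply/hasPn => z' z's /=; rewrite -leqNgt (leq_trans lcz) // ez.
  by apply: mz; apply/hasP; exists z'.
exists c0, c1, lo; split=> //; case: (leqP c0 c1) => lc; [left|right]; split=> // y ym.
  by rewrite (leqNgt c0) my.
by rewrite noy // my.
Qed.
End Row.

End Letters.

(** * Derivatives of minors as coefficients of determinants of series *)

Section Taylor.
Variables (S : comNzRingType) (d : {additive S -> S}) (K : nat).
Hypothesis dM : forall x y, d (x * y) = d x * y + x * d y.
Implicit Types P Q : {poly S}.

(** P is, below degree K, the Taylor series exp(T d) of its constant term. *)
Definition taylor P := forall j, (j.+1 < K)%N -> d P`_j = P^`()`_j.

Lemma taylorM P Q : taylor P -> taylor Q -> taylor (P * Q).
Proof.
move=> hP hQ j lj; rewrite derivM coefM coefD !coefM.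
rewrite raddf_sum -big_split /=; apply: eq_bigr => i _.
rewrite dM hP ?hQ //; first by apply: leq_ltn_trans lj; rewrite ltnS leq_subr.
by apply: leq_ltn_trans lj; rewrite ltnS -ltnS.
Qed.

Lemma taylorD P Q : taylor P -> taylor Q -> taylor (P + Q).
Proof. by move=> hP hQ j lj; rewrite derivD !coefD -hP // -hQ // raddfD. Qed.

Lemma taylorN P : taylor P -> taylor (- P).
Proof. by move=> hP j lj; rewrite derivN !coefN -hP // raddfN. Qed.

Lemma taylor1 : taylor 1.
Proof.
have d1 : d 1 = 0.
  have /eqP := dM 1 1; rewrite !mul1r mulr1 -[X in X == _]addr0 => /eqP /addrI.
  by move=> ->.
by move=> [|j] _; rewrite derivC coef0 coef1 //= raddf0.
Qed.

Lemma taylor_natdet n (F : nat -> nat -> {poly S}) :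
  (forall i j, taylor (F i j)) -> taylor (natdet n F).
Proof.
move=> hF; apply: (big_ind taylor) => [j _|x y|s _]; last first.
- have hs : taylor (\prod_i (\matrix_(i < n, j < n) F i j) i (s i)).
    by apply: (big_ind taylor) => [||i _]; [exact: taylor1|exact: taylorM|rewrite mxE].
  by case: (odd_perm s); rewrite ?expr1 ?expr0 ?mul1r // mulN1r; apply: taylorN.
- exact: taylorD.
by rewrite deriv0 !coef0 raddf0.
Qed.

Lemma taylor_iter P k : taylor P -> (k < K)%N -> iter k d P`_0 = P`_k *+ k`!.
Proof.
move=> hP; elim: k => [|k IH] lk //.
rewrite iterS IH ?(ltn_trans _ lk) // raddfMn /= hP // coef_deriv -mulrnA factS.
by rewrite mulnC.
Qed.
End Taylor.

Section Minors.
Variables (p q : nat) (i0 : 'I_p) (j0 : 'I_q).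
Notation R := (arc_ring p q).

Lemma malg_mulrnI (n : nat) (x y : R) : (0 < n)%N -> x *+ n = y *+ n -> x = y.
Proof.
move=> n0 e; apply/malgP => m; have := congr1 (mcoeff m) e.
by rewrite !mcoeffMn => /eqP; rewrite eqr_pMn2r // => /eqP.
Qed.

Definition xseries K (i : 'I_p) (j : 'I_q) : {poly R} := \poly_(l < K) xvar i j l.

(** The truncation at K does not change the coefficients below K. *)
Definition minor_coef K (r : seq 'I_p) (c : seq 'I_q) k : R :=
  (natdet (size r) (fun a b => xseries K (nth i0 r a) (nth j0 c b)))`_k.

Lemma coef_xseries K i j l : (xseries K i j)`_l = if (l < K)%N then xvar i j l else 0.
Proof. exact: coef_poly. Qed.

Lemma coef_xseries_lt K i j l : (l < K)%N -> (xseries K i j)`_l = xvar i j l.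
Proof. by move=> lt; rewrite coef_xseries lt. Qed.

Lemma taylor_xseries K i j : taylor (derivation (@arc_deriv_var p q)) K (xseries K i j).
Proof.
move=> k lk; rewrite coef_deriv !coef_xseries lk (ltn_trans _ lk) //.
exact: arc_deriv_xvar.
Qed.

(** By taylor_natdet, the minor of the series is the Taylor series of the minor
    of its constant terms. *)
Lemma nderiv_minor K s k : (k < K)%N ->
  arc_nderiv k (minor s) = minor_coef K (unzip1 s) (unzip2 s) k.
Proof.
move=> lk; apply: (malg_mulrnI (fact_gt0 k)); rewrite arc_nderivE /minor_coef.
have hT := taylor_natdet (derivationM (@arc_deriv_var p q)) (size (unzip1 s))
   (fun a b => taylor_xseries (nth i0 (unzip1 s) a) (nth j0 (unzip2 s) b)).
rewrite -(taylor_iter (hT K) lk).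
congr (iter _ _ _); rewrite [X in _ = X]natdet_coef0 size_map.
congr (\det _); apply/matrixP => i j; rewrite [LHS]mxE [RHS]mxE.
have lk0 := leq_ltn_trans (leq0n k) lk.
apply: etrans (esym (coef_xseries_lt _ _ lk0)).
have e1 : (tnth (in_tuple s) i).1 = nth i0 (unzip1 s) i.
  by rewrite (tnth_nth (i0, j0)) (nth_map (i0, j0)).
have e2 : (tnth (in_tuple s) j).2 = nth j0 (unzip2 s) j.
  by rewrite (tnth_nth (i0, j0)) (nth_map (i0, j0)).
by rewrite e1 e2.
Qed.

End Minors.

(** * Rows and columns of symbols *)

Section Symbols2.
Variables (p q : nat).
Notation E := (Esym p q).
Notation J := (Jsym p q).
Implicit Types (F G : E) (j : J).

Definition Erow F : seq ('I_p * nat) := unzip1 (val F).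
Definition Ecol F : seq ('I_q * nat) := unzip2 (val F).
Definition Esz F := size (val F).

Lemma size_Erow F : size (Erow F) = Esz F. Proof. exact: size_map. Qed.
Lemma size_Ecol F : size (Ecol F) = Esz F. Proof. exact: size_map. Qed.

Lemma Esz_gt0 F : (0 < Esz F)%N.
Proof. by case/and3P: (valP F). Qed.

Lemma uniq_Erow F : uniq (unzip1 (Erow F)).
Proof. by have /and3P [_ h _] := valP F; rewrite /unzip1 -map_comp. Qed.

Lemma uniq_Ecol F : uniq (unzip1 (Ecol F)).
Proof. by have /and3P [_ _ h] := valP F; rewrite /unzip1 -map_comp. Qed.

Lemma uniq_size n (s : seq 'I_n) : uniq s -> (size s <= n)%N.
Proof. by move=> us; rewrite -(card_uniqP us) -[leqRHS]card_ord max_card. Qed.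

Lemma Esz_le F : (Esz F <= p)%N.
Proof. by have := uniq_size (uniq_Erow F); rewrite size_map size_Erow. Qed.

Lemma Ewt_sides F : Ewt F = (wt (Erow F) + wt (Ecol F))%N.
Proof.
rewrite /Ewt /wt /unzip2 !sumnE !big_map -big_split /=.
by apply: eq_bigr.
Qed.

Lemma Eword_sides F : Eword F = rword (Erow F) ++ rword (Ecol F).
Proof. by rewrite /Eword /rword -!map_rev -!map_comp. Qed.

Lemma zip_sides (T U : Type) (s : seq (T * U)) : zip (unzip1 s) (unzip2 s) = s.
Proof. by elim: s => //= -[a b] s ->. Qed.

Lemma E_ext F G : Erow F = Erow G -> Ecol F = Ecol G -> F = G.
Proof.
move=> er ec; apply: val_inj.
by rewrite -[LHS]zip_sides -[RHS]zip_sides -!/(Erow _) -!/(Ecol _) er ec.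
Qed.

Lemma E_make (a : seq ('I_p * nat)) (b : seq ('I_q * nat)) : size a = size b ->
  (0 < size a)%N -> uniq (unzip1 a) -> uniq (unzip1 b) ->
  exists2 F, Erow F = a & Ecol F = b.
Proof.
move=> e s0 ua ub.
have h : is_E (zip a b).
  rewrite /is_E size_zip -e minnn s0 /=.
  have e1 : unzip1 (zip a b) = a by rewrite unzip1_zip ?e.
  have e2 : unzip2 (zip a b) = b by rewrite unzip2_zip ?e.
  rewrite (map_comp fst fst) -/(unzip1 (zip a b)) e1 ua /=.
  by rewrite (map_comp fst snd) -/(unzip2 (zip a b)) e2 ub.
by exists (Sub (zip a b) h); rewrite /Erow /Ecol SubK ?unzip1_zip ?unzip2_zip ?e.
Qed.

Definition Jrow j := unzip1 (val j).2.
Definition Jcol j := unzip2 (val j).2.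

Lemma perm_sort_ord n (s t : seq 'I_n) : sorted ltn (map val s) ->
  perm_eq s t -> sort (@ord_leq n) t = s.
Proof.
move=> ss pe; apply: (@sorted_eq _ (@ord_leq n)).
- by move=> x y z; apply: leq_trans.
- by move=> x y /andP h; apply: val_inj; apply/eqP; rewrite eqn_leq; apply/andP.
- by apply: sort_sorted => x y; apply: leq_total.
- by move: ss; rewrite sorted_map; apply: sub_sorted => x y; apply: ltnW.
by rewrite perm_sort perm_sym.
Qed.

Lemma sorted_Jrow j : sorted ltn (map val (Jrow j)).
Proof. by have /and3P [_ h _] := valP j; rewrite /Jrow /unzip1 -map_comp. Qed.
Lemma sorted_Jcol j : sorted ltn (map val (Jcol j)).
Proof. by have /and3P [_ _ h] := valP j; rewrite /Jcol /unzip2 -map_comp. Qed.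
Lemma size_Jrow j : size (Jrow j) = Jsz j. Proof. exact: size_map. Qed.
Lemma size_Jcol j : size (Jcol j) = Jsz j. Proof. exact: size_map. Qed.
Lemma Jsz_gt0 j : (0 < Jsz j)%N. Proof. by case/and3P: (valP j). Qed.
Lemma uniq_Jrow j : uniq (Jrow j).
Proof.
have := sorted_Jrow j; rewrite -(map_inj_uniq val_inj) ltn_sorted_uniq_leq.
by case/andP.
Qed.
Lemma uniq_Jcol j : uniq (Jcol j).
Proof.
have := sorted_Jcol j; rewrite -(map_inj_uniq val_inj) ltn_sorted_uniq_leq.
by case/andP.
Qed.

(** The class of a symbol is determined by its total weight and by its rows and
    columns as unordered sets. *)
Lemma EnormP F j : Enorm F = j <->
  [/\ Ewt F = Jwt j, perm_eq (unzip1 (Erow F)) (Jrow j) & perm_eq (unzip1 (Ecol F)) (Jcol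
    j)].
Proof.
have er : [seq a.1.1 | a <- val F] = unzip1 (Erow F) by rewrite /unzip1 -map_comp.
have ec : [seq a.2.1 | a <- val F] = unzip1 (Ecol F) by rewrite /unzip1 -map_comp.
split=> [<-|[ew pr pc]].
  rewrite /Jwt /Jrow /Jcol /= er ec; split=> //.
    by rewrite unzip1_zip ?size_sort ?size_map // perm_sym perm_sort.
  by rewrite unzip2_zip ?size_sort ?size_map // perm_sym perm_sort.
apply: val_inj; rewrite /= /Enorm_val er ec.
rewrite (perm_sort_ord (sorted_Jrow j)) 1?perm_sym //.
rewrite (perm_sort_ord (sorted_Jcol j)) 1?perm_sym //.
by rewrite ew zip_sides -surjective_pairing.
Qed.

Lemma J_make k (r : seq 'I_p) (c : seq 'I_q) : size r = size c ->
  (0 < size r)%N -> uniq r -> uniq c ->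
  exists j, [/\ Jwt j = k, perm_eq (Jrow j) r & perm_eq (Jcol j) c].
Proof.
move=> e s0 ur uc.
have [|||| F er ec] := @E_make [seq (x, 0%N) | x <- r] [seq (x, 0%N) | x <- c];
  rewrite /unzip1 -?map_comp ?map_id ?size_map //.
have [_ pr pc] := (EnormP F _).1 (erefl (Enorm F)).
pose s := (val (Enorm F)).2.
exists (Sub (k, s) (valP (Enorm F)) : J); rewrite /Jwt /Jrow /Jcol SubK; split=> //.
  by rewrite perm_sym -(map_id r) (map_comp fst (fun x => (x, 0%N)) r) -er.
by rewrite perm_sym -(map_id c) (map_comp fst (fun x => (x, 0%N)) c) -ec.
Qed.

Section Values.
Variables (i0 : 'I_p) (j0 : 'I_q) (K : nat).
Notation mR := (minor_coef i0 j0 K).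

Lemma minor_coef_Jval j r c : (Jwt j < K)%N -> perm_eq (Jrow j) r -> perm_eq (Jcol j) c ->
  exists b : bool, mR r c (Jwt j) = (-1) ^+ b * Jval j.
Proof.
move=> lk pr pc; rewrite /Jval (nderiv_minor i0 j0 _ lk) -/(Jrow j) -/(Jcol j) /minor_coef.
rewrite perm_sym in pr; rewrite perm_sym in pc.
have es : size r = size c by rewrite (perm_size pr) (perm_size pc) size_Jrow size_Jcol.
have [b eb] := natdet_permlr i0 j0 (xseries K) pr pc es.
by exists b; rewrite eb coef_sign (perm_size pr).
Qed.

Lemma minor_coef_nuniq r c k : size r = size c -> ~~ uniq r || ~~ uniq c -> mR r c k = 0.
Proof.
move=> e /orP [ur|uc]; rewrite /minor_coef.
  by rewrite (natdet_nuniql i0 (fun x b => xseries K x (nth j0 c b)) ur) coef0.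
by rewrite natdet_tr e (natdet_nuniql j0 (fun x a => xseries K (nth i0 r a) x) uc) coef0.
Qed.
End Values.
End Symbols2.

(** * Largest symbols above a bound *)

Section Words.
Local Open Scope nat_scope.
Implicit Types (s t x y : seqlexi (nat *l nat)).

Lemma ltxi_cat s t x y : size s = size t -> (s < t)%O ->
  (s ++ x < t ++ y :> seqlexi (nat *l nat))%O.
Proof.
elim: s t => [|a s IH] [|b t] //= [e]; rewrite !ltxi_cons => /andP [-> /implyP h] /=.
by apply/implyP => /h; apply: IH.
Qed.

Lemma lexi_cat s t x y : size s = size t -> (s <= t)%O -> (x < y)%O ->
  (s ++ x < t ++ y :> seqlexi (nat *l nat))%O.
Proof.
move=> e; rewrite le_eqVlt => /orP [/eqP <- lt|lt _]; last exact: ltxi_cat.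
by elim: s {e} => //= a s IH; rewrite eqhead_ltxiE.
Qed.
End Words.

Section RaiseTop.
Local Open Scope nat_scope.
Variable P : nat.
Implicit Types a : seq ('I_P * nat).

(** The last letter is the first one of the word: giving weight to it enlarges
    the word and respects every bound. *)
Lemma raise_top a k : 0 < size a -> exists a2,
  [/\ unzip1 a2 = unzip1 a, wt a2 = wt a + k, forall D, above D a -> above D a2,
      (rword a <= rword a2)%O & 0 < k -> (rword a < rword a2)%O].
Proof.
case: (lastP a) => // t z _; exists (rcons t (z.1, z.2 + k)).
have lz : (letter z <= letter (z.1, z.2 + k))%O.
  by rewrite le_letterE /= leqnn andbT; case: ltngtP; lia.
split.
- by rewrite /unzip1 !map_rcons.
- by rewrite -!cats1 !wt_cat /wt /=; lia.
- move=> D; rewrite -!cats1 !above_cat /= !andbT => /andP [-> /=].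
  by move/le_trans; apply.
- rewrite /rword !rev_rcons /= lexi_cons lz /=.
  by apply/implyP.
move=> k0; rewrite /rword !rev_rcons /= ltxi_cons lz /=; apply/implyP.
by rewrite le_letterE /=; case: ltngtP => /=; lia.
Qed.
End RaiseTop.

Section Bounds.
Local Open Scope nat_scope.
Variables (p q : nat).
Notation E := (Esym p q).
Notation J := (Jsym p q).
Implicit Types (F G : E) (j : J) (o : option E).

Definition letters (n : nat) (s : seq ('I_n * nat)) : nat -> nat *l nat :=
  fun i => nth (0, 0) [seq letter x | x <- s] i.

(** [o] is the previous factor; [None], before the first factor, imposes no
    bound. *)
Definition brow o := if o is Some F then letters (Erow F) else fun=> (0, 0).
Definition bcol o := if o is Some F then letters (Ecol F) else fun=> (0, 0).
Definition bsz o := if o is Some F then Esz F else p.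
Definition Ble o G := if o is Some F then Ele F G else true.

Lemma above0 n (s : seq ('I_n * nat)) (D : nat -> nat *l nat) :
  (forall i, D i = (0, 0)) -> above D s.
Proof.
elim: s D => //= x s IH D hD; rewrite hD IH => [|i]; last exact: hD.
by rewrite le_letterE /= andbT; case: x.2.
Qed.

Lemma BleE o G : Ble o G = [&& Esz G <= bsz o, above (brow o) (Erow G) & above (bcol o)
  (Ecol G)].
Proof.
case: o => [F|] /=; last by rewrite Esz_le !above0.
rewrite /Ele -/(Esz _) -/(Esz _); apply: andb_id2l; rewrite /Esz /Erow /Ecol.
elim: (val G) (val F) => [|b t IH] [|a s] //= lt; rewrite IH //.
have sh n (x : 'I_n * nat) r : shift 1 (letters (x :: r)) =1 letters r by move=> i.
by rewrite !(eq_above _ (sh _ _ _)) /letters /=; case: (_ <= _)%O; case: (_ <= _)%O => //=;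
  rewrite ?andbF.
Qed.

Lemma size_urow F : size (unzip1 (Erow F)) = Esz F. Proof. by rewrite !size_map. Qed.
Lemma size_ucol F : size (unzip1 (Ecol F)) = Esz F. Proof. by rewrite !size_map. Qed.

Lemma Eprec_same F G : Esz F = Esz G -> Ewt F = Ewt G -> Eprec F G = (Eword F < Eword G)%O.
Proof. by move=> e ew; rewrite /Eprec -!/(Esz _) e ew ltnn !eqxx ltnn. Qed.

Lemma Enorm_sz F G : Enorm F = Enorm G -> Esz F = Esz G.
Proof.
move=> e; have [_ /perm_size s1 _] := (EnormP F (Enorm G)).1 e.
have [_ /perm_size s2 _] := (EnormP G (Enorm G)).1 erefl.
by move: s1 s2; rewrite !size_urow => -> ->.
Qed.

Lemma Enorm_wt F G : Enorm F = Enorm G -> Ewt F = Ewt G.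
Proof.
move=> e; have [-> _ _] := (EnormP F (Enorm G)).1 e.
by have [-> _ _] := (EnormP G (Enorm G)).1 erefl.
Qed.

(** The maximality condition of standardness, uniformly for the first factor and
    for the next ones. *)
Definition best o F := largest (fun G => Enorm G = Enorm F /\ Ble o G) F.

Lemma best_no_larger o F (a : seq ('I_p * nat)) (b : seq ('I_q * nat)) : best o F ->
  perm_eq (unzip1 a) (unzip1 (Erow F)) -> perm_eq (unzip1 b) (unzip1 (Ecol F)) ->
  above (brow o) a -> above (bcol o) b -> wt a + wt b = Ewt F ->
  ~~ (Eword F < rword a ++ rword b)%O.
Proof.
move=> [[_ bF] mx] pa pb aa ab ew; apply/negP => lt.
have sa : size a = Esz F by have := perm_size pa; rewrite size_map size_urow.
have sb : size b = Esz F by have := perm_size pb; rewrite size_map size_ucol.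
have [||||G er ec] := @E_make p q a b; rewrite ?sa ?sb ?Esz_gt0 //.
- by rewrite (perm_uniq pa) uniq_Erow.
- by rewrite (perm_uniq pb) uniq_Ecol.
have [ew' pr pc] := (EnormP F _).1 (erefl (Enorm F)).
have eG : Enorm G = Enorm F.
  apply/EnormP; rewrite Ewt_sides er ec ew ew'; split=> //.
    by rewrite (perm_trans pa).
  by rewrite (perm_trans pb).
have [|eGF|pGF] := mx G.
- by split=> //; move: bF; rewrite !BleE er ec aa ab (Enorm_sz eG) => /andP [->].
- by move: lt; rewrite -er -ec -Eword_sides eGF ltxx.
move: pGF; rewrite Eprec_same ?(Enorm_sz eG) ?(Enorm_wt eG) //.
by rewrite [X in (X < _)%O]Eword_sides er ec lt_gtF.
Qed.

(** Weight that the new rows do not use goes to their last letter. *)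
Lemma best_greedy_row o F : best o F -> greedy (brow o) (Erow F).
Proof.
move=> bF a' pa aa lw; apply/negP => lt.
have sa : size a' = Esz F by have := perm_size pa; rewrite size_map size_urow.
have [|a2 [u2 w2 ab2 le2 _]] := @raise_top p a' (wt (Erow F) - wt a');
  first by rewrite sa Esz_gt0.
have aF : above (bcol o) (Ecol F) by case: bF => -[_]; rewrite BleE => /and3P [].
have /negP[] : ~~ (Eword F < rword a2 ++ rword (Ecol F))%O.
  apply: (best_no_larger bF) => //; first by rewrite u2.
    exact: ab2.
  by rewrite w2 Ewt_sides; lia.
rewrite Eword_sides; apply: ltxi_cat; last exact: lt_le_trans le2.
have s2 := congr1 size u2; rewrite !size_map in s2.
by rewrite !size_map !size_rev s2 sa size_Erow.
Qed.

(** Weight that the new columns do not use goes to the rows, which come first in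
    the word. *)
Lemma best_greedy_col o F : best o F -> greedy (bcol o) (Ecol F).
Proof.
move=> bF b' pb ab lw; apply/negP => lt.
have [|a2 [u2 w2 ab2 le2 _]] := @raise_top p (Erow F) (wt (Ecol F) - wt b').
  by rewrite size_Erow Esz_gt0.
have aF : above (brow o) (Erow F) by case: bF => -[_]; rewrite BleE => /and3P [].
have /negP[] : ~~ (Eword F < rword a2 ++ rword b')%O.
  apply: (best_no_larger bF) => //; first by rewrite u2.
    exact: ab2.
  by rewrite w2 Ewt_sides; lia.
rewrite Eword_sides; apply: lexi_cat => //.
have s2 := congr1 size u2; rewrite size_map size_urow in s2.
by rewrite !size_map !size_rev s2 size_Erow.
Qed.

End Bounds.

(** * Free and bad indices *)

Lemma perm_map_lift (T U : eqType) (f : T -> U) (s : seq U) (t : seq T) :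
  perm_eq s (map f t) -> exists2 t', perm_eq t' t & s = map f t'.
Proof.
elim: s t => [|x s IH] t pe.
  by have /eqP := perm_size pe; rewrite size_map eq_sym => /nilP ->; exists [::].
have /mapP [y yt ex] : x \in map f t by rewrite -(perm_mem pe) mem_head.
have [|t' pt' es] := IH (rem y t).
  by rewrite -(perm_cons x) (perm_trans pe) // ex -map_cons perm_map // perm_to_rem.
by exists (y :: t'); rewrite ?es ?ex // perm_sym (permPl (perm_to_rem yt)) perm_cons
  perm_sym.
Qed.

Section Pointwise.
Local Open Scope nat_scope.
Variables (P : nat) (T : eqType) (f g : T -> 'I_P).

Lemma pointwise_above (z : seq (T * nat)) D : (forall x, x \in z -> f x.1 <= g x.1) ->
  above D [seq (f x.1, x.2) | x <- z] -> above D [seq (g x.1, x.2) | x <- z].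
Proof.
elim: z D => //= x z IH D h /andP [le ab]; apply/andP; split.
  apply: le_trans le _; rewrite le_letterE /= eqxx ltnn /=.
  by rewrite h ?mem_head.
by apply: IH => // y yz; apply: h; rewrite in_cons yz orbT.
Qed.

Lemma pointwise_lexi (z : seq (T * nat)) : (forall x, x \in z -> f x.1 <= g x.1) ->
  ([seq letter (f x.1, x.2) | x <- z] <= [seq letter (g x.1,
    x.2) | x <- z] :> seqlexi (nat *l nat))%O.
Proof.
elim: z => //= x z IH h; rewrite lexi_cons IH ?implybT ?andbT.
  by rewrite le_letterE /= eqxx ltnn /= h ?mem_head.
by move=> y yz; apply: h; rewrite in_cons yz orbT.
Qed.

Lemma pointwise_ltxi (z : seq (T * nat)) y : (forall x, x \in z -> f x.1 <= g x.1) ->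
  y \in z -> f y.1 < g y.1 ->
  ([seq letter (f x.1, x.2) | x <- z] < [seq letter (g x.1,
    x.2) | x <- z] :> seqlexi (nat *l nat))%O.
Proof.
elim: z => //= x z IH h yz lt; rewrite ltxi_cons !le_letterE /= !eqxx !ltnn /=.
rewrite h ?mem_head //=; move: yz; rewrite in_cons => /orP [/eqP <-|yz].
  by rewrite leqNgt lt.
by rewrite IH ?implybT // => w wz; apply: h; rewrite in_cons wz orbT.
Qed.
End Pointwise.

Section Side.
Local Open Scope nat_scope.
Variables (P h h' : nat) (i0 : 'I_P) (u u' : seq 'I_P).
Hypothesis su : size u = h.
Hypothesis su' : size u' = h'.
Notation N := (h + h').
Implicit Types (e : {ffun 'I_N -> bool}).

Definition entry i := nth i0 (u ++ u') i.
Notation w := entry.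

Lemma entry_lo : map w (iota 0 h) = u.
Proof.
rewrite -[RHS](mkseq_nth i0) su; apply/eq_in_map => i.
by rewrite mem_iota /w nth_cat su => /andP [_ ->].
Qed.

Lemma entry_hi : map w (iota h h') = u'.
Proof.
rewrite -[h in iota h]addn0 iotaDl -map_comp -[RHS](mkseq_nth i0) su'.
by apply: eq_map => i; rewrite /w /= nth_cat su ltnNge leq_addr addKn.
Qed.

Lemma card_entry (f g : pred nat) :
  #|[pred i : 'I_N | (i < h) && f (w i) || (h <= i) && g (w i)]| =
  count f (map val u) + count g (map val u').
Proof.
rewrite -[X in count f (map val X)]entry_lo -[X in count g (map val X)]entry_hi -!map_comp
  !count_map.
transitivity (count (fun i => (i < h) && f (w i) || (h <= i) && g (w i)) (iota 0 N)).
  by rewrite -val_enum_ord count_map -sum1_card -sum1_count big_enum_cond.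
rewrite iotaD count_cat; congr (_ + _); apply: eq_in_count => i; rewrite mem_iota /= !add0n.
  by move=> lt; rewrite lt leqNgt lt orbF.
by move=> /andP [le _]; rewrite le ltnNge le.
Qed.

Variables c0 c1 : nat.
(** The set of free indices [Gset] and the set of bad indices [Bset] for the
    thresholds of row_thresholds, when the rows u of the first minor come before
    the rows u' of the second one. *)
Definition Gset : pred nat := fun i =>
  if c0 <= c1 then (i < h) && (c1 <= w i) || (h <= i) && (c0 <= w i < c1)
  else (i < h) && (c1 <= w i < c0) || (h <= i) && (w i < c1).
Definition Bset : pred nat := fun i =>
  if c0 <= c1 then (i < h) && (w i < c0) else (h <= i) && (c0 <= w i).

Lemma GBset i : Gset i -> ~~ Bset i.
Proof.
rewrite /Gset /Bset; case: (leqP c0 c1) => lc; case: (ltnP i h) => li //=.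
  by rewrite orbF -leqNgt; apply: leq_trans.
by rewrite -ltnNge => /ltn_trans; apply.
Qed.

Lemma Gset_out i : Gset i -> i < h -> c1 <= w i.
Proof. by rewrite /Gset; case: ifP => _ + lt; rewrite lt (leqNgt h) lt /= orbF // => /andP
  []. Qed.

Lemma Gset_in i : Gset i -> h <= i -> w i < c1.
Proof. by rewrite /Gset; case: ifP => _ + lt; rewrite lt (ltnNge i) lt /= // => /andP [].
  Qed.

Section Good.
Variable e : {ffun 'I_N -> bool}.
Hypothesis ad : admissible Gset Bset e.
Hypothesis sz : size (part e true) = h'.
Hypothesis sw : swaps Bset e = 0.

Lemma good_move (i : 'I_N) : e i != (h <= i) -> Gset i.
Proof.
move=> ne; apply: contraT => ng; have := card0_eq sw i; rewrite !inE ne andbT => nb.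
by rewrite ad ?nb ?eqxx in ne.
Qed.

(** Without bad swaps, indices of u that are at least c1 have been exchanged
    with indices of u' below c1. Putting the former back in place of the latter,
    letter by letter, enlarges the word. *)
Lemma good_replace (a1 : seq ('I_P * nat)) : perm_eq (unzip1 a1) (map w (part e false)) ->
  exists a2, [/\ perm_eq (unzip1 a2) u, wt a2 = wt a1,
    forall D, above D a1 -> above D a2, (rword a1 <= rword a2)%O &
    e != initial_colouring h h' -> (rword a1 < rword a2)%O].
Proof.
case/perm_map_lift => pos pp ea.
pose inn := [seq i <- part e false | h <= i].
pose out := [seq i <- iota 0 h | i \notin part e false].
have sub i : i \in part e false -> i < h -> i \in iota 0 h by move=> _; rewrite mem_iota.
have kp : perm_eq (part e false) ([seq i <- part e false | i < h] ++ inn).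
  rewrite -(perm_filterC (fun i => i < h) (part e false)).
  rewrite /inn (eq_filter (a1 := fun i => h <= i) (a2 :=
    predC (fun i => i < h))) // => i /=.
  by rewrite -leqNgt.
have kp' : perm_eq (iota 0 h) ([seq i <- part e false | i < h] ++ out).
  rewrite -(perm_filterC (fun i => i \in part e false) (iota 0 h)).
  rewrite perm_cat2r.
  apply: uniq_perm; rewrite ?filter_uniq ?iota_uniq ?uniq_part // => i.
  by rewrite !mem_filter mem_iota add0n leq0n /= andbC.
have sio : size inn = size out.
  have s1 := perm_size kp; have s2 := perm_size kp'; rewrite !size_cat size_iota in s1 s2.
  by have := size_part2 e; rewrite sz s1 => /addIn /eqP;
    rewrite [X in _ == X]s2 eqn_add2l => /eqP.
pose f i := if i < h then i else nth 0 out (index i inn).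
have fle i : i \in part e false -> w i <= w (f i) /\ (h <= i -> w i < w (f i)).
  move=> ie; rewrite /f; case: ltnP => [//|li].
  have ii : i \in inn by rewrite mem_filter li.
  have lo : nth 0 out (index i inn) \in out by rewrite mem_nth // -sio index_mem.
  suff lt : w i < w (nth 0 out (index i inn)) by split=> //; apply: ltnW.
  move: lo; rewrite mem_filter mem_iota add0n leq0n /= => /andP [no lo].
  set o := nth _ _ _ in no lo *.
  have lN : o < N by apply: leq_trans lo _; rewrite leq_addr.
  have eo : e (Ordinal lN) = true.
    by move: no; rewrite -[o]/(val (Ordinal lN)) mem_part; case: (e _).
  have iN := part_lt ie; have ei : e (Ordinal iN) = false.
    by move: ie; rewrite -[i]/(val (Ordinal iN)) mem_part => /eqP.
  have g1 : Gset i by apply: (@good_move (Ordinal iN)); rewrite ei /= li.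
  have g2 : Gset o by apply: (@good_move (Ordinal lN)); rewrite eo /= leqNgt lo.
  exact: leq_trans (Gset_in g1 li) (Gset_out g2 lo).
have mf : perm_eq (map f (part e false)) (iota 0 h).
  rewrite (perm_trans (perm_map f kp)) // perm_sym (perm_trans kp') // map_cat.
  rewrite (_ : map f [seq i <- part e false | i < h] = [seq i <- part e false | i < h]);
    last first.
    by rewrite -[RHS]map_id; apply/eq_in_map => i; rewrite mem_filter /f => /andP [-> _].
  rewrite perm_cat2l (_ : map f inn = out) //.
  apply: (@eq_from_nth _ 0); rewrite size_map // => i li; rewrite (nth_map 0) // /f.
  have : nth 0 inn i \in inn by rewrite mem_nth.
  rewrite mem_filter ltnNge => /andP [-> _] /=.
  by rewrite index_uniq // filter_uniq // uniq_part.
pose z := zip pos (unzip2 a1).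
have sp : size pos = size (unzip2 a1).
  by have := congr1 size ea; rewrite !size_map => ->.
have ea1 : a1 = [seq (w x.1, x.2) | x <- z].
  rewrite -{1}[a1]zip_sides ea /z; elim: (pos) (unzip2 a1) {sp ea} => [|x s IH] [|y t] //=.
  by rewrite IH.
have zin x : x \in z -> x.1 \in part e false.
  move=> xz; rewrite -(perm_mem pp); have <- : unzip1 z = pos by rewrite unzip1_zip ?sp.
  exact: map_f.
exists [seq (w (f x.1), x.2) | x <- z].
have uz : unzip1 [seq (w (f x.1), x.2) | x <- z] = map w (map f pos).
  have <- : unzip1 z = pos by rewrite unzip1_zip ?sp.
  by rewrite /unzip1 -!map_comp.
split.
- by rewrite uz -[X in perm_eq _ X]entry_lo perm_map // (perm_trans _ mf) // perm_map.
- by rewrite [in RHS]ea1 /wt /unzip2 -!map_comp.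
- move=> D; rewrite ea1; apply: (pointwise_above (f := w) (g :=
  w \o f)) => x /zin /fle [] //.
- rewrite ea1 /rword -!map_rev -!map_comp.
  apply: (pointwise_lexi (f := w) (g := w \o f)) => x; rewrite mem_rev => /zin /fle [] //.
move=> ne; have [i] : exists i : 'I_N, (h <= i) && (e i == false).
  apply/existsP; apply: contraNT ne; rewrite negb_exists => /forallP hn.
  have in0 : inn = [::].
    apply/eqP; rewrite -[_ == _]negbK -has_filter -all_predC; apply/allP => i ie.
    have iN := part_lt ie; have := hn (Ordinal iN); rewrite negb_and /=.
    by move: ie; rewrite -[i]/(val (Ordinal iN)) mem_part => /eqP -> ; rewrite eqxx orbF.
  have out0 : out = [::] by apply/nilP; rewrite /nilp -sio in0.
  apply/eqP/ffunP => i; rewrite ffunE; case: leqP => li; have := hn i; rewrite negb_and.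
    by rewrite li /=; case: (e i).
  move=> _; have : val i \notin out by rewrite out0.
  by rewrite mem_filter mem_iota /= add0n li andbT negbK mem_part => /eqP.
case/andP => li /eqP ei; rewrite ea1 /rword -!map_rev -!map_comp.
have iz : val i \in pos by rewrite (perm_mem pp) mem_part ei.
have /mapP [x xz ex] : val i \in unzip1 z by rewrite unzip1_zip ?sp.
apply: (pointwise_ltxi (f := w) (g := w \o f) (y := x)); rewrite ?mem_rev //.
  by move=> y; rewrite mem_rev => /zin /fle [].
by rewrite -ex; case: (fle (val i)) => [|_]; [rewrite mem_part ei|apply].
Qed.
End Good.

Lemma count_part e b (f : pred nat) :
  count f (part e b) = #|[pred i : 'I_N | (e i == b) && f i]|.
Proof.
rewrite -sum1_card -sum1_count /part big_map big_filter_cond.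
by rewrite big_enum_cond.
Qed.

Lemma card_disjoint (A B C : pred 'I_N) : (forall i, A i -> B i -> false) ->
  (forall i, A i || B i -> C i) -> #|A| + #|B| <= #|C|.
Proof.
move=> dis sub; rewrite -cardUI [X in _ + X]eq_card0 ?addn0.
  by apply: subset_leq_card; apply/subsetP => i; rewrite !inE; apply: sub.
by move=> i; rewrite !inE; apply/negP => /andP [/dis] + /[dup] => h1 /h1.
Qed.

(** If c0 <= c1, no index below c0 leaves the second minor and each bad swap
    brings one in. If c1 < c0, no index that is at least c0 enters the second
    minor and each bad swap takes one out. *)
Lemma heavy_count e : admissible Gset Bset e -> size (part e true) = h' ->
  cnt (map val u') c0 + swaps Bset e <= cnt (map val (map w (part e true))) c0.
Proof.
move=> ad sz.
have eu' f : count f (map val u') = #|[pred i : 'I_N | (h <= i) && f (w i)]|.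
  rewrite -[LHS]add0n -[X in X + _](count_pred0 (map val u)) -card_entry.
  by apply: eq_card => i; rewrite !inE andbF.
rewrite /cnt eu' (count_map val) (count_map w) count_part; case: (leqP c0 c1) => lc.
  apply: card_disjoint => i; rewrite /Bset lc /=.
    by move=> /andP [li _] /andP [/andP [li' _] _]; move: li'; rewrite ltnNge li.
  case/orP => [/andP [li wi]|/andP [/andP [li wi] ne]]; rewrite wi andbT.
    rewrite ad ?li // /Gset /Bset lc ltnNge li //=.
    by rewrite negb_and -ltnNge wi.
  by move: ne; rewrite leqNgt li eqbF_neg negbK => ->.
have e1 : #|[pred i : 'I_N | (e i == true) && (w i < c0)]| +
          #|[pred i : 'I_N | (e i == true) && (c0 <= w i)]| = h'.
  rewrite -[RHS]sz -(count_predC (fun i => w i < c0) (part e true)) !count_part.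
  by congr (_ + _); apply: eq_card => i; rewrite !inE -leqNgt.
have e2 : #|[pred i : 'I_N | (h <= i) && (w i < c0)]| +
          #|[pred i : 'I_N | (h <= i) && (c0 <= w i)]| = h'.
  rewrite -[RHS]su' -(size_map val u') -(count_predC (gtn c0)) !eu'.
  by congr (_ + _); apply: eq_card => i; rewrite !inE /= -leqNgt.
suff : #|[pred i : 'I_N | (e i == true) && (c0 <= w i)]| + swaps Bset e <=
   #|[pred i : 'I_N | (h <= i) && (c0 <= w i)]| by move: e1 e2; rewrite /=; lia.
have nl : (c0 <= c1) = false by apply/negbTE; rewrite -ltnNge.
apply: card_disjoint => i; rewrite /Bset nl /=.
  by move=> /andP [/eqP ei _] /andP [/andP [li _]]; rewrite ei li.
case/orP => [/andP [/eqP ei wi]|/andP [] //]; rewrite wi andbT.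
case: leqP => // li; exfalso; suff : e i = (h <= i) by rewrite ei (leqNgt h) li.
apply: ad.
  rewrite /Gset nl li (leqNgt h) li /= orbF negb_and -(leqNgt c0) wi.
  by rewrite orbT.
by rewrite /Bset nl leqNgt li.
Qed.
End Side.

Section SideData.
Local Open Scope nat_scope.
Variables (P : nat) (i0 : 'I_P).
Implicit Types (a : seq ('I_P * nat)) (u : seq 'I_P).

Lemma eq_thr D D' n : D =1 D' -> thr D n = thr D' n.
Proof.
by elim: n D D' => //= n IH D D' e; rewrite e (IH _ (shift 1 D')) // => i; rewrite /shift e.
Qed.

Lemma eq_base D D' n : D =1 D' -> base D n = base D' n.
Proof.
by elim: n D D' => //= n IH D D' e; rewrite e (IH _ (shift 1 D')) // => i; rewrite /shift e.
Qed.

Lemma thr_letters (s m : seq ('I_P * nat)) : thr (letters (s ++ m)) (size s) =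
  map val (unzip1 s).
Proof. by elim: s => //= x s IH; rewrite -IH; congr (_ :: _); apply: eq_thr. Qed.

Lemma base_letters (s m : seq ('I_P * nat)) : base (letters (s ++ m)) (size s) =
  wt s :> nat.
Proof. by rewrite /wt; elim: s => //= x s IH; rewrite -IH; congr (_ + _);
  apply: eq_base. Qed.

Lemma count_interval s c d : c <= d -> count (fun x => c <= x < d) s + cnt s c = cnt s d.
Proof.
move=> lcd; rewrite /cnt addnC -count_predUI [X in _ + X](eq_count (a2 := pred0)).
  rewrite count_pred0 addn0; apply: eq_count => x /=.
  by case: (ltnP x c) => //= lx; rewrite (leq_trans lx).
by move=> x /=; case: ltnP.
Qed.

Lemma count_geq s c : count (fun x => c <= x) s + cnt s c = size s.
Proof. by rewrite addnC -(count_predC (gtn c) s); congr (_ + _); apply: eq_count => x /=;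
  rewrite -leqNgt. Qed.

(** The number of free and bad indices enters the exponent of S - 1. *)
Lemma card_GB (s m : seq ('I_P * nat)) u' c0 c1 (a := s ++ m) : size s = size u' ->
  (c0 <= c1 /\ forall y, y \in m -> ~~ (c0 <= y.1 < c1)) \/
  (c1 < c0 /\ forall y, y \in m -> c1 <= y.1 < c0) ->
  #|[pred i : 'I_(size a + size u') | Gset (size a) i0 (unzip1 a) u' c0 c1 i
        || Bset (size a) i0 (unzip1 a) u' c0 c1 i]|
   + cnt (map val u') c0 + cnt (map val (unzip1 s)) c1 =
  size a + cnt (map val u') c1 + cnt (map val (unzip1 s)) c0.
Proof.
move=> ss hc; have sz : size (unzip1 a) = size a by rewrite size_map.
have cm (f : pred nat) : (forall y, y \in m -> ~~ f (val y.1)) ->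
  count f (map val (unzip1 m)) = 0.
  move=> hf; apply/eqP; rewrite -leqn0 leqNgt -has_count; apply/hasPn.
  by move=> _ /mapP [_ /mapP [y ym ->] ->]; apply: hf.
have ca c : cnt (map val (unzip1 a)) c = cnt (map val (unzip1 s)) c + cnt (map val (unzip1
  m)) c.
  by rewrite /a unzip1_cat map_cat cnt_cat.
have sa : size a = size s + size m by rewrite size_cat.
have szv t : size (map val (unzip1 t)) = size t by rewrite !size_map.
case: hc => -[lc hm].
  rewrite -[X in X + _ + _](_ : count (fun x => (c1 <=
    x) || (x < c0)) (map val (unzip1 a)) +
      count (fun x => c0 <= x < c1) (map val u') = _); last first.
    rewrite -(card_entry i0 sz (erefl (size u'))); apply: eq_card => i;
      rewrite !inE /Gset /Bset lc.
    by rewrite andb_orr -!orbA; congr (_ || _); rewrite orbC.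
  have -> : count (fun x => (c1 <= x) || (x < c0)) (map val (unzip1 a)) =
      count (fun x => c1 <= x) (map val (unzip1 a)) + cnt (map val (unzip1 a)) c0.
    rewrite /cnt -count_predUI [X in _ + X](eq_count (a2 := pred0)) ?count_pred0 ?addn0 //.
    by move=> x /=; apply/negP => /andP [/(leq_trans lc)]; rewrite leqNgt => /negP.
  have := count_geq (map val (unzip1 a)) c1; have := count_interval (map val u') lc.
  have := count_interval (map val (unzip1 m)) lc; rewrite cm //.
  rewrite szv !ca.
  have arith (m0 m1 v u0 u1 x s0 s1 n : nat) : 0 + m0 = m1 -> v + u0 = u1 ->
    x + (s1 + m1) = n -> x + (s0 + m0) + v + u0 + s1 = n + u1 + s0 by lia.
  exact: arith.
rewrite -[X in X + _ + _](_ : count (fun x => c1 <= x < c0) (map val (unzip1 a)) +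
    count (fun x => (x < c1) || (c0 <= x)) (map val u') = _); last first.
  rewrite -(card_entry i0 sz (erefl (size u'))); apply: eq_card => i.
  rewrite !inE /Gset /Bset (leqNgt c0 c1) lc /=.
  by rewrite andb_orr -!orbA.
have -> : count (fun x => (x < c1) || (c0 <= x)) (map val u') =
    cnt (map val u') c1 + count (fun x => c0 <= x) (map val u').
  rewrite /cnt -count_predUI [X in _ + X](eq_count (a2 := pred0)) ?count_pred0 ?addn0 //.
  by move=> x /=; apply/negP => /andP [lx lx'];
    have := leq_trans lc (leq_trans lx' (ltnW lx)); rewrite ltnn.
have := count_geq (map val u') c0; have := count_interval (map val (unzip1 a)) (ltnW lc).
have m1 : cnt (map val (unzip1 m)) c1 = 0.
  by apply: cm => y /hm /andP [le _]; rewrite -leqNgt.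
have m0 : cnt (map val (unzip1 m)) c0 = size m.
  have := count_geq (map val (unzip1 m)) c0; rewrite szv cm // => y /hm /andP [_].
  by rewrite -ltnNge.
rewrite size_map !ca m0 m1 sa -ss.
have arith (v s0 s1 u0 u1 x k n : nat) : v + (s1 + 0) = s0 + k -> x + u0 = n ->
  v + (u1 + x) + u0 + s1 = n + k + u1 + s0 by lia.
exact: arith.
Qed.

(** All that is needed about the rows, or the columns, of a largest symbol a.
    The indices u' can be placed above a with weight T. A list of letters above
    D whose indices form the second minor weighs at least T + size a - GB, plus
    one for each bad swap, where GB is the number of free and bad indices. If u'
    is as long as a, then c0 = 0, no index is bad, and it is the weight of a
    that is compared with T. *)
Lemma side_data D a u' : greedy D a -> above D a -> uniq (unzip1 a) -> uniq u' ->
  size u' <= size a -> exists c0 c1 T,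
  let G := Gset (size a) i0 (unzip1 a) u' c0 c1 in
  let B := Bset (size a) i0 (unzip1 a) u' c0 c1 in
  let w := entry i0 (unzip1 a) u' in
  let GB := #|[pred i : 'I_(size a + size u') | G i || B i]| in
  [/\ exists a2, [/\ perm_eq (unzip1 a2) u', above (letters a) a2 & wt a2 <= T],
      size u' < size a -> forall e : {ffun 'I_(size a + size u') -> bool},
        admissible G B e -> size (part e true) = size u' ->
        forall a1, perm_eq (unzip1 a1) (map w (part e true)) -> above D a1 ->
        T + size a + swaps B e <= wt a1 + GB &
      size u' = size a -> T + size a = wt a + GB /\
         forall e : {ffun 'I_(size a + size u') -> bool}, swaps B e = 0].
Proof.
move=> gr ab ua uu'; rewrite leq_eqVlt => /orP [/eqP es|lt].
  have [c1 [lo [e1 e2 _]]] := max_gap (etrans es (esym (size_map fst a))).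
  exists 0, c1, (wt a + lo) => G B w GB; split.
  - have [|a2 [p2 ab2 w2]] := @arrange P (letters a) u' lo.
      by move=> c; rewrite es -[a in letters a]cats0 thr_letters.
    exists a2; split=> //; rewrite (leq_trans w2) // es -[X in letters X]cats0 base_letters.
    by rewrite leqnn.
  - by rewrite es ltnn.
  move=> _; split.
    have no (y : 'I_P * nat) : y \in [::] -> ~~ (0 <= y.1 < c1) by [].
    have := card_GB (esym es) (or_introl (conj (leq0n c1) no)).
    rewrite cats0 -/G -/B -/GB !cnt_zero e1.
    have arith (x s1 n w0 : nat) : x + 0 + s1 = n + (s1 + lo) + 0 ->
      w0 + lo + n = w0 + x by lia.
    exact: arith.
  by move=> e; apply: eq_card0 => i; rewrite !inE /B /Bset /= ltn0 andbF.
pose s := take (size u') a; pose m := drop (size u') a.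
have ea : a = s ++ m by rewrite cat_take_drop.
have ss : size s = size u' by rewrite size_take lt.
have m0 : m != [::] by rewrite -size_eq0 size_drop subn_eq0 -ltnNge.
rewrite ea in gr ab ua.
have [c0 [c1 [lo [v0 v1 v2 hc]]]] := row_thresholds gr ab m0 (esym ss).
exists c0, c1, (wt s + lo) => G B w GB; split.
- have [|a2 [p2 ab2 w2]] := @arrange P (letters a) u' lo.
    by move=> c; rewrite -ss ea thr_letters.
  by exists a2; split=> //; rewrite (leq_trans w2) // -ss ea base_letters.
- move=> _ e ad sz a1 p1 ab1.
  have s1 : size a1 = size u' by have := perm_size p1; rewrite size_map (size_map w) sz.
  have f1 := above_duality c0 ab1; rewrite s1 in f1.
  have e1 : cnt (map val (unzip1 a1)) c0 = cnt (map val (map w (part e true))) c0.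
    by rewrite /cnt (seq.permP (perm_map val p1)).
  have f2 := heavy_count (size_map fst a) (erefl (size u')) ad sz.
  have f3 := card_GB ss hc; rewrite -ea in f3; rewrite -/G -/B -/GB in f3.
  have f4 := base_le ab; rewrite ss in f4 v0.
  have arith (bs A wa ec u0 sw gb s1' n u1 s0 ws : nat) :
    bs + A <= wa + ec -> u0 + sw <= A -> gb + u0 + s1' = n + u1 + s0 ->
    s0 = ec + (ws - bs) -> u1 = s1' + lo -> bs <= ws ->
    ws + lo + n + sw <= wa + gb by lia.
  rewrite -e1 in f2; exact: (arith _ _ _ _ _ _ _ _ _ _ _ _ f1 f2 f3 v0 v1 f4).
by move=> es; rewrite es ltnn in lt.
Qed.
End SideData.

(** * The straightening law *)

Section JIdeal.
Variables (p q : nat) (L : Jsym p q -> Prop).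

(** Modulo this ideal, straightening means vanishing. *)
Definition Jideal : {pred arc_ring p q} := fun f =>
  `[< ideal_gen (fun g => exists2 J : Jsym p q, L J & g = Jval J) f >].

Lemma Jideal_idealr_closed : idealr_closed Jideal.
Proof.
split.
- by apply/asboolP; exists [::]; rewrite big_nil.
- apply/asboolP => -[s [hs e]].
  suff : (1 : arc_ring p q)@_(mone : {cmonom _}) = 0 by rewrite mcoeff1 eqxx.
  rewrite e raddf_sum big1_seq //= => a /hs [J _ ->].
  by rewrite mcoeff1M mcoeff1_Jval mulr0.
- by move=> a x y /asboolP hx /asboolP hy; apply/asboolP; apply: ideal_genMD.
Qed.

HB.instance Definition _ := isIdealr.Build (arc_ring p q) Jideal
  Jideal_idealr_closed.

Lemma Jideal_J J : L J -> Jval J \in Jideal.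
Proof.
move=> LJ; apply/asboolP; exists [:: (1, Jval J)]; split.
  by move=> a; rewrite inE => /eqP -> /=; exists J.
by rewrite big_seq1 mul1r.
Qed.

Notation Q := {ideal_quot Jideal}.
Lemma pi_Jideal f : (\pi_Q f == 0) = (f \in Jideal).
Proof. by rewrite -(rmorph0 \pi_Q) -Quotient.idealrBE subr0. Qed.
End JIdeal.

Section Vanish.
Variables (p q : nat) (i0 : 'I_p) (j0 : 'I_q) (K : nat).
Variables (Q : comNzRingType) (f : {rmorphism arc_ring p q -> Q}).
Variable L : Jsym p q -> Prop.
Hypothesis fL : forall j, L j -> f (Jval j) = 0.
Notation mR := (minor_coef i0 j0 K).

Lemma minor_coef_vanish r c k : (k < K)%N -> size r = size c -> (0 < size r)%N ->
  (forall j, Jwt j = k -> perm_eq (Jrow j) r -> perm_eq (Jcol j) c -> L j) ->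
  f (mR r c k) = 0.
Proof.
move=> lk es s0 hL; case: (boolP (uniq r && uniq c)) => [/andP [ur uc]|nu]; last first.
  by rewrite minor_coef_nuniq ?rmorph0 // -negb_and.
have [j [ew pr pc]] := J_make k es s0 ur uc.
have [|b] := minor_coef_Jval i0 j0 (K := K) _ pr pc; first by rewrite ew.
by rewrite ew => ->; rewrite rmorphM fL ?mulr0 //; apply: hL.
Qed.

Definition Xf (w : nat -> 'I_p) (w' : nat -> 'I_q) i j l : Q := f (xvar (w i) (w' j) l).

Lemma subdet_minor_coef w w' r c k : size r = size c ->
  subdet K (Xf w w') r c k = f (mR (map w r) (map w' c) k).
Proof.
move=> es; rewrite /subdet /minor_coef size_map -coef_map -(natdet_map (map_poly f)).
congr (nth 0 (polyseq _) k); apply: eq_natdet => a b la lb.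
rewrite (nth_map 0%N) // (nth_map 0%N) -?es //.
apply/polyP => l; rewrite coef_map coef_xseries coef_poly /Xf.
by case: (l < K)%N; rewrite /= ?rmorph0.
Qed.
End Vanish.

Lemma mul_signs_eq0 (S : comNzRingType) (x y x' y' : S) (s t : bool) :
  x' = (-1) ^+ s * x -> y' = (-1) ^+ t * y -> x' * y' = 0 -> x * y = 0.
Proof.
move=> -> ->; rewrite mulrACA -signr_addb => e0.
by apply: (can_inj (signrMK (s (+) t))); rewrite e0 mulr0.
Qed.

Section Budget.
Local Open Scope nat_scope.

Lemma budget_fit (T1 T2 m wa wb : nat) : T1 + T2 <= m -> wa <= T1 -> wb <= T2 ->
  wa + (m - (wa + wb)) + wb = m.
Proof. by lia. Qed.

Lemma budget_top (T1 T2 g1 g2 wa wb n k h m : nat) : m < T1 + T2 -> T1 + h = wa + g1 ->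
  T2 + h = wb + g2 -> n = wa + wb -> k + g1 + g2 <= m + 0 + 0 + 2 * h -> k < n.
Proof. by lia. Qed.

Lemma budget_low (T1 T2 g1 g2 wa wb k h m x y : nat) : m < T1 + T2 ->
  T1 + h + x <= wa + g1 -> T2 + h + y <= wb + g2 -> k = wa + wb ->
  k + g1 + g2 <= m + x + y + 2 * h -> False.
Proof. by lia. Qed.
End Budget.

Section Straighten.
Variables (p q : nat).
Notation E := (Esym p q).
Notation J := (Jsym p q).
Implicit Types (F G : E) (j : J) (o : option E).

(** If a symbol j below F can be placed after o at all, its best representative
    there precedes F. *)
Definition below o F j := forall G, Enorm G = j -> Ble o G -> Eprec G F.

Lemma Eprec_size F G : (Esz F < Esz G)%N -> Eprec G F.
Proof. by move=> lt; rewrite /Eprec -!/(Esz _) lt. Qed.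

Lemma Eprec_wt F G : Esz F = Esz G -> (Ewt G < Ewt F)%N -> Eprec G F.
Proof. by move=> e lt; rewrite /Eprec -!/(Esz _) e ltnn eqxx lt. Qed.

Lemma Enorm_Jsz F j : Enorm F = j -> Esz F = Jsz j.
Proof.
move=> e; have [_ /perm_size s1 _] := (EnormP F j).1 e.
by move: s1; rewrite size_urow size_Jrow.
Qed.

Lemma Ele_letters F G : (Esz G <= Esz F)%N -> above (letters (Erow F)) (Erow G) ->
  above (letters (Ecol F)) (Ecol G) -> Ele F G.
Proof. by move=> h1 h2 h3; rewrite -[Ele F G]/(Ble (Some F) G) BleE /= h1 h2 h3. Qed.

(** The exchange of the minors of F and j, with the free and bad indices of
    side_data for rows and for columns. A minor larger than F, or as large and
    lighter, is below F. As j cannot be placed above F, its weight is less than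
    T + T', the weight that its rows and columns would need; a second minor to
    which heavy0 applies is then too light to have a representative above o or,
    if it is as large as F, lighter than F. And by good_replace a representative
    of a first minor to which good0 applies would have a smaller word than F. *)
Lemma straighten (Q : comNzRingType) (f : {rmorphism arc_ring p q -> Q}) o F j :
  best o F -> (forall G, Enorm G = j -> ~~ Ele F G) ->
  (forall j', below o F j' -> f (Jval j') = 0) ->
  f (Jval (Enorm F)) * f (Jval j) = 0.
Proof.
move=> bF nj fL.
case: (ltnP (Esz F) (Jsz j)) => [lt|le].
  have z : f (Jval j) = 0.
    by apply: fL => G /Enorm_Jsz eG _; apply: Eprec_size; rewrite eG.
  exact: (etrans (congr1 (fun x => f (Jval (Enorm F)) * x) z) (mulr0 _)).
have i0 : 'I_p by case: (Jrow j) (size_Jrow j) (Jsz_gt0 j) => [<-|].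
have j0 : 'I_q by case: (Jcol j) (size_Jcol j) (Jsz_gt0 j) => [<-|].
have [/esym ewF prF pcF] := (EnormP F _).1 (erefl (Enorm F)).
have abF : Ble o F by case: bF => -[].
move: (abF); rewrite BleE => /and3P [szo aro aco].
pose a := Erow F; pose b := Ecol F; pose h := Esz F; pose h' := Jsz j.
have sd := side_data i0 (best_greedy_row bF) aro (uniq_Erow F) (uniq_Jrow j).
have sd' := side_data j0 (best_greedy_col bF) aco (uniq_Ecol F) (uniq_Jcol j).
rewrite size_Erow size_Jrow in sd; rewrite size_Ecol size_Jcol in sd'.
have [c0 [c1 [T [[a2 [pa2 aa2 wa2]] B1 C1]]]] := sd le.
have [c0' [c1' [T' [[b2 [pb2 ab2 wb2]] B2 C2]]]] := sd' le.
rewrite -/h -/h' in le B1 C1 B2 C2.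
set Gr := Gset _ _ _ _ _ _ in B1 C1; set Br := Bset _ _ _ _ _ _ in B1 C1.
set Gc := Gset _ _ _ _ _ _ in B2 C2; set Bc := Bset _ _ _ _ _ _ in B2 C2.
set w := entry _ _ _ in B1; set w' := entry _ _ _ in B2.
have h0 : (0 < h)%N := Esz_gt0 F. have h0' : (0 < h')%N := Jsz_gt0 j.
have sa : size (unzip1 a) = h := size_urow F.
have sb : size (unzip1 b) = h := size_ucol F.
(* otherwise a2 and b2, with the weight left over put on top, would form a
   representative of j above F *)
have light : (Jwt j < T + T')%N.
  rewrite ltnNge; apply/negP => hw.
  have sa2 : size a2 = h' by have := perm_size pa2; rewrite size_map size_Jrow.
  have sb2 : size b2 = h' by have := perm_size pb2; rewrite size_map size_Jcol.
  have [|a3 [u3 w3 ab3 _ _]] := @raise_top p a2 (Jwt j - (wt a2 + wt b2));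
    first by rewrite sa2.
  have sa3 : size a3 = h' by have := congr1 size u3; rewrite !size_map sa2.
  have [||||G er ec] := @E_make p q a3 b2; rewrite ?sa3 ?sb2 //.
  - by rewrite u3 (perm_uniq pa2) uniq_Jrow.
  - by rewrite (perm_uniq pb2) uniq_Jcol.
  have : Ele F G.
    by apply: Ele_letters; rewrite ?er ?ec //; [rewrite -size_Erow er sa3|apply: ab3].
  apply/negP; apply: nj; apply/EnormP; rewrite Ewt_sides er ec u3 w3; split=> //.
  exact: budget_fit hw wa2 wb2.
pose n := Ewt F; pose n' := Jwt j; pose K := (n + n').+1.
have van := @minor_coef_vanish p q i0 j0 K Q f (below o F) fL.
have := @exchange Q h h' n n' K (Xf f w w') (ltnSn _) le.
have mnE r c k : size r = size c -> subdet K (Xf f w w') r c k =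
  f (minor_coef i0 j0 K (map w r) (map w' c) k).
  exact: subdet_minor_coef.
move=> /(_ _ _ Gr Br Gc Bc (@GBset _ _ _ _ _ _ _) (@GBset _ _ _ _ _ _ _)) ex.
have {ex} : subdet K (Xf f w w') (iota 0 h) (iota 0 h) n *
     subdet K (Xf f w w') (iota h h') (iota h h') n' = 0.
  apply: ex.
  - move=> r c k _ _ es lt lk; rewrite mnE // van ?size_map //;
    first by apply: leq_trans lt.
    move=> j' ew pr _ G /Enorm_Jsz eG _; apply: Eprec_size.
    by rewrite eG -size_Jrow (perm_size pr) size_map.
  - move=> r c k _ _ es es' lk; rewrite mnE ?es ?es' // van ?size_map ?es ?es' //.
      by rewrite (leq_trans lk) // /K ltnW // ltnS leq_addr.
    move=> j' ew pr _ G eG _; apply: Eprec_wt.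
      by rewrite (Enorm_Jsz eG) -size_Jrow (perm_size pr) size_map es.
    by have [-> _ _] := (EnormP G j').1 eG; rewrite ew.
  - move=> e e' k lk ad ad' es es' hk.
    rewrite mnE ?es ?es' //; apply: van; rewrite ?(size_map w) ?(size_map w') ?es ?es' //.
    move=> j' ew pr pc G eG bG.
    have [ewG prG pcG] := (EnormP G j').1 eG.
    move: (bG); rewrite BleE => /and3P [_ arG acG].
    have szG : Esz G = h' by rewrite (Enorm_Jsz eG) -size_Jrow (perm_size pr) (size_map w)
      es.
    have [eh|lth] := eqVneq h' h.
      apply: Eprec_wt; first by rewrite szG eh.
      have [d1 s1] := C1 eh; have [d2 s2] := C2 eh.
      rewrite (s1 e) (s2 e') in hk; rewrite ewG ew.
      exact: budget_top light d1 d2 (Ewt_sides F) hk.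
    exfalso; have lt' : (h' < h)%N by rewrite ltn_neqAle lth.
    have d1 := B1 lt' e ad es _ (perm_trans prG pr) arG.
    have d2 := B2 lt' e' ad' es' _ (perm_trans pcG pc) acG.
    have en := Ewt_sides G; rewrite ewG ew in en.
    exact: budget_low light d1 d2 en hk.
  - move=> e e' ad ad' es es' s0 s0' ne.
    have sf : size (part e false) = h by have := size_part2 e; rewrite es => /addIn.
    have sf' : size (part e' false) = h by have := size_part2 e'; rewrite es' => /addIn.
    rewrite mnE ?sf ?sf' //; apply: van; rewrite ?(size_map w) ?(size_map w') ?sf ?sf' //.
      by rewrite /K ltnS leq_addr.
    move=> j' ew pr pc G eG bG.
    have [ewG prG pcG] := (EnormP G j').1 eG.
    have szG : Esz G = h by rewrite (Enorm_Jsz eG) -size_Jrow (perm_size pr) (size_map w)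
      sf.
    move: (bG); rewrite BleE => /and3P [_ arG acG].
    have [a3 [pa3 wa3 ab3 le3 lt3]] := good_replace sa ad es s0 (perm_trans prG pr).
    have [b3 [pb3 wb3 abb3 leb3 ltb3]] := good_replace sb ad' es' s0' (perm_trans pcG pc).
    have ewGF : Ewt G = Ewt F by rewrite ewG ew.
    have nl : ~~ (Eword F < rword a3 ++ rword b3)%O.
      apply: (best_no_larger bF) => //; [exact: ab3|exact: abb3|].
      by rewrite wa3 wb3 -Ewt_sides.
    rewrite Eprec_same //; rewrite -leNgt in nl; apply: lt_le_trans nl.
    rewrite Eword_sides.
    have szr : size (rword (Erow G)) = size (rword a3).
      have := perm_size pa3; rewrite size_map sa => sa3.
      by rewrite /rword !size_map !size_rev sa3 size_Erow.
    case: ne => ne; first by apply: ltxi_cat => //; apply: lt3.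
    by apply: lexi_cat => //; apply: ltb3.
have [/esym ewF' _ _] := (EnormP F _).1 (erefl (Enorm F)).
rewrite !mnE ?size_iota //.
have lk : (Jwt j < K)%N by rewrite /K ltnS leq_addl.
have lkF : (Jwt (Enorm F) < K)%N by rewrite ewF' /K ltnS leq_addr.
have eJ : exists s : bool, minor_coef i0 j0 K (map w (iota h h')) (map w' (iota h h')) n' =
  (-1) ^+ s * Jval j.
  have p1 : perm_eq (Jrow j) (map w (iota h h')) by rewrite entry_hi // size_Jrow.
  have p2 : perm_eq (Jcol j) (map w' (iota h h')) by rewrite entry_hi // size_Jcol.
  exact: minor_coef_Jval lk p1 p2.
have eF : exists s : bool, minor_coef i0 j0 K (map w (iota 0 h)) (map w' (iota 0 h)) n =
  (-1) ^+ s * Jval (Enorm F).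
  have p1 : perm_eq (Jrow (Enorm F)) (map w (iota 0 h)) by rewrite entry_lo // perm_sym.
  have p2 : perm_eq (Jcol (Enorm F)) (map w' (iota 0 h)) by rewrite entry_lo // perm_sym.
  by rewrite /n -ewF'; exact: minor_coef_Jval lkF p1 p2.
case: eJ => s1 ->; case: eF => s2 ->.
exact: (mul_signs_eq0 (rmorphMsign f s2 (Jval (Enorm F))) (rmorphMsign f s1 (Jval j))).
Qed.
End Straighten.

(** * Homogeneous components *)

Section Homog.
Variable I : choiceType.
Notation R := {malg int[{cmonom I}]}.
Implicit Types (f g : R) (m : {cmonom I}).

Definition homog d f := forall m, f@_m != 0 -> mdeg m = d.

Definition hpart d f : R := \sum_(m <- msupp f | mdeg m == d) << f@_m *g m >>.

Lemma mcoeff_hpart d f m : (hpart d f)@_m = if mdeg m == d then f@_m else 0.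
Proof.
rewrite /hpart raddf_sum big_mkcond /=.
under eq_bigr => k _.
  rewrite (_ : (if _ then _ else _) = if (k == m) && (mdeg m == d) then f@_m else 0);
    last first.
    by case: (eqVneq k m) => [->|ne]; case: eqP; rewrite ?mcoeffU ?eqxx ?mulr1n ?(negPf ne).
  over.
case: (mdeg m == d); last by rewrite big1 // => k _; rewrite andbF.
case: (boolP (m \in msupp f)) => mf.
  rewrite (big_fsetD1 m) //= eqxx big1_seq ?addr0 // => k /andP [_].
  by rewrite in_fsetD1 => /andP [/negPf ->].
rewrite big1_seq ?(mcoeff_outdom mf) // => k /andP [_ kf].
by case: eqP kf mf => //= -> ->.
Qed.

Lemma homog_hpart d f : homog d (hpart d f).
Proof. by move=> m; rewrite mcoeff_hpart; case: (mdeg m =P d) => [-> //|_];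
  rewrite eqxx. Qed.

Lemma hpart_homog d f : homog d f -> hpart d f = f.
Proof.
move=> hf; apply/malgP => m; rewrite mcoeff_hpart; case: eqP => // ne.
by apply/esym/eqP; apply: contra_notT ne => /hf.
Qed.

Lemma hpart_sum d (T : Type) (r : seq T) (F : T -> R) :
  hpart d (\sum_(x <- r) F x) = \sum_(x <- r) hpart d (F x).
Proof.
apply/malgP => m; rewrite mcoeff_hpart !raddf_sum /=.
under [RHS]eq_bigr => x _ do rewrite mcoeff_hpart.
by case: eqP => // _; rewrite big1.
Qed.

Lemma homogM d e f g : homog d f -> homog e g -> homog (d + e) (f * g).
Proof.
move=> hf hg m; apply: contraNeq => ne; rewrite mcoeffMl big1 // => m1 _.
rewrite big1 // => m2 _; case: eqP => [em|]; rewrite ?mulr0n // mulr1n.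
have [->|/hf e1] := eqVneq f@_m1 0; first by rewrite mul0r.
have [->|/hg e2] := eqVneq g@_m2 0; first by rewrite mulr0.
by move: ne; rewrite -em mdegM e1 e2 eqxx.
Qed.

Lemma homogD d f g : homog d f -> homog d g -> homog d (f + g).
Proof.
move=> hf hg m; rewrite mcoeffD; have [->|/hf //] := eqVneq f@_m 0.
by rewrite add0r => /hg.
Qed.

Lemma homogN d f : homog d f -> homog d (- f).
Proof. by move=> hf m; rewrite mcoeffN oppr_eq0 => /hf. Qed.

Lemma homog0 d : homog d 0.
Proof. by move=> m; rewrite mcoeff0 eqxx. Qed.

Lemma homog1 : homog 0 1.
Proof. by move=> m; rewrite mcoeff1; case: (m =P mone) => [->|_];
  rewrite ?eqxx // mdeg1. Qed.

Lemma homogU m : homog (mdeg m) << m >>.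
Proof. by move=> k; rewrite mcoeffU1; case: (m =P k) => [->|_]; rewrite ?eqxx. Qed.

Lemma hpartM D a f g : homog a f ->
  hpart D (f * g) = if (a <= D)%N then f * hpart (D - a)%N g else 0.
Proof.
move=> hf; apply/malgP => m; rewrite mcoeff_hpart.
have le : (msupp (hpart (D - a)%N g) `<=` msupp g)%fset.
  apply/fsubsetP => k; rewrite -!mcoeff_neq0 mcoeff_hpart.
  by case: (mdeg k == _); rewrite ?eqxx.
have key : mdeg m = D -> (a <= D)%N -> (f * g)@_m = (f * hpart (D - a)%N g)@_m.
  move=> em la; apply: etrans (mcoeffMlw m (fsubset_refl (msupp f)) (fsubset_refl (msupp
    g))) _.
  apply: etrans _ (esym (mcoeffMlw m (fsubset_refl (msupp f)) le)).
  apply: eq_bigr => m1 _; apply: eq_bigr => m2 _; rewrite mcoeff_hpart.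
  case: (mmul m1 m2 =P m) => [e12|]; rewrite ?mulr0n // !mulr1n.
  have [->|/hf e1] := eqVneq f@_m1 0; first by rewrite !mul0r.
  case: eqP => // ne; case: ne; move: em; rewrite -e12 mdegM e1 => <-.
  by rewrite addKn.
have zero : mdeg m = D -> (D < a)%N -> (f * g)@_m = 0.
  move=> em la; rewrite mcoeffMl; apply: big1 => m1 _; apply: big1 => m2 _.
  case: (mmul m1 m2 =P m) => [e12|_]; last exact: mulr0n.
  apply: etrans (mulr1n _) _.
  have [->|/hf e1] := eqVneq f@_m1 0; first by rewrite mul0r.
  by move: la; rewrite -em -e12 mdegM e1 ltnNge leq_addr.
case: (leqP a D) => la; case: (mdeg m =P D) => em.
- exact: key.
- apply/esym/eqP; apply: contra_notT em => ne.
  by rewrite (homogM hf (@homog_hpart (D - a)%N g) ne) subnKC.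
- by apply: etrans (zero em la) _; rewrite mcoeff0.
by rewrite mcoeff0.
Qed.

End Homog.

Section HomogMinors.
Variables (p q : nat) (i0 : 'I_p) (j0 : 'I_q).
Notation R := (arc_ring p q).

Definition homog_coefs d (P : {poly R}) := forall k, homog d P`_k.

Lemma homog_coefsM d e P Q : homog_coefs d P -> homog_coefs e Q ->
  homog_coefs (d + e) (P * Q).
Proof.
move=> hP hQ k; rewrite coefM; apply: big_ind => [|x y|i _].
- exact: homog0.
- exact: homogD.
- exact: homogM.
Qed.

Lemma homog_coefs_det n (M : 'M[{poly R}]_n) : (forall i j, homog_coefs 1 (M i j)) ->
  homog_coefs n (\det M).
Proof.
move=> hM k; rewrite /determinant coef_sum; apply: big_ind => [|x y|s _].
- exact: homog0.
- exact: homogD.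
have hp r : homog_coefs (size r) (\prod_(i <- r) M i (s i)).
  elim: r => [|i r IH]; last by rewrite big_cons; apply: (@homog_coefsM 1).
  by move=> l; rewrite big_nil coef1; case: eqP => _; [exact: homog1|exact: homog0].
have := hp (index_enum 'I_n) k.
rewrite (_ : size _ = n); last by rewrite -[RHS]card_ord cardE enumT.
by rewrite coef_sign; case: (odd_perm s); rewrite ?expr1 ?expr0 ?mulN1r ?mul1r //;
  apply: homogN.
Qed.

Lemma homog_minor_coef K r c k : homog (size r) (minor_coef i0 j0 K r c k).
Proof.
apply: homog_coefs_det => i j l; rewrite mxE coef_xseries; case: ifP => _;
  last exact: homog0.
have := @homogU _ (ucm ((nth i0 r i, nth j0 c j, l) : arc_idx p q)).
by rewrite mdegU.
Qed.

Lemma homog_Jval (J : Jsym p q) : homog (Jsz J) (Jval J).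
Proof.
rewrite /Jval (nderiv_minor i0 j0 _ (ltnSn (Jwt J))) -size_Jrow.
exact: homog_minor_coef.
Qed.

Lemma Jval_var (z : arc_idx p q) : exists2 J : Jsym p q, Jsz J = 1%N & Jval J = << ucm z >>.
Proof.
case: z => -[i j] k; exists (Sub (k, [:: (i, j)]) isT : Jsym p q) => //.
rewrite /Jval (nderiv_minor i0 j0 _ (ltnSn k)) /minor_coef /natdet.
rewrite det_mx11 mxE.
exact: coef_xseries_lt.
Qed.
End HomogMinors.

(** * Well-foundedness of the order on symbols *)

Section Rank.
Local Open Scope nat_scope.
Variable A : nat.
Implicit Types s t : seqlexi (nat *l nat).

(** Words of bounded weight are numbered by reading them as numbers in base M,
    compatibly with the lexicographic order. *)
Definition code (x : nat *l nat) := x.1 * A + x.2.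
Fixpoint wnum M (s : seq (nat *l nat)) : nat :=
  if s is x :: s' then code x * M ^ size s' + wnum M s' else 0.

Lemma wnum_lt M s : all (fun x => code x < M) s -> wnum M s < M ^ size s.
Proof.
elim: s => //= x s IH /andP [lx /IH lt]; rewrite expnS.
by apply: leq_trans (_ : (code x).+1 * M ^ size s <= _);
  rewrite ?leq_mul2r ?lx ?orbT // mulSn addnC ltn_add2r.
Qed.

Lemma wnum_mono M s t : size s = size t -> all (fun x => code x < M) s ->
  all (fun x => x.2 < A) s -> all (fun x => x.2 < A) t -> (s < t)%O -> wnum M s < wnum M t.
Proof.
elim: s t => [|x s IH] [|y t] //= [es] /andP [lx ls] /andP [ax as_] /andP [ay at_].
rewrite ltxi_cons => /andP [le /implyP lt].
have [eyx|nyx] := boolP (y <= x)%O.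
  have -> : x = y by apply/eqP; rewrite eq_le le eyx.
  by rewrite es ltn_add2l; apply: IH => //; apply: lt.
have {le} : code x < code y.
  move: nyx; rewrite -ltNge lt_letterE /code => /orP [l1|/andP [/eqP <- l2]];
    last by rewrite ltn_add2l.
  apply: leq_trans (_ : x.1.+1 * A <= _); first by rewrite mulSn addnC ltn_add2r.
  by apply: leq_trans (leq_addr _ _); rewrite leq_mul2r l1 orbT.
move=> lxy; apply: leq_trans (_ : (code x).+1 * M ^ size t <= _).
  by rewrite -es mulSn addnC ltn_add2r wnum_lt.
by apply: leq_trans (leq_addr _ _); rewrite leq_mul2r lxy orbT.
Qed.
End Rank.

Section Prec.
Local Open Scope nat_scope.
Variables (p q : nat).
Notation E := (Esym p q).
Notation J := (Jsym p q).
Implicit Types (F G : E) (j : J) (o : option E).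

Let A := p + q.
Let M w := w.+1 * A.

Lemma letter_ok n (a : seq ('I_n * nat)) w : n <= A -> wt a <= w ->
  all (fun x => code A x < M w) [seq letter x | x <- a] &&
  all (fun x : nat *l nat => x.2 < A) [seq letter x | x <- a].
Proof.
move=> nA; elim: a => //= x a IH; rewrite /wt /= => le.
have lx : x.1 < A by apply: leq_trans nA.
have /andP [-> ->] : all (fun x => code A x < M w) [seq letter x | x <- a] &&
  all (fun x : nat *l nat => x.2 < A) [seq letter x | x <- a].
  by apply: IH; rewrite (leq_trans _ le) // leq_addl.
rewrite lx !andbT /code /M mulSn addnC /=.
apply: leq_trans (_ : A + x.2 * A <= _); first by rewrite ltn_add2r.
by rewrite leq_add2l leq_mul2r (leq_trans _ le) ?orbT // leq_addr.
Qed.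

Lemma word_ok F : all (fun x => code A x < M (Ewt F)) (Eword F) &&
  all (fun x : nat *l nat => x.2 < A) (Eword F).
Proof.
rewrite Eword_sides !all_cat /rword !map_rev !all_rev.
have /andP [-> ->] : all (fun x => code A x < M (Ewt F)) [seq letter x | x <- Erow F] &&
  all (fun x : nat *l nat => x.2 < A) [seq letter x | x <- Erow F].
  by apply: letter_ok; rewrite ?Ewt_sides ?leq_addr.
have /andP [-> ->] : all (fun x => code A x < M (Ewt F)) [seq letter x | x <- Ecol F] &&
  all (fun x : nat *l nat => x.2 < A) [seq letter x | x <- Ecol F].
  by apply: letter_ok; rewrite ?Ewt_sides ?leq_addl.
by [].
Qed.

Lemma size_Eword F : size (Eword F) = Esz F + Esz F.
Proof. by rewrite Eword_sides size_cat !size_map !size_rev size_Erow size_Ecol. Qed.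

Definition erank F := wnum A (M (Ewt F)) (Eword F).

Lemma erank_lt F G : Esz F = Esz G -> Ewt F = Ewt G -> (Eword F < Eword G)%O ->
  erank F < erank G.
Proof.
move=> es ew lt; rewrite /erank -ew; have /andP [k1 k2] := word_ok F.
have /andP [_ k3] := word_ok G.
by apply: wnum_mono => //; rewrite !size_Eword es.
Qed.

Lemma erank_bound F : erank F < (M (Ewt F)) ^ (Esz F + Esz F).
Proof. by rewrite -size_Eword; apply: wnum_lt; have /andP [] := word_ok F. Qed.

Lemma letter_inj n : injective (@letter n).
Proof. by move=> [x k] [y l] [-> e]; congr (_, _); apply: val_inj. Qed.

Lemma Eword_inj F G : Esz F = Esz G -> Eword F = Eword G -> F = G.
Proof.
move=> es; rewrite !Eword_sides => /eqP.
rewrite eqseq_cat; last by rewrite !size_map !size_rev !size_Erow.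
rewrite /rword !map_rev => /andP [/eqP er /eqP ec].
by apply: E_ext; apply: (inj_map (@letter_inj _)); apply: (can_inj revK).
Qed.

(** Sizes are at most p, and there are finitely many words of given size and
    weight. *)
Lemma Eprec_ind (Pr : E -> Prop) :
  (forall F, (forall G, Eprec G F -> Pr G) -> Pr F) -> forall F, Pr F.
Proof.
move=> step.
suff all_ a b c F : p - Esz F <= a -> Ewt F <= b -> erank F <= c -> Pr F.
  by move=> F; apply: (all_ (p - Esz F) (Ewt F) (erank F)).
elim/ltn_ind: a b c F => a IHa; elim/ltn_ind => b IHb; elim/ltn_ind => c IHc F la lb lc.
apply: step => G; rewrite /Eprec -!/(Esz _).
case/orP => [lt|/andP [/eqP es /orP [lw|/andP [/eqP ew lt]]]].
- have lG := Esz_le G.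
  by apply: (IHa (p - Esz G) _ (Ewt G) (erank G)) => //; lia.
- by apply: (IHb (Ewt G) _ (erank G)) => //; [lia|rewrite es].
apply: (IHc (erank G)) => //; last 2 first.
- by rewrite es.
- by rewrite ew.
by apply: leq_trans lc; apply: erank_lt.
Qed.

Lemma best_ex o j : (exists G, Enorm G = j /\ Ble o G) ->
  exists F, best o F /\ Enorm F = j.
Proof.
move=> [G0 [e0 b0]].
pose Pn n := `[< exists G, [/\ Enorm G = j, Ble o G & erank G = n] >].
have ex : exists n, Pn n by exists (erank G0); apply/asboolP; exists G0.
have bd n : Pn n -> n <= (M (Ewt G0)) ^ (Esz G0 + Esz G0).
  move=> /asboolP [G [eG bG <-]]; apply: ltnW.
  have eGG : Enorm G = Enorm G0 by rewrite eG e0.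
  by rewrite -(Enorm_wt eGG) -(Enorm_sz eGG) erank_bound.
case: (ex_maxnP ex bd) => n /asboolP [F [eF bF rF]] mx.
exists F; split=> //; split=> // G [eG bG].
have [eq|ne] := eqVneq (Eword G) (Eword F).
  by left; apply: Eword_inj eq; apply: Enorm_sz.
right; rewrite Eprec_same ?(Enorm_sz eG) ?(Enorm_wt eG) //.
rewrite lt_neqAle ne leNgt; apply/negP => lt.
have := @erank_lt F G (esym (Enorm_sz eG)) (esym (Enorm_wt eG)) lt.
rewrite rF ltnNge; apply/negP; rewrite negbK; apply: mx.
by apply/asboolP; exists G; split=> //; rewrite eG.
Qed.

Lemma Enorm_ex j : exists G, Enorm G = j.
Proof.
pose a := [seq (x, 0) | x <- Jrow j]; pose b := [seq (x, 0) | x <- Jcol j].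
have ua : unzip1 a = Jrow j by rewrite /unzip1 -map_comp map_id.
have ub : unzip1 b = Jcol j by rewrite /unzip1 -map_comp map_id.
have za n (s : seq 'I_n) : wt [seq (x, 0) | x <- s] = 0 by rewrite /wt; elim: s.
have sa : size a = Jsz j by rewrite size_map size_Jrow.
have sb : size b = Jsz j by rewrite size_map size_Jcol.
have [|a2 [u2 w2 _ _ _]] := @raise_top p a (Jwt j); first by rewrite sa Jsz_gt0.
have sa2 : size a2 = Jsz j by have := congr1 size u2; rewrite size_map ua size_Jrow.
have [||||G er ec] := @E_make p q a2 b; rewrite ?sa2 ?sb ?Jsz_gt0 //.
- by rewrite u2 ua uniq_Jrow.
- by rewrite ub uniq_Jcol.
exists G; apply/EnormP; rewrite Ewt_sides er ec u2 ua ub w2 !za.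
by rewrite addn0.
Qed.
End Prec.

(** * Standard monomials span *)

Section StraightenIdeal.
Variables (p q : nat).
Implicit Types (F G : Esym p q) (j : Jsym p q).

Lemma straighten_ideal o F j :
  best o F -> (forall G, Enorm G = j -> ~~ Ele F G) ->
  exists s : seq (arc_ring p q * Jsym p q), (forall a, a \in s -> below o F a.2) /\
    Jval (Enorm F) * Jval j = \sum_(a <- s) a.1 * Jval a.2.
Proof.
move=> bF nj; set L := below o F.
have kill j' : L j' -> \pi_({ideal_quot (Jideal L)}) (Jval j') = 0.
  by move=> Lj; apply/eqP; rewrite pi_Jideal Jideal_J.
pose ph : {rmorphism arc_ring p q -> {ideal_quot (Jideal L)}} :=
  \pi_({ideal_quot (Jideal L)}).
have z : ph (Jval (Enorm F)) * ph (Jval j) = 0 by exact: (straighten (f := ph) bF nj kill).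
have /asboolP [s [hs es]] : Jval (Enorm F) * Jval j \in Jideal L.
  by rewrite -pi_Jideal; apply/eqP; apply: etrans z; apply: rmorphM.
have {hs} [t et] : exists t : seq (arc_ring p q * Jsym p q),
    (forall a, a \in t -> L a.2) /\ \sum_(a <- s) a.1 * a.2 = \sum_(a <- t) a.1 * Jval a.2.
  elim: s hs {es} => [|a s IH] hs; first by exists [::]; split=> //; rewrite !big_nil.
  have [|t [ht et]] := IH; first by move=> b bs; apply: hs; rewrite in_cons bs orbT.
  have [j' Lj' ej] := hs a (mem_head _ _).
  exists ((a.1, j') :: t); split; last by rewrite !big_cons et ej.
  by move=> b; rewrite in_cons => /orP [/eqP ->|/ht].
by exists t; split; [case: et|rewrite es; case: et].
Qed.
End StraightenIdeal.

Lemma sum_mulA (S : comNzRingType) (T : Type) (s : seq (S * T)) (P : pred (S * T))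
    (v : T -> S) (g : S) :
  (\sum_(a <- s | P a) a.1 * v a.2) * g = \sum_(a <- s | P a) v a.2 * (a.1 * g).
Proof. by rewrite mulr_suml; apply: eq_bigr => a _; rewrite mulrA (mulrC a.1). Qed.

Lemma mulr_regroup (S : comNzRingType) (a b c d : S) : a * b * (c * d) = a * (b * c * d).
Proof. by rewrite !mulrA. Qed.

Section Span.
Variables (p q : nat) (i0 : 'I_p) (j0 : 'I_q).
Notation E := (Esym p q).
Notation J := (Jsym p q).
Notation R := (arc_ring p q).
Implicit Types (F G : E) (j : J) (t : seq E) (f g : R).

Definition Jmon (s : seq J) : R := \prod_(j <- s) Jval j.
Definition Emon t : R := \prod_(F <- t) Jval (Enorm F).
Definition Esize t := \sum_(F <- t) Esz F.

Definition standard_span f := exists s : seq (seq J * int),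
  (forall x, x \in s -> Jstandard x.1) /\ f = \sum_(x <- s) Jmon x.1 *~ x.2.

Lemma standard_span0 : standard_span 0.
Proof. by exists [::]; rewrite big_nil. Qed.

Lemma standard_spanD f g : standard_span f -> standard_span g -> standard_span (f + g).
Proof.
move=> [s [hs ->]] [t [ht ->]]; exists (s ++ t); rewrite big_cat; split=> // x.
by rewrite mem_cat => /orP [/hs|/ht].
Qed.

Lemma standard_spanMz f c : standard_span f -> standard_span (f *~ c).
Proof.
move=> [s [hs ->]]; exists [seq (x.1, x.2 * c) | x <- s]; split.
  by move=> _ /mapP [x /hs h ->].
have add0 : {morph (fun y : R => y *~ c) : x y / x + y} by move=> x y; apply: mulrzDl.
by rewrite big_map (big_morph _ add0 (mul0rz _ c)); apply: eq_bigr => x _; rewrite mulrzA.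
Qed.

Lemma standard_span_sum (T : eqType) (r : seq T) (F : T -> R) : (forall x, x \in r ->
  standard_span (F x)) ->
  standard_span (\sum_(x <- r) F x).
Proof.
elim: r => [|x r IH] h; first by rewrite big_nil; apply: standard_span0.
rewrite big_cons; apply: standard_spanD; first by apply: h; rewrite mem_head.
by apply: IH => y yr; apply: h; rewrite in_cons yr orbT.
Qed.

Lemma standard_span_standard t : Estandard t -> standard_span (Emon t).
Proof.
move=> st; exists [:: (map (@Enorm p q) t, 1)]; split.
  by move=> x; rewrite inE => /eqP -> /=; exists t.
by rewrite big_seq1 mulr1z /Jmon big_map.
Qed.

Definition olast t : option E := if t is F :: t' then Some (last F t') else None.

Lemma standard_rcons t F : Estandard (rcons t F) <-> Estandard t /\ best (olast t) F.
Proof.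
have hs F0 t' : standard_from F0 (rcons t' F) <->
    standard_from F0 t' /\ best (Some (last F0 t')) F.
  elim: t' F0 => [|G t' IH] F0 /=.
    by split=> [[h1 h2 _]|[_ h]]; [split|split=> //; case: (h) => -[]].
  by split=> [[h1 h2 /IH [h3 h4]]|[[h1 h2 h3] h4]]; [|split=> //; apply/IH].
case: t => [|G t] /=; last first.
  by split=> [[h1 /hs [h2 h3]]|[[h1 h2] h3]]; [|split=> //; apply/hs].
split=> [[[h1 h2] _]|[_ [[h1 _] h2]]].
  by split=> //; split=> // G [eG _]; apply: h2.
by split=> //; split=> // G eG; apply: h2.
Qed.

Lemma olast_rcons t F : olast (rcons t F) = Some F.
Proof. by case: t => //= G t; rewrite last_rcons. Qed.

Lemma Emon_rcons t F : Emon (rcons t F) = Emon t * Jval (Enorm F).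
Proof. by rewrite /Emon -cats1 big_cat big_seq1. Qed.

Lemma Esize_rcons t F : Esize (rcons t F) = (Esize t + Esz F)%N.
Proof. by rewrite /Esize -cats1 big_cat big_seq1. Qed.

Lemma Esize_ge t : (size t <= Esize t)%N.
Proof.
rewrite /Esize; elim: t => //= F t IH; rewrite big_cons.
by have := Esz_gt0 F; lia.
Qed.

Variable dlt : nat.

(** The total degree dlt in the variables is fixed, which bounds the length of
    the prefixes. *)
Definition reduces t := forall f d, homog d f -> (Esize t + d)%N = dlt ->
  standard_span (Emon t * f).

(** The induction hypothesis: cutting t at one of its factors and replacing this
    factor by a smaller one gives a prefix that is already settled. *)
Definition smaller_reduce t := forall t1 F t2 F', t = t1 ++ F :: t2 ->
  Estandard (rcons t1 F') -> Eprec F' F -> reduces (rcons t1 F').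

(** Straighten j with the last factor F of t. A resulting symbol that can be
    placed after the rest of t leads to a smaller prefix, and otherwise t has
    become shorter. After the empty prefix every symbol can be placed. *)
Lemma unplaceable_reduces t j g d : Estandard t -> smaller_reduce t ->
  (forall G, Enorm G = j -> ~~ Ble (olast t) G) -> homog d g ->
  (Esize t + Jsz j + d)%N = dlt -> standard_span (Emon t * (Jval j * g)).
Proof.
elim/last_ind: t j g d => [|t F IH] j g d st sm nj hg eD.
  by have [G eG] := Enorm_ex j; have := nj G eG.
have [st' bF] := (standard_rcons t F).1 st.
have sm' : smaller_reduce t.
  move=> t1 F1 t2 F1' et; apply: (sm t1 F1 (rcons t2 F)).
  by rewrite et rcons_cat rcons_cons.
have [|s [ls es]] := @straighten_ideal p q (olast t) F j bF.
  by move=> G /nj; rewrite olast_rcons.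
pose D := (Esz F + Jsz j + d)%N.
have hFj : homog D (Jval (Enorm F) * Jval j * g).
  apply: homogM hg; apply: homogM; last exact: homog_Jval.
  by rewrite (Enorm_Jsz (erefl (Enorm F))); apply: homog_Jval.
have eq1 : Jval (Enorm F) * Jval j * g = \sum_(a <- s) hpart D (Jval a.2 * (a.1 * g)).
  apply: etrans (esym (hpart_homog hFj)) _.
  apply: etrans (congr1 (fun x => hpart D (x * g)) es) _.
  apply: etrans (congr1 (hpart D) (sum_mulA s _ _ g)) _.
  exact: hpart_sum.
have eq2 : Emon (rcons t F) * (Jval j * g) =
    \sum_(a <- s) Emon t * hpart D (Jval a.2 * (a.1 * g)).
  apply: etrans (congr1 (fun x => x * _) (Emon_rcons t F)) _.
  apply: etrans (mulr_regroup _ _ _ _) _.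
  by apply: etrans (congr1 (fun x => _ * x) eq1) _; apply: mulr_sumr.
rewrite eq2; apply: standard_span_sum => a /ls la.
rewrite (hpartM D _ (@homog_Jval p q i0 j0 a.2)); case: leqP => [le|_]; last first.
  by rewrite mulr0; apply: standard_span0.
set g' := hpart _ _; have hg' : homog (D - Jsz a.2)%N g' by apply: homog_hpart.
have eD' : (Esize t + Jsz a.2 + (D - Jsz a.2))%N = dlt.
  by move: eD; rewrite Esize_rcons /D in le *; lia.
have [[G [eG bG]]|none] := pselect (exists G, Enorm G = a.2 /\ Ble (olast t) G).
  have [F' [bF' eF']] := best_ex (ex_intro _ G (conj eG bG)).
  have pF' : Eprec F' F by apply: la => //; case: bF' => -[].
  have stF' : Estandard (rcons t F') by apply/standard_rcons.
  have := sm t F [::] F' (esym (cats1 t F)) stF' pF' g' _ hg'.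
  rewrite Emon_rcons eF' -mulrA; apply.
  by rewrite Esize_rcons (Enorm_Jsz eF').
apply: IH hg' eD' => // G eG; apply/negP => bG.
by apply: none; exists G.
Qed.

(** By induction on the number of factors that may still follow, and then on the
    next factor along Eprec. Variables are symbols of size 1, so a monomial f
    always provides a next factor; if that cannot be placed it is straightened.
    *)
Lemma standard_reduces k t : (size t + k)%N = dlt.+1 -> Estandard t ->
  smaller_reduce t -> reduces t.
Proof.
elim: k t => [|k IH] t ek st sm f d hf eD.
  by have := Esize_ge t; move: ek eD; lia.
have step G : best (olast t) G -> reduces (rcons t G).
  elim/Eprec_ind: G => G IHG bG; apply: IH.
  - by rewrite size_rcons addSnnS.
  - exact/standard_rcons.
  move=> t1 F t2 F' et; case/lastP: t2 et => [|t2 G'].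
    rewrite cats1 => /rcons_inj [<- <-] /standard_rcons [_ bF'] pF'.
    exact: IHG.
  rewrite -rcons_cons -rcons_cat => /rcons_inj [et _].
  exact: sm et.
rewrite [f]malg_intE mulr_sumr; apply: standard_span_sum => m mf.
rewrite mulrzAr; apply: standard_spanMz.
have em : mdeg m = d by apply: hf; rewrite mcoeff_neq0.
case: d hf eD em => [|d] hf eD em.
  rewrite (mdeg_eq0I em) -[<< _ >>]/(1 : R) mulr1; exact: standard_span_standard.
have [z mz] : exists z, m z != 0%N.
  have [//|none] := pselect (exists z, m z != 0%N).
  have m1 : m = onecm _.
    by apply/eqP/cmP => z; rewrite onecmE; apply/eqP; apply: contra_notT none => h;
      exists z.
  by move: em; rewrite m1 mdeg1.
have em' : m = mulcm (ucm z) (divcm m (ucm z)).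
  apply/eqP/cmP => y; rewrite mulcmE divcmE ucmE subnKC //.
  by case: eqVneq => [<-|_] //; rewrite lt0n.
have [j sj ej] := Jval_var i0 j0 z.
have hg : homog d (<< divcm m (ucm z) >> : R).
  have := @homogU _ (divcm m (ucm z)).
  suff -> : mdeg (divcm m (ucm z)) = d by [].
  by have := congr1 mdeg em'; rewrite em mdegM mdegU => -[].
have emj : (<< m >> : R) = Jval j * << divcm m (ucm z) >>.
  apply: etrans (congr1 (fun k => << k >> : R) em') _.
  apply: etrans (malgUM _ _) _.
  exact: (congr1 (fun x : R => x * << divcm m (ucm z) >>) (esym ej)).
rewrite emj.
have [[G [eG bG]]|none] := pselect (exists G, Enorm G = j /\ Ble (olast t) G).
  have [F' [bF' eF']] := best_ex (ex_intro _ G (conj eG bG)).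
  have := step F' bF' _ _ hg; rewrite Emon_rcons eF' -mulrA; apply.
  by rewrite Esize_rcons (Enorm_Jsz eF') sj addn1 addSnnS.
apply: unplaceable_reduces hg _ => //.
- by move=> G eG; apply/negP => bG; apply: none; exists G.
- by rewrite sj addn1 addSnnS.
Qed.
End Span.

Lemma span_all p q (i0 : 'I_p) (j0 : 'I_q) (f : arc_ring p q) : standard_span f.
Proof.
rewrite [f]malg_intE; apply: standard_span_sum => m _; apply: standard_spanMz.
have := @standard_reduces p q i0 j0 (mdeg m) (mdeg m).+1 [::] (erefl _) I.
have sm : @smaller_reduce p q (mdeg m) [::] by case.
move=> /(_ sm << m >> (mdeg m) (@homogU _ m)); rewrite /Esize big_nil /Emon big_nil mul1r.
exact.
Qed.

(** * Determinants of products of matrices of series *)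

Section DetExpand.
Variable S : comNzRingType.

Lemma natdet_expand n (F : nat -> nat -> S) :
  natdet n.+1 F = \sum_(j < n.+1) F 0%N j * ((-1) ^+ j * natdet n (fun a b => F a.+1 (bump
    j b))).
Proof.
rewrite /natdet (expand_det_row _ ord0); apply: eq_bigr => j _.
rewrite mxE; congr (_ * _); rewrite /cofactor add0n; congr (_ * \det _).
by apply/matrixP => a b; rewrite !mxE.
Qed.

End DetExpand.

Section DetCoef.
Variable S : comNzRingType.

(** Expansion along the first row. *)
Lemma natdet_vanish_up (A B : Type) (F : A -> B -> {poly S}) K n :
  (forall w w' k, (k < K)%N -> (natdet n (fun a b => F (w a) (w' b)))`_k = 0) ->
  forall w w' k, (k < K)%N -> (natdet n.+1 (fun a b => F (w a) (w' b)))`_k = 0.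
Proof.
move=> h w w' k lk; rewrite natdet_expand coef_sum big1 // => j _.
rewrite mulrCA coefM big1 // => i _; rewrite coefM big1 ?mulr0 // => l _.
rewrite (h (fun a => w a.+1) (fun b => w' (bump j b))) ?mulr0 //.
have := ltn_ord i; lia.
Qed.

End DetCoef.
Section Gen.
Variable S : comNzRingType.

(** Congruence modulo 'X^K. *)
Definition eq_modX K (P Q : {poly S}) := forall k, (k < K)%N -> P`_k = Q`_k.

Lemma eq_modXM K P P' Q Q' : eq_modX K P P' -> eq_modX K Q Q' ->
  eq_modX K (P * Q) (P' * Q').
Proof.
move=> hP hQ k lk; rewrite !coefM; apply: eq_bigr => i _.
by rewrite hP ?hQ //; have := ltn_ord i; lia.
Qed.

Lemma eq_modX_det K n (M M' : 'M[{poly S}]_n) : (forall i j, eq_modX K (M i j) (M' i j)) ->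
  eq_modX K (\det M) (\det M').
Proof.
move=> h k lk; rewrite /determinant !coef_sum; apply: eq_bigr => s _.
rewrite !coef_sign; congr (_ * _); move: k lk.
apply: (big_ind2 (eq_modX K)) => [//|x x' y y'|i _]; first exact: eq_modXM.
exact: h.
Qed.

(** The Cauchy-Binet expansion, without sorting the columns f that are selected;
    if f is not injective, two rows of the second factor are equal. *)
Lemma det_sum_prod n h (A B : 'I_n -> 'I_h -> S) :
  \det (\matrix_(a < n, b < n) \sum_(l < h) A a l * B b l) =
  \sum_(f : {ffun 'I_n -> 'I_h} | injectiveb f) \sum_(s : 'S_n)
     (-1) ^+ s * \prod_a (A a (f a) * B (s a) (f a)).
Proof.
have e1 : \det (\matrix_(a < n, b < n) \sum_(l < h) A a l * B b l) =
  \sum_(f : {ffun 'I_n -> 'I_h}) (\prod_a A a (f a)) *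
     \det (\matrix_(a < n, b < n) B b (f a)).
  rewrite /determinant; under [RHS]eq_bigr => f _ do rewrite mulr_sumr.
  rewrite exchange_big /=; apply: eq_bigr => s _.
  under eq_bigr => a _ do rewrite mxE.
  rewrite (bigA_distr_bigA (fun a l => A a l * B (s a) l)) mulr_sumr.
  apply: eq_bigr => f _; rewrite big_split /= mulrCA; congr (_ * (_ * _)).
  by apply: eq_bigr => a _; rewrite mxE.
rewrite e1 [RHS]big_mkcond; apply: eq_bigr => f _; case: injectiveP => [_|ninj].
  rewrite /determinant mulr_sumr; apply: eq_bigr => s _; rewrite big_split /= mulrCA.
  by congr (_ * (_ * _)); apply: eq_bigr => a _; rewrite mxE.
suff -> : \det (\matrix_(a < n, b < n) B b (f a)) = 0 by rewrite mulr0.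
have /injectivePn [a [a' ne e]] : ~~ injectiveb f by apply/injectiveP.
by apply: (determinant_alternate ne) => b; rewrite !mxE e.
Qed.

End Gen.

Section Coefs.
Variable S : comNzRingType.
Definition coefsum K (y : nat -> S) : {poly S} := \poly_(k < K) y k.

Lemma coefsum_lt K L y : (K <= L)%N -> eq_modX K (coefsum K y) (coefsum L y).
Proof. by move=> le k lk; rewrite !coef_poly lk (leq_trans lk le). Qed.

Lemma coef_sum_coefsum h K (y z : 'I_h -> nat -> S) k : (k < K)%N ->
  (\sum_(l < h) coefsum k.+1 (y l) * coefsum k.+1 (z l))`_k =
  (\sum_(l < h) coefsum K (y l) * coefsum K (z l))`_k.
Proof.
move=> lk; rewrite !coef_sum; apply: eq_bigr => l _.
by apply: (eq_modXM (coefsum_lt _ lk) (coefsum_lt _ lk)).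
Qed.

Lemma coef_prod_pairs n K (y z : 'I_n -> nat -> S) k :
  (\prod_a (coefsum K (y a) * coefsum K (z a)))`_k =
  \sum_(x : {ffun 'I_n -> 'I_K * 'I_K} | \sum_a ((x a).1 + (x a).2)%N == k)
     \prod_a (y a (x a).1 * z a (x a).2).
Proof.
have e a : coefsum K (y a) * coefsum K (z a) =
    \sum_(kl : 'I_K * 'I_K) (y a kl.1 * z a kl.2)%:P * 'X^(kl.1 + kl.2).
  rewrite /coefsum !poly_def big_distrlr /=.
  rewrite (pair_big xpredT xpredT (fun i j : 'I_K => (y a i *: 'X^i) * (z a j *: 'X^j))).
  by apply: eq_bigr => kl _ /=; rewrite -!mul_polyC exprD polyCM mulrACA.
under eq_bigr => a _ do rewrite e.
rewrite bigA_distr_bigA coef_sum [RHS]big_mkcond; apply: eq_bigr => x _.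
rewrite big_split /= -(big_morph _ (@polyCM S) (erefl _)) coefCM.
rewrite -(big_morph (fun m => 'X^m : {poly S}) (exprD 'X) (expr0 _)) coefXn.
by rewrite eq_sym; case: eqP; rewrite ?mulr1 ?mulr0.
Qed.

Lemma coef_det_sum n h K (y z : 'I_n -> 'I_h -> nat -> S) k :
  (\det (\matrix_(a < n, b < n) \sum_(l < h) coefsum K (y a l) * coefsum K (z b l)))`_k =
  \sum_(f : {ffun 'I_n -> 'I_h} | injectiveb f) \sum_(s : 'S_n)
  \sum_(x : {ffun 'I_n -> 'I_K * 'I_K} | \sum_a ((x a).1 + (x a).2)%N == k)
     (-1) ^+ s * \prod_a (y a (f a) (x a).1 * z (s a) (f a) (x a).2).
Proof.
rewrite det_sum_prod coef_sum; apply: eq_bigr => f _.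
rewrite coef_sum; apply: eq_bigr => s _; rewrite coef_sign coef_prod_pairs.
exact: mulr_sumr.
Qed.
End Coefs.

(** * Substitution and monomials *)

Section Substitution.
Variables (I : choiceType) (S : comNzRingType) (v : I -> S).

Definition monom_eval (m : {cmonom I}) : S := \prod_(i <- finsupp m) v i ^+ m i.

Lemma monom_evalEw (d : {fset I}) (m : {cmonom I}) : (finsupp m `<=` d)%fset ->
  monom_eval m = \prod_(i <- d) v i ^+ m i.
Proof.
move=> le; rewrite /monom_eval (big_fset_incl _ le) //= => i _.
by rewrite -cmE_eq0 => /eqP ->.
Qed.

Lemma monom_eval_is_mmorphism : mmorphism monom_eval.
Proof.
split=> [m1 m2|]; last first.
  rewrite /monom_eval big1_seq // => i /andP [_]; rewrite -cmE_neq0.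
  by rewrite -[monalg.mone]/(onecm I) onecmE eqxx.
have le1 : (finsupp m1 `<=` finsupp m1 `|` finsupp m2)%fset by apply: fsubsetUl.
have le2 : (finsupp m2 `<=` finsupp m1 `|` finsupp m2)%fset by apply: fsubsetUr.
rewrite (monom_evalEw le1) (monom_evalEw le2).
rewrite (@monom_evalEw (finsupp m1 `|` finsupp m2)%fset); last by rewrite mdomD.
rewrite -big_split /=; apply: eq_bigr => i _; rewrite -exprD.
by rewrite -[monalg.mmul m1 m2]/(mulcm m1 m2) mulcmE.
Qed.

HB.instance Definition _ := monalg.isMultiplicative.Build {cmonom I} S monom_eval
  monom_eval_is_mmorphism.

(** The universal property of the ring of polynomials. *)
Definition monalg_subst : {rmorphism {malg int[{cmonom I}]} -> S} := mmap intr monom_eval.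

Lemma monalg_subst_var i : monalg_subst << ucm i >> = v i.
Proof.
have e : monalg_subst << ucm i >> = mmap intr monom_eval << ucm i >> by [].
by rewrite e mmapU mul1r /monom_eval mdomU big_seq_fset1 cmUU expr1.
Qed.
End Substitution.

Section Multiset.
Variable V : choiceType.
Notation P := {malg int[{cmonom V}]}.
Implicit Types s : seq V.

(** The monomial whose multiset of variables is s. *)
Definition mset s : {cmonom V} := foldr (fun z m => mulcm (ucm z) m) (onecm V) s.

Lemma msetE s z : mset s z = count_mem z s.
Proof. by elim: s => [|y s IH] /=; rewrite ?onecmE // mulcmE ucmE IH. Qed.

Lemma mset_cat s t : mset (s ++ t) = mulcm (mset s) (mset t).
Proof. by apply/eqP/cmP => z; rewrite mulcmE !msetE count_cat. Qed.

Lemma mset_perm s t : perm_eq s t -> mset s = mset t.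
Proof. by move=> /seq.permP e; apply/eqP/cmP => z; rewrite !msetE e. Qed.

Lemma mulcm_cancel (m m1 m2 : {cmonom V}) : mulcm m m1 = mulcm m m2 -> m1 = m2.
Proof.
move=> e; apply/eqP/cmP => z; have := congr1 (fun m : {cmonom V} => m z) e.
by rewrite !mulcmE => /addnI.
Qed.

Lemma mcoeffM_neq0 (f g : P) m : (f * g)@_m != 0 ->
  exists m1 m2, [/\ mulcm m1 m2 = m, f@_m1 != 0 & g@_m2 != 0].
Proof.
move=> ne; apply: contrapT => none; case/eqP: ne; rewrite mcoeffMl.
apply: big1 => m1 _; apply: big1 => m2 _.
case: (mmul m1 m2 =P m) => [e12|_]; last exact: mulr0n.
apply: etrans (mulr1n _) _.
have [->|n1] := eqVneq f@_m1 0; first by rewrite mul0r.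
have [->|n2] := eqVneq g@_m2 0; first by rewrite mulr0.
by case: none; exists m1, m2.
Qed.

Lemma mcoeffM_unique (f g : P) m1 m2 :
  (forall n1 n2, f@_n1 != 0 -> g@_n2 != 0 -> mulcm n1 n2 = mulcm m1 m2 -> n1 = m1) ->
  (f * g)@_(mulcm m1 m2) = f@_m1 * g@_m2.
Proof.
move=> uni.
have key n1 n2 : (f@_n1 * g@_n2) *+ (mmul n1 n2 == mulcm m1 m2) =
    if n1 == m1 then if n2 == m2 then f@_m1 * g@_m2 else 0 else 0.
  case: (n1 =P m1) => [->|ne1].
    case: (n2 =P m2) => [->|ne2]; first by rewrite eqxx mulr1n.
    by case: eqP => // /mulcm_cancel.
  case: eqP => // e; rewrite mulr1n.
  have [->|h1] := eqVneq f@_n1 0; first by rewrite mul0r.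
  have [->|h2] := eqVneq g@_n2 0; first by rewrite mulr0.
  by case: ne1; apply: uni h1 h2 e.
have big0s (T : choiceType) (A : {fset T}) (x : T) (c : int) : (x \notin A -> c = 0) ->
    \sum_(y <- A) (if y == x then c else 0) = c.
  move=> h; case: (boolP (x \in A)) => [xA|/[dup] /h -> nA].
    rewrite (big_fsetD1 x) //= eqxx big1_seq ?addr0 // => y /andP [_].
    by rewrite in_fsetD1 => /andP [/negPf ->].
  by rewrite big1 // => y _; case: ifP.
rewrite mcoeffMl; under eq_bigr => n1 _ do under eq_bigr => n2 _ do rewrite key.
have inner n1 : \sum_(n2 <- msupp g)
    (if n1 == m1 then if n2 == m2 then f@_m1 * g@_m2 else 0 else 0) =
    if n1 == m1 then f@_m1 * g@_m2 else 0.
  case: (n1 == m1); last by rewrite big1.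
  by apply: big0s => /mcoeff_outdom ->; rewrite mulr0.
under eq_bigr => n1 _ do rewrite inner.
by apply: big0s => /mcoeff_outdom ->; rewrite mul0r.
Qed.
End Multiset.

(** * The image of a symbol after factoring through h columns *)

Section SumCoef.
Variable V : choiceType.
Notation P := {malg int[{cmonom V}]}.

Lemma sum_mcoeff_neq0 (T : Type) (r : seq T) (B : pred T) (F : T -> P) m :
  (\sum_(x <- r | B x) F x)@_m != 0 -> exists2 x, B x & (F x)@_m != 0.
Proof.
move=> ne; apply: contrapT => none; case/eqP: ne; rewrite raddf_sum /=.
apply: big1 => x Bx; apply/eqP; apply: contra_notT none => n0; by exists x.
Qed.

Lemma mcoeff_signU (s : bool) (k m : {cmonom V}) :
  ((-1) ^+ s * << k >> : P)@_m = if k == m then (-1) ^+ s else 0.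
Proof.
have e : (<< k >> : P)@_m = (k == m)%:R by exact: mcoeffU1.
case: s; rewrite ?expr1 ?expr0 ?mulN1r ?mul1r ?mcoeffN e; by case: (k == m); rewrite ?oppr0.
Qed.
End SumCoef.

Lemma mem_zip_iota (T : eqType) (d : T) (s : seq T) b i x :
  (i, x) \in zip (iota b (size s)) s -> (b <= i < b + size s)%N /\ x = nth d s (i - b).
Proof.
elim: s b => //= y s IH b; rewrite in_cons => /orP [/eqP [-> ->]|/IH [h ->]].
  by rewrite leqnn subnn addnS ltnS leq_addr.
have -> : (i - b = (i - b.+1).+1)%N by lia.
by split=> //; lia.
Qed.

Lemma nth_wt n (d : 'I_n * nat) a i : (i < size a)%N -> ((nth d a i).2 <= wt a)%N.
Proof.
elim: a i => //= x a IH [|i] li; rewrite /wt /=; first exact: leq_addr.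
by apply: leq_trans (leq_addl _ _); apply: IH.
Qed.

Lemma wt_sum n (d : 'I_n * nat) a : wt a = (\sum_(i < size a) (nth d a i).2)%N.
Proof. by rewrite /wt /unzip2 sumnE big_map (big_nth d) big_mkord. Qed.

Section Phi.
Variables (p q h : nat) (i0 : 'I_p) (j0 : 'I_q).
Notation E := (Esym p q).
Notation J := (Jsym p q).
Notation R := (arc_ring p q).
Implicit Types (F G : E) (j : J).

(** The variables of the two factors: the index of the column comes first, and
    inl stands for the first factor, inr for the second one. *)
Definition factor_var : choiceType := Choice.clone (nat * (('I_p * nat) + ('I_q *
  nat)))%type _.
Notation P := {malg int[{cmonom factor_var}]}.

Definition avar (l : nat) (x : 'I_p * nat) : factor_var := (l, inl x).
Definition bvar (l : nat) (x : 'I_q * nat) : factor_var := (l, inr x).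

Definition aseries K (l : nat) i : {poly P} := coefsum K (fun k => << ucm (avar l (i,
  k)) >>).
Definition bseries K (l : nat) (j : 'I_q) : {poly P} :=
  coefsum K (fun k => << ucm (bvar l (j, k)) >>).

Definition var_image (z : arc_idx p q) : P :=
  let: (i, j, k) := z in (\sum_(l < h) aseries k.+1 l i * bseries k.+1 l j)`_k.

Definition column_subst : {rmorphism R -> P} := monalg_subst var_image.
Notation phi := column_subst.

Lemma phi_xseries K i (j : 'I_q) :
  eq_modX K (map_poly phi (xseries K i j)) (\sum_(l < h) aseries K l i * bseries K l j).
Proof.
move=> k lk; rewrite coef_map coef_xseries lk.
have e0 : phi (xvar i j k) = (\sum_(l < h) aseries k.+1 l i * bseries k.+1 l j)`_k.
  exact: (monalg_subst_var var_image ((i, j, k) : arc_idx p q)).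
apply: etrans e0 _.
exact: (coef_sum_coefsum (fun (l : 'I_h) k => << ucm (avar l (i, k)) >>)
  (fun (l : 'I_h) k => << ucm (bvar l (j, k)) >>)).
Qed.

Definition ent : Type := (nat * (('I_p * nat) * ('I_q * nat)))%type.
Definition entry_vars (s : seq ent) : seq factor_var :=
  flatten [seq [:: avar x.1 x.2.1; bvar x.1 x.2.2] | x <- s].

Lemma entry_vars_prod s : << mset (entry_vars s) >> =
  \prod_(e <- s) (<< ucm (avar e.1 e.2.1) >> * << ucm (bvar e.1 e.2.2) >>) :> P.
Proof.
elim: s => [|e s IH]; first by rewrite big_nil.
rewrite big_cons; apply: etrans (malgUM _ _) _.
apply: etrans (congr1 (fun y => _ * y) (malgUM _ _)) _.
by apply: etrans (mulrA _ _ _) _; apply: (congr1 (fun y : P => _ * y)).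
Qed.

Section Expand.
Variables (K n : nat) (r : seq 'I_p) (c : seq 'I_q).
Hypotheses (sr : size r = n) (sc : size c = n).

Definition word (f : 'I_n -> 'I_h) (s : 'S_n) (x : 'I_n -> 'I_K * 'I_K) : seq ent :=
  [seq (val (f a), ((nth i0 r a, val (x a).1), (nth j0 c (s a), val (x a).2)))
     | a <- enum 'I_n].

Lemma phi_minor_coef k : (k < K)%N -> phi (minor_coef i0 j0 K r c k) =
  \sum_(f : {ffun 'I_n -> 'I_h} | injectiveb f) \sum_(s : 'S_n)
  \sum_(x : {ffun 'I_n -> 'I_K * 'I_K} | \sum_a ((x a).1 + (x a).2)%N == k)
     (-1) ^+ s * << mset (entry_vars (word f s x)) >>.
Proof.
move=> lk; rewrite /minor_coef sr -coef_map -(natdet_map (map_poly phi)).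
pose M := \matrix_(a < n, b < n) \sum_(l < h) aseries K l (nth i0 r a) * bseries K l (nth
  j0 c b).
apply: etrans (_ : (\det M)`_k = _).
  apply: eq_modX_det lk => a b; rewrite !mxE; exact: phi_xseries.
rewrite (coef_det_sum K (fun (a : 'I_n) (l : 'I_h) k => << ucm (avar l (nth i0 r a, k)) >>)
   (fun (b : 'I_n) (l : 'I_h) k => << ucm (bvar l (nth j0 c b, k)) >>)).
apply: eq_bigr => f _; apply: eq_bigr => s _; apply: eq_bigr => x _.
apply: (congr1 (fun y : P => (-1) ^+ s * y)); apply: esym;
  apply: etrans (entry_vars_prod _) _.
by rewrite big_map big_enum.
Qed.
End Expand.

(** The entries of a representative of j are put into distinct columns, in any
    order. *)
Definition monomial_of j (m : {cmonom factor_var}) := exists F cols,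
  [/\ Enorm F = j, size cols = Esz F, uniq cols & m = mset (entry_vars (zip cols (val F)))].

Lemma Jval_minor_coef j : Jval j = minor_coef i0 j0 (Jwt j).+1 (Jrow j) (Jcol j) (Jwt j).
Proof. exact: nderiv_minor. Qed.

Lemma phi_monomial_of j m : (phi (Jval j))@_m != 0 -> monomial_of j m.
Proof.
rewrite Jval_minor_coef (@phi_minor_coef _ (Jsz j)) ?size_Jrow ?size_Jcol //.
move=> /sum_mcoeff_neq0 [f injf] /sum_mcoeff_neq0 [s _] /sum_mcoeff_neq0 [x /eqP ex].
rewrite mcoeff_signU; case: (mset _ =P m) => [em _|_]; last by rewrite eqxx.
pose a := [seq (nth i0 (Jrow j) (val a), val (x a).1) | a <- enum 'I_(Jsz j)].
pose b := [seq (nth j0 (Jcol j) (s a), val (x a).2) | a <- enum 'I_(Jsz j)].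
have sab : size a = size b by rewrite !size_map.
have ea : unzip1 a = Jrow j.
  rewrite /unzip1 -map_comp -[RHS](mkseq_nth i0) /mkseq size_Jrow -val_enum_ord -map_comp.
  exact: eq_map.
have eb : perm_eq (unzip1 b) (Jcol j).
  have -> : unzip1 b = map (nth j0 (Jcol j)) (map val (map s (enum 'I_(Jsz j)))).
    by rewrite /unzip1 -!map_comp; apply: eq_map.
  rewrite -[X in perm_eq _ X](mkseq_nth j0) /mkseq size_Jcol -val_enum_ord.
  do 2 apply: perm_map.
  apply: uniq_perm; rewrite ?(map_inj_uniq perm_inj) ?enum_uniq // => y.
  rewrite mem_enum; apply/mapP; exists (s^-1 y)%g; rewrite ?mem_enum ?permKV //.
have sa : size a = Jsz j by rewrite size_map size_enum_ord.
have [||| F er ec] := E_make sab.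
- by rewrite sa Jsz_gt0.
- by rewrite ea uniq_Jrow.
- by rewrite (perm_uniq eb) uniq_Jcol.
have eF : val F = zip a b by rewrite -er -ec zip_sides.
exists F, [seq val (f a) | a <- enum 'I_(Jsz j)]; split.
- apply/EnormP; rewrite er ec ea; split=> //.
  rewrite Ewt_sides er ec /wt /unzip2 !sumnE -!map_comp !big_map -big_split /=.
  by apply: etrans _ ex; rewrite -[RHS]big_enum enumT.
- by rewrite size_map size_enum_ord -sa -er size_Erow.
- rewrite map_inj_uniq ?enum_uniq //; apply: inj_comp val_inj _.
  exact/injectiveP.
rewrite -em; congr (mset (entry_vars _)); rewrite eF /a /b.
by rewrite zip_map zip_map.
Qed.

(** A matrix factored through h columns has rank at most h. *)
Lemma phi_kills j : (h < Jsz j)%N -> phi (Jval j) = 0.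
Proof.
move=> lt; rewrite Jval_minor_coef (@phi_minor_coef _ (Jsz j)) ?size_Jrow ?size_Jcol //.
apply: big1 => f /injectiveP /leq_card; rewrite !card_ord; lia.
Qed.

(** The i-th entry of F is put into column i. *)
Definition mon F : {cmonom factor_var} := mset (entry_vars (zip (iota 0 (Esz F)) (val F))).

Lemma mem_entry_vars_a s l x : avar l x \in entry_vars s ->
  exists2 e, e \in s & e.1 = l /\ e.2.1 = x.
Proof.
move=> /flattenP [_ /mapP [e es ->]]; rewrite !inE => /orP [/eqP [-> ->]|/eqP //].
by exists e.
Qed.

Lemma mem_entry_vars_b s l x : bvar l x \in entry_vars s ->
  exists2 e, e \in s & e.1 = l /\ e.2.2 = x.
Proof.
move=> /flattenP [_ /mapP [e es ->]]; rewrite !inE => /orP [/eqP //|/eqP [-> ->]].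
by exists e.
Qed.

Lemma entry_vars_a s e : e \in s -> avar e.1 e.2.1 \in entry_vars s.
Proof. by move=> es; apply/flattenP; eexists; [exact: map_f es|rewrite !inE eqxx]. Qed.

Lemma entry_vars_b s e : e \in s -> bvar e.1 e.2.2 \in entry_vars s.
Proof. by move=> es; apply/flattenP; eexists; [exact: map_f es|rewrite !inE eqxx orbT]. Qed.

Lemma mset_mem (s t : seq factor_var) z : mset s = mset t -> z \in s -> z \in t.
Proof. by move=> e; rewrite -!has_pred1 !has_count -!msetE e. Qed.

Lemma symbol_vars_a F l x : avar l x \in entry_vars (zip (iota 0 (Esz F)) (val F)) ->
  (l < Esz F)%N /\ x = nth (i0, 0%N) (Erow F) l.
Proof.
move=> /mem_entry_vars_a [[l' e] /= /(mem_zip_iota ((i0, 0%N), (j0, 0%N))) [h1 h2] [<- <-]].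
by rewrite h2 subn0 /Erow /unzip1 (nth_map ((i0, 0%N), (j0, 0%N))).
Qed.

Lemma symbol_vars_b F l x : bvar l x \in entry_vars (zip (iota 0 (Esz F)) (val F)) ->
  (l < Esz F)%N /\ x = nth (j0, 0%N) (Ecol F) l.
Proof.
move=> /mem_entry_vars_b [[l' e] /= /(mem_zip_iota ((i0, 0%N), (j0, 0%N))) [h1 h2] [<- <-]].
by rewrite h2 subn0 /Ecol /unzip2 (nth_map ((i0, 0%N), (j0, 0%N))).
Qed.

(** As the indices of the rows, and of the columns, are distinct, the monomial
    determines the term of the expansion where it occurs. *)
Lemma phi_mon F : (Esz F <= h)%N -> (phi (Jval (Enorm F)))@_(mon F) != 0.
Proof.
move=> lh; pose K := (Ewt F).+1; pose n := Esz F.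
pose r := unzip1 (Erow F); pose c := unzip1 (Ecol F).
have sr : size r = n by rewrite size_urow.
have sc : size c = n by rewrite size_ucol.
have [ew pr pc] := (EnormP F _).1 (erefl (Enorm F)).
have [b eb] : exists b : bool, minor_coef i0 j0 K r c (Ewt F) = (-1) ^+ b * Jval (Enorm F).
  rewrite ew; apply: minor_coef_Jval; rewrite -?ew //; by rewrite perm_sym.
suff : (phi (minor_coef i0 j0 K r c (Ewt F)))@_(mon F) != 0.
  rewrite eb rmorphM rmorph_sign; case: b {eb} => //.
    by rewrite expr1 mulN1r mcoeffN oppr_eq0.
  by rewrite expr0 mul1r.
rewrite (@phi_minor_coef _ n) // raddf_sum /=.
pose f0 : {ffun 'I_n -> 'I_h} := [ffun a => widen_ord lh a].
have wr a : (a < n)%N -> ((nth (i0, 0) (Erow F) a).2 <= Ewt F)%N.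
  move=> la; rewrite Ewt_sides; apply: leq_trans (leq_addr _ _).
  by apply: nth_wt; rewrite size_Erow.
have wc a : (a < n)%N -> ((nth (j0, 0) (Ecol F) a).2 <= Ewt F)%N.
  move=> la; rewrite Ewt_sides; apply: leq_trans (leq_addl _ _).
  by apply: nth_wt; rewrite size_Ecol.
pose x0 : {ffun 'I_n -> 'I_K * 'I_K} :=
  [ffun a : 'I_n => (inord (nth (i0, 0%N) (Erow F) a).2, inord (nth (j0,
    0%N) (Ecol F) a).2)].
have key (f : {ffun 'I_n -> 'I_h}) s (x : {ffun 'I_n -> 'I_K * 'I_K}) :
    mset (entry_vars (word r c f s x)) = mon F -> [/\ f = f0, s = 1%g & x = x0].
  move=> em.
  have memw a : (val (f a), ((nth i0 r a, val (x a).1), (nth j0 c (s a), val (x a).2)))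
      \in word r c f s x by apply: map_f; rewrite mem_enum.
  have ha a := symbol_vars_a (mset_mem em (entry_vars_a (memw a))).
  have hb a := symbol_vars_b (mset_mem em (entry_vars_b (memw a))).
  have fa a : val (f a) = a.
    have [lf /= e] := ha a; apply/eqP; rewrite eq_sym.
    rewrite -(nth_uniq i0 _ _ (uniq_Erow F)) ?size_urow //.
    have := congr1 fst e; rewrite /= /r => ->.
    by rewrite (nth_map (i0, 0%N)) ?size_Erow.
  split.
  - by apply/ffunP => a; apply: val_inj; rewrite fa ffunE.
  - apply/permP => a; rewrite perm1; apply: val_inj => /=; apply/eqP.
    have [lf /= e] := hb a.
    rewrite -(nth_uniq j0 _ _ (uniq_Ecol F)) ?size_ucol //.
    have := congr1 fst e; rewrite /= /c fa => ->.
    by rewrite (nth_map (j0, 0%N)) ?size_Ecol.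
  apply/ffunP => a; rewrite ffunE [LHS]surjective_pairing.
  have [lf /(congr1 snd) /= ea] := ha a.
  have [_ /(congr1 snd) /= ebb] := hb a.
  by congr pair; apply: val_inj; rewrite /= inordK ?ltnS -?fa ?ea ?ebb ?wr ?wc ?fa.
have injf0 : injectiveb f0.
  by apply/injectiveP => a a'; rewrite !ffunE => /(congr1 val) /= e; apply: val_inj.
have x0E a : (val (x0 a).1 = (nth (i0, 0) (Erow F) a).2)%N /\
             (val (x0 a).2 = (nth (j0, 0) (Ecol F) a).2)%N.
  by rewrite ffunE /= !inordK ?ltnS ?wr ?wc.
have sx0 : (\sum_a ((x0 a).1 + (x0 a).2))%N == Ewt F.
  apply/eqP; rewrite Ewt_sides (wt_sum (i0, 0%N)) (wt_sum (j0, 0%N)).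
  rewrite size_Erow size_Ecol -big_split /=.
  by apply: eq_bigr => a _; have [-> ->] := x0E a.
have em0 : mset (entry_vars (word r c f0 (1 : 'S_n)%g x0)) = mon F.
  congr (mset (entry_vars _)); rewrite /word.
  pose d := ((i0, 0%N), (j0, 0%N)).
  rewrite -[in RHS](mkseq_nth d (val F)) /mkseq -/(Esz F) -[X in zip X _]map_id.
  rewrite zip_map -val_enum_ord -[RHS]map_comp; apply: eq_map => a /=.
  have [-> ->] := x0E a; rewrite perm1 ffunE /= /r /c.
  rewrite !(nth_map d) ?size_Erow ?size_Ecol ?(nth_map (i0, 0%N)) ?(nth_map (j0,
    0%N)) ?size_Erow ?size_Ecol //.
  by rewrite /Erow /Ecol !(nth_map d) //; case: (nth d (val F) a) => -[u k] [v l].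
have neq1 (f : {ffun 'I_n -> 'I_h}) (s : 'S_n) (x : {ffun 'I_n ->
  'I_K * 'I_K}) : ~ [/\ f = f0, s = 1%g & x = x0] ->
    ((-1) ^+ s * << mset (entry_vars (word r c f s x)) >> : P)@_(mon F) = 0.
  by move=> ne; rewrite mcoeff_signU; case: (mset _ =P mon F) => // /key.
rewrite (big_only1 f0) //=; last first.
  move=> f nf _; rewrite raddf_sum; apply: big1 => s _; rewrite raddf_sum.
  apply: big1 => x _; apply: neq1 => -[e _ _]; by rewrite e eqxx in nf.
rewrite raddf_sum (big_only1 1%g) //=; last first.
  move=> s ns _; rewrite raddf_sum.
  apply: big1 => x _; apply: neq1 => -[_ e _]; by rewrite e eqxx in ns.
rewrite raddf_sum (big_only1 x0) //=; last first.
  move=> x nx _; apply: neq1 => -[_ _ e]; by rewrite e eqxx in nx.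
by rewrite mcoeff_signU em0 eqxx odd_perm1.
Qed.
End Phi.

(** * Leading monomials of standard products *)

Section EOrder.
Variables (p q : nat).
Notation E := (Esym p q).
Implicit Types (F G H : E) (o : option E).

Lemma Eprec_irr F : ~ Eprec F F.
Proof. by rewrite /Eprec !ltnn ltxx !eqxx. Qed.

Lemma Eprec_trans F G H : Eprec F G -> Eprec G H -> Eprec F H.
Proof.
rewrite /Eprec; case/orP => [l1|/andP [/eqP e1 h1]]; case/orP => [l2|/andP [/eqP e2 h2]].
- by rewrite (ltn_trans l2 l1).
- by rewrite -e2 l1.
- by rewrite e1 l2.
rewrite e1 e2 eqxx ltnn /=.
case/orP: h1 => [l1|/andP [/eqP w1 h1]]; case/orP: h2 => [l2|/andP [/eqP w2 h2]].
- by rewrite (ltn_trans l1 l2).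
- by rewrite -w2 l1.
- by rewrite w1 l2.
by rewrite w1 w2 eqxx (lt_trans h1 h2) orbT.
Qed.

Lemma Ele_trans F G H : Ele F G -> Ele G H -> Ele F H.
Proof.
rewrite /Ele; elim: (val F) (val G) (val H) => [|a s IH] [|b t] [|c u] //=.
rewrite !ltnS => /and3P [l1 /andP [h1 h2] h3] /and3P [l2 /andP [h4 h5] h6].
have /andP [-> ->] := IH t u (introT andP (conj l1 h3)) (introT andP (conj l2 h6)).
by rewrite (le_trans h1 h4) (le_trans h2 h5).
Qed.

Lemma Ble_trans o G H : Ble o G -> Ele G H -> Ble o H.
Proof. by case: o => //= F; apply: Ele_trans. Qed.

Lemma pointwise_le_lexi (s t : seq (nat *l nat)) : size s = size t ->
  all (fun xy => xy.1 <= xy.2)%O (zip s t) -> (s <= t :> seqlexi (nat *l nat))%O.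
Proof.
elim: s t => [|x s IH] [|y t] //= [e] /andP [h /(IH _ e) h'].
by rewrite lexi_cons h h' implybT.
Qed.

Lemma zip_map2 (T U V W : Type) (f : T -> V) (g : U -> W) s t :
  zip (map f s) (map g t) = [seq (f x.1, g x.2) | x <- zip s t].
Proof. by elim: s t => [|x s IH] [|y t] //=; rewrite IH. Qed.

Lemma Ele_prec F G : Esz F = Esz G -> Ele F G -> F = G \/ Eprec F G.
Proof.
move=> es /andP [_ h].
have [->|ne] := pselect (F = G); [by left|right].
have lw : (Ewt F <= Ewt G)%N.
  rewrite /Ewt; move: es h; rewrite /Esz.
  elim: (val F) (val G) => [|a s IH] [|b t] //= [e] /andP [/andP [h1 h2] h3].
  rewrite !big_cons; apply: leq_add (IH _ e h3).
  by move: h1 h2; rewrite !le_letterE /=; lia.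
have ll : (Eword F <= Eword G)%O.
  apply: pointwise_le_lexi; first by rewrite /Eword !size_cat !size_map !size_rev -!/(Esz
    _) es.
  rewrite /Eword zip_cat ?size_map ?size_rev -?/(Esz _) ?es // all_cat !zip_map2.
  by rewrite -!rev_zip // !all_map !all_rev -all_predI.
rewrite /Eprec -!/(Esz _) es ltnn eqxx /=.
case: ltngtP lw => //= ew _; rewrite lt_neqAle ll andbT.
by apply/eqP => /(Eword_inj es).
Qed.

Fixpoint Echain o t : Prop := if t is F :: t' then Ble o F /\ Echain (Some F) t' else True.
Fixpoint best_chain o t : Prop := if t is F :: t' then best o F /\ best_chain (Some F) t'
  else True.

Lemma best_chainW o t : best_chain o t -> Echain o t.
Proof. by elim: t o => //= F t IH o [[[_ h] _] /IH]. Qed.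

Lemma Estandard_best_chain t : Estandard t -> best_chain None t.
Proof.
have hs F s : standard_from F s -> best_chain (Some F) s.
  elim: s F => //= G s IH F [_ b /IH]; by split.
case: t => //= F t [[h1 h2] /hs]; split=> //; split=> // G [eG _]; exact: h2.
Qed.

Lemma Echain_ge F t G : Echain (Some F) t -> G \in t -> Ele F G.
Proof.
elim: t F => //= H t IH F [h c]; rewrite in_cons => /orP [/eqP -> //|/(IH _ c)].
exact: Ele_trans.
Qed.

Fixpoint chain_prec (t t' : seq E) : Prop := if t is F :: s then
  if t' is F' :: s' then Eprec F F' \/ (F = F' /\ chain_prec s s') else False else False.

Lemma chain_prec_irr t : ~ chain_prec t t.
Proof. by elim: t => //= F t IH [/Eprec_irr|[_ /IH]]. Qed.

Lemma chain_prec_trans t1 t2 t3 : chain_prec t1 t2 -> chain_prec t2 t3 -> chain_prec t1 t3.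
Proof.
elim: t1 t2 t3 => //= F1 t1 IH [//|F2 t2] [//|F3 t3] [l1|[-> l1]] [l2|[<- l2]].
- by left; apply: Eprec_trans l1 l2.
- by left.
- by left.
by right; split=> //; apply: IH l1 l2.
Qed.
End EOrder.

Lemma exists_maximal (T : eqType) (lt : T -> T -> Prop) (s : seq T) :
  (forall x, ~ lt x x) -> (forall x y z, lt x y -> lt y z -> lt x z) ->
  s != [::] -> exists2 x, x \in s & forall y, y \in s -> ~ lt x y.
Proof.
move=> irr tr; elim: s => // x s IH _.
have [->|/IH [y ys hy]] := eqVneq s [::].
  by exists x; rewrite ?mem_head // => y; rewrite inE => /eqP ->.
have [l|nl] := pselect (lt y x).
  exists x; first exact: mem_head.
  move=> z; rewrite in_cons => /orP [/eqP -> //|zs] l'.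
  by apply: (hy z zs); apply: tr l l'.
exists y; first by rewrite in_cons ys orbT.
by move=> z; rewrite in_cons => /orP [/eqP -> //|/hy].
Qed.

Section Dominate.
Variables (p q h : nat) (i0 : 'I_p) (j0 : 'I_q).
Notation E := (Esym p q).
Notation J := (Jsym p q).
Implicit Types (F G H : E) (o : option E) (t : seq E).
Notation factor_var := (factor_var p q).
Notation ent := (ent p q).
Notation avar := (@avar p q).
Notation bvar := (@bvar p q).
Notation d := ((i0, 0%N), (j0, 0%N)).

Definition symbol_vars F : seq factor_var := entry_vars (zip (iota 0 (Esz F)) (val F)).
Definition chain_vars t : seq factor_var := flatten [seq symbol_vars F | F <- t].

(** F is the first element of the chain, so its letters are the smallest ones in
    each column. *)
Lemma chain_vars_bound F t l : Echain (Some F) t ->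
  (forall x, avar l x \in chain_vars (F :: t) ->
     (l < Esz F)%N /\ (letter (nth (i0, 0%N) (Erow F) l) <= letter x)%O) /\
  (forall x, bvar l x \in chain_vars (F :: t) ->
     (l < Esz F)%N /\ (letter (nth (j0, 0%N) (Ecol F) l) <= letter x)%O).
Proof.
move=> ch.
have ge G : G \in F :: t -> G = F \/ Ele F G.
  by rewrite in_cons => /orP [/eqP ->|/(Echain_ge ch)]; [left|right].
have nth_le G : Ele F G -> (l < Esz G)%N ->
    [/\ (l < Esz F)%N, (letter (nth (i0, 0%N) (Erow F) l) <= letter (nth (i0,
      0%N) (Erow G) l))%O
     & (letter (nth (j0, 0%N) (Ecol F) l) <= letter (nth (j0, 0%N) (Ecol G) l))%O].
  move=> /andP [le /(all_nthP (d, d)) hz] ll.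
  have lF : (l < Esz F)%N by apply: leq_trans ll le.
  have := hz l; rewrite size_zip -!/(Esz _) (minn_idPr le) => /(_ ll).
  rewrite nth_zip_cond size_zip -!/(Esz _) (minn_idPr le) ll /=.
  by rewrite /Erow /Ecol /unzip1 /unzip2 !(nth_map d) // => /andP [].
split=> x /flattenP [_ /mapP [G /ge hG ->]].
- move=> /(symbol_vars_a i0 j0) [lG ->]; case: hG => [eG|/nth_le /(_ lG) [] //].
  by rewrite -eG.
move=> /(symbol_vars_b i0 j0) [lG ->]; case: hG => [eG|/nth_le /(_ lG) [] //].
by rewrite -eG.
Qed.

Lemma entry_vars_perm (s t : seq ent) : perm_eq s t ->
  perm_eq (entry_vars s) (entry_vars t).
Proof. by move=> e; apply: perm_flatten; apply: perm_map. Qed.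

Lemma E_perm F (s : seq (('I_p * nat) * ('I_q * nat))) : perm_eq s (val F) ->
  exists2 G, val G = s & Enorm G = Enorm F.
Proof.
move=> e; have hs : is_E s.
  have /and3P [h1 h2 h3] := valP F; apply/and3P; split.
  - by rewrite (perm_size e).
  - by rewrite (perm_uniq (perm_map _ e)).
  - by rewrite (perm_uniq (perm_map _ e)).
exists (Sub s hs : E); first exact: SubK.
have [h1 h2 h3] := (EnormP F _).1 (erefl (Enorm F)).
apply/EnormP; split.
- by rewrite -h1 /Ewt; apply: perm_big.
- by apply: perm_trans h2; apply: perm_map; apply: perm_map.
- by apply: perm_trans h3; apply: perm_map; apply: perm_map.
Qed.

(** Let F0 be the representative of F' whose monomial m1 divides that of the
    chain. It uses columns of F only. If it uses fewer, F' is shorter than F, so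
    F precedes F'. If not, its entries can be sorted by column, and entry by
    entry they are at least those of F. So F precedes or equals F0, which
    precedes or equals F' since F' is best. *)
Lemma chain_step o F t F' m1 m2 : Ble o F -> Echain (Some F) t -> best o F' ->
  monomial_of (Enorm F') m1 -> mulcm m1 m2 = mset (chain_vars (F :: t)) ->
  Eprec F F' \/ (F = F' /\ m1 = mset (symbol_vars F)).
Proof.
move=> oF ch bF' [F0 [cols [eF0 sc uc ->]]] em.
have bnd e : e \in zip cols (val F0) -> [/\ (e.1 < Esz F)%N,
    (letter (nth (i0, 0%N) (Erow F) e.1) <= letter e.2.1)%O
   & (letter (nth (j0, 0%N) (Ecol F) e.1) <= letter e.2.2)%O].
  move=> es.
  have sub z : z \in entry_vars (zip cols (val F0)) -> z \in chain_vars (F :: t).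
    have := congr1 (fun m : {cmonom factor_var} => m z) em; rewrite /= mulcmE !msetE.
    by rewrite -!has_pred1 !has_count => <- hz; apply: leq_trans hz (leq_addr _ _).
  have [ha hb] := chain_vars_bound e.1 ch.
  have [l1 l2] := ha _ (sub _ (entry_vars_a es));
    have [_ l3] := hb _ (sub _ (entry_vars_b es)).
  by split.
have szc : size cols = size (val F0) by [].
have cb : {subset cols <= iota 0 (Esz F)}.
  move=> l; rewrite -(@unzip1_zip _ _ cols (val F0)) ?szc // => /mapP [e /bnd [le _ _] ->].
  by rewrite mem_iota.
have le : (Esz F' <= Esz F)%N.
  by rewrite -(Enorm_sz eF0) -sc -[leqRHS](size_iota 0); apply: uniq_leq_size.
move: le; rewrite leq_eqVlt => /orP [/eqP es|lt]; last by left; apply: Eprec_size.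
have sF0 : Esz F0 = Esz F by rewrite -es (Enorm_sz eF0).
have pc : perm_eq cols (iota 0 (Esz F)).
  apply: uniq_perm => //; first exact: iota_uniq.
  have [|_] // := uniq_min_size uc cb; by rewrite size_iota sc sF0.
pose s := sort (relpre fst leq) (zip cols (val F0)).
have ps : perm_eq s (zip cols (val F0)) by rewrite perm_sort.
have s1 : unzip1 s = iota 0 (Esz F).
  apply: (sorted_eq leq_trans anti_leq); last first.
  - by rewrite (perm_trans (perm_map _ ps)) // -/(unzip1 _) unzip1_zip ?szc.
  - exact: iota_sorted.
  by rewrite sorted_map; apply: sort_sorted => x y; apply: leq_total.
have p2 : perm_eq (unzip2 s) (val F0).
  by rewrite (perm_trans (perm_map _ ps)) // -/(unzip2 _) unzip2_zip ?szc.
have [G eG nG] := E_perm p2.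
have sG : Esz G = Esz F by rewrite (Enorm_sz nG).
have zG : zip (iota 0 (Esz F)) (val G) = s by rewrite eG -s1 zip_sides.
have em1 : mset (entry_vars (zip cols (val F0))) = mset (symbol_vars G).
  by rewrite /symbol_vars sG zG; apply/esym/mset_perm/entry_vars_perm.
have FG : Ele F G.
  rewrite /Ele -!/(Esz _) sG leqnn /=; apply/(all_nthP (d, d)) => i.
  rewrite size_zip -!/(Esz _) sG minnn => li.
  rewrite nth_zip -?/(Esz _) ?sG //=.
  have : (i, nth d (val G) i) \in zip cols (val F0).
    rewrite -(perm_mem ps) -zG; apply/(nthP (0%N, d)); exists i.
      by rewrite size_zip size_iota -/(Esz _) sG minnn.
    by rewrite nth_zip ?size_iota -/(Esz _) ?sG // nth_iota.
  move=> /bnd [_ /= h1 h2].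
  by move: h1 h2; rewrite /Erow /Ecol /unzip1 /unzip2 !(nth_map d) // => -> ->.
have FlG := Ele_prec (esym sG) FG.
have [eGF'|lGF'] := bF'.2 G (conj (etrans nG eF0) (Ble_trans oF FG)).
  case: FlG => [eFG|lFG]; last by left; rewrite -eGF'.
  by right; split; [exact: etrans eFG eGF'|rewrite em1 -eFG].
left; case: FlG => [-> //|l]; exact: Eprec_trans l lGF'.
Qed.

Fixpoint monomials_of (s : seq J) (m : {cmonom factor_var}) : Prop := if s is j :: s' then
  exists m1 m2, [/\ monomial_of j m1, monomials_of s' m2 & mulcm m1 m2 = m] else m =
    onecm _.

Notation phi := (@column_subst p q h).
Notation P := {malg int[{cmonom factor_var}]}.

Lemma phi_monomials_of (s : seq J) m : (\prod_(j <- s) phi (Jval j))@_m != 0 ->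
  monomials_of s m.
Proof.
elim: s m => [|j s IH] m; rewrite ?big_nil ?big_cons.
  by rewrite mcoeff1; case: (m =P monalg.mone) => // _; rewrite eqxx.
move=> /mcoeffM_neq0 [m1 [m2 [em h1 h2]]]; exists m1, m2; split=> //.
  exact: phi_monomial_of h1.
exact: IH.
Qed.

Lemma mset_chain_vars F t : mset (chain_vars (F :: t)) =
  mulcm (mset (symbol_vars F)) (mset (chain_vars t)).
Proof. exact: mset_cat. Qed.

Lemma mset_nil_mem (s : seq factor_var) z : mset s = onecm _ -> z \in s -> False.
Proof.
move=> e; have := congr1 (fun m : {cmonom factor_var} => m z) e; rewrite /= msetE onecmE.
by rewrite -has_pred1 has_count => ->.
Qed.

Lemma entries_neq0 F (cols : seq nat) : size cols = Esz F ->
  exists z, z \in entry_vars (zip cols (val F)).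
Proof.
move=> sc; have h0 := Esz_gt0 F; pose e := nth (0%N, d) (zip cols (val F)) 0.
exists (avar e.1 e.2.1); apply: entry_vars_a; apply: mem_nth.
by rewrite size_zip sc minnn.
Qed.

(** Triangularity of the images of the standard products with respect to the
    monomials of their chains. *)
Lemma dominate o t t' : Echain o t -> best_chain o t' ->
  monomials_of (map (@Enorm p q) t') (mset (chain_vars t)) -> t = t' \/ chain_prec t t'.
Proof.
elim: t o t' => [|F t IH] o [|F' t'] /=; first by left.
- move=> _ _ [m1 [m2 [[F0 [cols [_ sc _ ->]]] _ /mulcm_eq0 [e _]]]].
  by have [z /(mset_nil_mem e)] := entries_neq0 sc.
- move=> _ _; rewrite mset_chain_vars => /mulcm_eq0 [e _].
  by have [|z /(mset_nil_mem e)] := @entries_neq0 F (iota 0 (Esz F)); rewrite ?size_iota.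
move=> [oF ch] [bF' bt] [m1 [m2 [f1 f2 em]]].
have [l|[eF e1]] := chain_step oF ch bF' f1 em; first by right; left.
rewrite -{}eF in bt bF' *.
have e2 : m2 = mset (chain_vars t).
  by apply: (@mulcm_cancel _ (mset (symbol_vars F))); rewrite -mset_chain_vars -em e1.
by have [->|l] := IH _ _ ch bt (eq_ind _ _ f2 _ e2); [left|right; right].
Qed.

Lemma phi_chain o t : best_chain o t -> all (fun F => Esz F <= h)%N t ->
  (\prod_(F <- t) phi (Jval (Enorm F)))@_(mset (chain_vars t)) != 0.
Proof.
elim: t o => [|F t IH] o /=; first by move=> _ _; rewrite big_nil mcoeff1 eqxx.
move=> [bF bt] /andP [lF lt]; rewrite big_cons mset_chain_vars mcoeffM_unique.
  by rewrite mulf_neq0 ?(IH _ bt) //; apply: phi_mon.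
move=> n1 n2 h1 h2 e; rewrite -mset_chain_vars in e.
have [/Eprec_irr|[]] // := chain_step bF.1.2 (best_chainW bt) bF (phi_monomial_of i0 j0 h1)
  e.
Qed.
End Dominate.

(** * The basis theorem *)

Lemma collect_terms (V : zmodType) (I : eqType) (b : I -> V) (l : seq (I * int)) :
  exists c : I -> int, \sum_(x <- l) b x.1 *~ x.2 = \sum_(i <- undup (unzip1 l)) b i *~ c i.
Proof.
exists (fun i => \sum_(x <- l | x.1 == i) x.2).
have addb i : {morph (fun m => b i *~ m) : m n / m + n} by move=> m n; apply: mulrzDr.
under [RHS]eq_bigr => i _ do rewrite (big_morph _ (addb i) (mulr0z _)).
rewrite (exchange_big_dep xpredT) //= big_seq [RHS]big_seq; apply: eq_bigr => x xl.
rewrite -big_filter (@eq_filter _ _ (pred1 x.1)); last by move=> i; rewrite /= eq_sym.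
by rewrite filter_pred1_uniq ?undup_uniq ?mem_undup ?map_f // big_seq1.
Qed.

Section Larger.
Variables (p q h : nat) (i0 : 'I_p) (j0 : 'I_q).
Variables (Q : comNzRingType) (f : {rmorphism arc_ring p q -> Q}).
Hypothesis fL : forall j : Jsym p q, Jsz j = h.+1 -> f (Jval j) = 0.

Lemma rmorph_minor_coef K r c k : f (minor_coef i0 j0 K r c k) =
  (natdet (size r) (fun a b => map_poly f (xseries K (nth i0 r a) (nth j0 c b))))`_k.
Proof. by rewrite /minor_coef -coef_map -(natdet_map (map_poly f)). Qed.

(** The minors of size h + 1 vanish by hypothesis, the larger ones by expansion.
    *)
Lemma natdet_larger K n (w : nat -> 'I_p) (w' : nat -> 'I_q) k : (k < K)%N ->
  (natdet (h.+1 + n) (fun a b => map_poly f (xseries K (w a) (w' b))))`_k = 0.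
Proof.
elim: n w w' k => [|n IH] w w' k lk; last first.
  rewrite addnS.
  exact: (@natdet_vanish_up Q _ _ (fun i (j : 'I_q) => map_poly f (xseries K i j)) K (h.+1
    + n)%N IH w w' k lk).
rewrite addn0.
have := @minor_coef_vanish p q i0 j0 K Q f _ fL (mkseq w h.+1) (mkseq w' h.+1) k lk.
rewrite !size_mkseq => /(_ (erefl _) isT) e0.
apply: etrans _ (e0 _); last by move=> j _ /perm_size; rewrite size_mkseq size_Jrow.
apply: etrans _ (esym (rmorph_minor_coef _ _ _ _)); rewrite size_mkseq.
apply: (congr1 (fun P : {poly Q} => nth 0 (polyseq P) k)); apply: eq_natdet => a b la lb.
by rewrite !nth_mkseq.
Qed.

Lemma larger_vanish j : (h < Jsz j)%N -> f (Jval j) = 0.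
Proof.
move=> lt; rewrite (Jval_minor_coef i0 j0) rmorph_minor_coef size_Jrow -(subnKC lt).
exact: (natdet_larger (Jsz j - h.+1) (nth i0 (Jrow j)) (nth j0 (Jcol j)) (ltnSn _)).
Qed.
End Larger.

Section Quotient.
Variables (p q h : nat) (i0 : 'I_p) (j0 : 'I_q).
Notation E := (Esym p q).
Notation J := (Jsym p q).
Notation R := (arc_ring p q).
Implicit Types (f : R) (j : J).

Variables (Q : comNzRingType) (ph : {rmorphism R -> Q}).
Hypothesis ker_ph : forall f, (ph f == 0) = (f \in arc_ideal p q h.+1).
Hypothesis ph_surj : forall v, exists f, v = ph f.

Lemma pi_large j : (h < Jsz j)%N -> ph (Jval j) = 0.
Proof.
move=> lt; apply: (@larger_vanish p q h i0 j0 Q ph) lt => j' Lj.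
apply/eqP; rewrite ker_ph; apply/asboolP; exists [:: (1, Jval j')]; split.
  by move=> a; rewrite inE => /eqP -> /=; exists j'.
by rewrite big_seq1 mul1r.
Qed.

Lemma pi_Jmon_large (s : seq J) : ~~ all (fun j => (Jsz j <= h)%N) s -> ph (Jmon s) = 0.
Proof.
rewrite /Jmon; elim: s => //= j s IH; rewrite big_cons negb_and -ltnNge => hs.
apply: etrans (rmorphM ph _ _) _; case/orP: hs => [/pi_large ->|/IH ->].
  exact: mul0r.
exact: mulr0.
Qed.

Lemma quotient_span (v : Q) : exists (s : seq (seq J)) (c : seq J -> int),
  (forall i, i \in s -> Jstandard i /\ all (fun j => (Jsz j <= h)%N) i) /\
  v = \sum_(i <- s) ph (Jmon i) *~ c i.
Proof.
have [f ->] := ph_surj v.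
have [l [hl ef]] := span_all i0 j0 f.
pose l' := [seq x <- l | all (fun j => (Jsz j <= h)%N) x.1].
have [c ec] := collect_terms (fun i => ph (Jmon i)) l'.
exists (undup (unzip1 l')), c; split.
  move=> i; rewrite mem_undup => /mapP [x]; rewrite mem_filter => /andP [ax /hl sx] ->.
  by [].
rewrite -ec big_filter big_mkcond ef raddf_sum; apply: eq_bigr => x _.
apply: etrans (raddfMz ph _ _) _; case: ifP => // /negbT /pi_Jmon_large e.
by apply: etrans (congr1 (fun y => y *~ x.2) e) _; apply: mul0rz.
Qed.

Notation phi := (@column_subst p q h).

Lemma phi_kills_ideal f : f \in arc_ideal p q h.+1 -> phi f = 0.
Proof.
move=> /asboolP [s [hs ->]]; rewrite rmorph_sum big_seq; apply: big1 => a /hs [j sj ->].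
apply: etrans (rmorphM phi _ _) _; apply: etrans (congr1 (fun y => _ * y) _) (mulr0 _).
by apply: (phi_kills i0 j0); rewrite sj.
Qed.

(** Take a maximal chain among those with nonzero coefficients. By dominate its
    monomial does not occur in the image of any other product. *)
Lemma quotient_free (s : seq (seq J)) (c : seq J -> int) : uniq s ->
  (forall i, i \in s -> Jstandard i /\ all (fun j => (Jsz j <= h)%N) i) ->
  \sum_(i <- s) ph (Jmon i) *~ c i = 0 -> forall i, i \in s -> c i = 0.
Proof.
move=> us hs e0.
have /boolp.choice [tt htt] : forall i, exists t : seq E,
    Jstandard i -> Estandard t /\ map (@Enorm p q) t = i.
  by move=> i; have [[t ht]|ni] := pselect (Jstandard i); [exists t|exists [::]].
have ez : \sum_(i <- s) phi (Jmon i) *~ c i = 0.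
  have : phi (\sum_(i <- s) Jmon i *~ c i) = 0.
    apply: phi_kills_ideal; rewrite -ker_ph; apply/eqP; apply: etrans e0.
    apply: etrans (raddf_sum ph _ _ _) _; apply: eq_bigr => i _; exact: (raddfMz ph).
  move=> e; apply: etrans e; apply/esym; apply: etrans (raddf_sum phi _ _ _) _.
  by apply: eq_bigr => i _; exact: (raddfMz phi).
pose s' := [seq i <- s | c i != 0].
have [s0|sn0] := eqVneq s' [::].
  move=> i si; apply/eqP; apply: contraT => ci.
  have : i \in s' by rewrite mem_filter ci si.
  by rewrite s0.
have [i is' imax] := @exists_maximal _ (fun x y => chain_prec (tt x) (tt y)) s'
  (fun x => @chain_prec_irr _ _ _) (fun x y z => @chain_prec_trans _ _ _ _ _) sn0.
move: (is'); rewrite mem_filter => /andP [ci si].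
have [sti hi] := hs i si; have [est eti] := htt i sti.
have cht := Estandard_best_chain est.
pose M := mset (chain_vars (tt i)).
have phJ i' : Jstandard i' -> phi (Jmon i') = \prod_(F <- tt i') phi (Jval (Enorm F)).
  move=> /htt [_ e]; rewrite -{1}e /Jmon big_map; exact: rmorph_prod.
have coef_i : (phi (Jmon i))@_M != 0.
  rewrite phJ //; apply: (phi_chain i0 j0 cht).
  have := hi; rewrite -{1}eti all_map; apply: sub_all => F /=.
  by rewrite -(Enorm_Jsz (erefl (Enorm F))).
have coef_ne i' : i' \in s' -> i' != i -> (phi (Jmon i'))@_M = 0.
  move=> is2 ne; apply/eqP; apply: contraT => n0.
  move: (is2); rewrite mem_filter => /andP [_ /hs [sti' _]].
  have [est' eti'] := htt i' sti'.
  have fl : monomials_of i' M.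
    apply: (phi_monomials_of i0 j0 (h := h)); move: n0; rewrite /Jmon.
    by rewrite (_ : phi _ = \prod_(j <- i') phi (Jval j)) //; apply: rmorph_prod.
  rewrite -{1}eti' in fl.
  have [ett|l] := dominate i0 j0 (best_chainW cht) (Estandard_best_chain est') fl.
    by move: ne; rewrite -eti -eti' ett eqxx.
  by case: (imax i' is2).
suff : (phi (Jmon i))@_M * c i = 0 by move=> /eqP;
  rewrite mulf_eq0 (negPf coef_i) (negPf ci).
have := congr1 (mcoeff M) ez; rewrite mcoeff0 raddf_sum /= (bigD1_seq i) //=.
rewrite big1_seq ?addr0 => [|i' /andP [ne i's]]; first by rewrite raddfMz /= -mulrzr intz.
rewrite raddfMz /=; have [->|ci'] := eqVneq (c i') 0; first exact: mulr0z.
by rewrite coef_ne ?mul0rz // mem_filter ci' i's.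
Qed.
End Quotient.

Theorem theorem1p6 (p q h : nat) (hp : (0 < p)%N) (hq : (0 < q)%N) :
  Zbasis
    (fun s : seq (Jsym p q) => Jstandard s /\ all (fun J => (Jsz J <= h)%N) s)
    (fun s => \pi_({ideal_quot (arc_ideal p q h.+1)}) (\prod_(J <- s) Jval J)).
Proof.
pose ph : {rmorphism arc_ring p q -> {ideal_quot (arc_ideal p q h.+1)}} :=
  \pi_({ideal_quot (arc_ideal p q h.+1)}).
have ker f : (ph f == 0) = (f \in arc_ideal p q h.+1).
  by rewrite -(rmorph0 ph) -Quotient.idealrBE subr0.
have surj v : exists f, v = ph f by elim/quotW: v => f; exists f.
split; first exact: (quotient_free (Ordinal hp) (Ordinal hq) ker).
exact: (quotient_span (Ordinal hp) (Ordinal hq) ker surj).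
Qed.
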